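(* Assume that for each $i=1,2,3,4$ the following hold: (1) there are $L_i>0$ and a positive function $g_i$ on $E_i$ of at most polynomial growth such that $|a_i(x)-a_i(y)|\le L_i|x-y|$, $|c_i(x,z)-c_i(y,z)|\le g_i(z)|x-y|$ and $|c_i(x,z)|\le g_i(z)(1+|x|)$ for all $x,y\in\mathbb{R}^{d_i}$, $z\in E_i$; (2) $a_i$ is four times continuously differentiable and $a_i$ and all its derivatives up to order $4$ are of polynomial growth; (3) there are $\varrho_i>0$, $K_i>0$ with $f_i(z)\mathbf{1}_{\{|z|\le \varrho_i\}}\le K_i|z|^{1-d_i}$, and $\int |z|^l f_i(z)\,dz<\infty$ for every $l\ge 1$; (4) there is $c_{i,0}>0$ such that $\inf_{x}|c_i(x,z)|\ge c_{i,0}|z|$ for $z$ near the origin. Assume moreover that for $\theta\in\Theta$, $\mathbf{U}(\theta)=\mathbf{U}(\theta^* )$ implies $\theta=\theta^*$. Let $\alpha\in(0,1)$. Then, under $H_1$ (i.e. under $\mathbf{P}_{\Sigma^*}$), as $n\to\infty$, $$\mathbf{P}\Bigl(\mathbf{T}_n>\chi^2_{\bar p-q}(\alpha)\Bigr)\longrightarrow1.$$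
   Context: Model. Let $(\Omega,\mathcal{F},(\mathcal{F}_t)_{t\ge0},\mathbf{P})$ be a stochastic basis, $p_1,p_2,k_1,k_2$ positive integers with $k_1\le p_1$, $k_2\le p_2$; put $p=p_1+p_2$, $\bar p=p(p+1)/2$, $(d_1,d_2,d_3,d_4)=(k_1,p_1,p_2,k_2)$, $E_i=\mathbb{R}^{d_i}\setminus\{0\}$. The latent càdlàg $(\mathcal{F}_t)$-adapted processes $S^1=\xi$, $S^2=\delta$, $S^3=\varepsilon$, $S^4=\zeta$, with $S^i$ being $\mathbb{R}^{d_i}$-valued, satisfy $$dS^i_t=a_i(S^i_{t-})dt+\mathbf{S}_i\,dW_{i,t}+\int_{E_i}c_i(S^i_{t-},z)\,\mu_i(dt,dz),\qquad S^i_0=x_{i,0},$$ where $x_{i,0}\in\mathbb{R}^{d_i}$ is non-random, $a_i:\mathbb{R}^{d_i}\to\mathbb{R}^{d_i}$ and $c_i:\mathbb{R}^{d_i}\times E_i\to\mathbb{R}^{d_i}$ are (unknown) Borel functions, $\mathbf{S}_i\in\mathbb{R}^{d_i\times r_i}$ is constant, $W_i$ is an $r_i$-dimensional standard $(\mathcal{F}_t)$-Wiener process, and $\mu_i$ is a Poisson random measure on $\mathbb{R}_+\times E_i$ with compensator $f_i(z)\,dz\,dt$, $f_i=\lambda_{i,0}F_i$, $\lambda_{i,0}>0$, $F_i$ a probability density. For every $t\ge0$ the $\sigma$-fields $\mathcal{F}_t$, $\sigma(W_{i,u}-W_{i,t};u\ge t)$ and $\sigma(\mu_i(A\cap((t,\infty)\times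 E_i));A\subset\mathbb{R}_+\times E_i\text{ Borel})$, $i=1,2,3,4$, are independent. The observable processes are $X_{1,t}=\Lambda_1\xi_t+\delta_t\in\mathbb{R}^{p_1}$ and $X_{2,t}=\Lambda_2\eta_t+\varepsilon_t\in\mathbb{R}^{p_2}$, where the $k_2$-dimensional process $\eta$ satisfies $\eta_t=B_0\eta_t+\Gamma\xi_t+\zeta_t$; $X_t=(X_{1,t}^\top,X_{2,t}^\top)^\top$. Here $\Lambda_1\in\mathbb{R}^{p_1\times k_1}$, $\Lambda_2\in\mathbb{R}^{p_2\times k_2}$ have full column rank, $\Gamma\in\mathbb{R}^{k_2\times k_1}$, $B_0\in\mathbb{R}^{k_2\times k_2}$ has zero diagonal, and $\Psi=\mathbb{I}_{k_2}-B_0$ is non-singular. Put $\Sigma_{\xi\xi}=\mathbf{S}_1\mathbf{S}_1^\top$, $\Sigma_{\delta\delta}=\mathbf{S}_2\mathbf{S}_2^\top$, $\Sigma_{\varepsilon\varepsilon}=\mathbf{S}_3\mathbf{S}_3^\top$, $\Sigma_{\zeta\zeta}=\mathbf{S}_4\mathbf{S}_4^\top$, and $$\Sigma=\begin{pmatrix}\Sigma^{11}&\Sigma^{12}\\ \Sigma^{12\top}&\Sigma^{22}\end{pmatrix},\quad \Sigma^{11}=\Lambda_1\Sigma_{\xi\xi}\Lambda_1^\top+\Sigma_{\delta\delta},\quad \Sigma^{12}=\Lambda_1\Sigma_{\xi\xi}\Gamma^\top\Psi^{-1\top}\Lambda_2^\top,$$ $$\Sigma^{22}=\Lambda_2\Psi^{-1}(\Gamma\Sigma_{\xi\xi}\Gamma^\top+\Sigma_{\zeta\zeta})\Psi^{-1\top}\Lambda_2^\top+\Sigma_{\varepsilon\varepsilon}.$$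 $\Sigma$ is assumed positive definite. $\mathbf{P}_{\Sigma}$ denotes the law of $X$ under the model with this $\Sigma$. Parametrization. Constraints are imposed on $\Lambda_1,\Lambda_2,\Gamma,\Psi,\Sigma_{\xi\xi},\Sigma_{\delta\delta},\Sigma_{\varepsilon\varepsilon},\Sigma_{\zeta\zeta}$ (e.g. some entries are set to $0$ or $1$); $\theta\in\Theta\subset\mathbb{R}^q$ is the vector of their unknown non-duplicated elements, and the matrices are written $\Lambda_1^\theta,\Lambda_2^\theta,\Gamma^\theta,\Psi^\theta,\Sigma_{\xi\xi}^\theta,\Sigma_{\delta\delta}^\theta,\Sigma_{\varepsilon\varepsilon}^\theta,\Sigma_{\zeta\zeta}^\theta$. $\Theta$ is convex and compact. $\Sigma(\theta)$ is the (positive definite) matrix $$\Sigma(\theta)=\begin{pmatrix}\Sigma(\theta)^{11}&\Sigma(\theta)^{12}\\ \Sigma(\theta)^{12\top}&\Sigma(\theta)^{22}\end{pmatrix},\quad \Sigma(\theta)^{11}=\Lambda_1^\theta\Sigma_{\xi\xi}^\theta\Lambda_1^{\theta\top}+\Sigma_{\delta\delta}^\theta,\quad \Sigma(\theta)^{12}=\Lambda_1^\theta\Sigma_{\xi\xi}^\theta\Gamma^{\theta\top}(\Psi^\theta)^{-1\top}\Lambda_2^{\theta\top},$$ $$\Sigma(\theta)^{22}=\Lambda_2^\theta(\Psi^\theta)^{-1}(\Gamma^\theta\Sigma_{\xi\xi}^\theta\Gamma^{\theta\top}+\Sigma_{\zeta\zeta}^\theta)(\Psi^\theta)^{-1\top}\Lambda_2^{\theta\top}+\Sigma_{\varepsilon\varepsilon}^\theta;$$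 it is twice continuously differentiable in $\theta$. The test is $H_0:\Sigma=\Sigma(\theta)$ against $H_1:\Sigma\ne\Sigma(\theta)$; under $H_1$ the true value of $\Sigma$ is a fixed $\Sigma^*$ with $\Sigma^*\ne\Sigma(\theta)$ for every $\theta\in\Theta$. Put $$\mathbf{U}(\theta)=\log\det\Sigma(\theta)-\log\det\Sigma^*+\operatorname{tr}\{\Sigma(\theta)^{-1}\Sigma^*\}-p,$$ and let $\theta^*\in\Theta$ be such that $\mathbf{U}(\theta^* )=\inf_{\theta\in\Theta}\mathbf{U}(\theta)$. Observations. $X_{t_i^n}$, $i=0,\dots,n$, with $t_i^n=ih_n$ and $T=nh_n$ fixed. $\Delta_i^nX=X_{t_i^n}-X_{t_{i-1}^n}$. The constants $D>0$ and $\rho\in[1/3,1/2)$ are fixed. Estimators and test statistic. $N_n=\sum_{i=1}^n\mathbf{1}_{\{|\Delta_i^nX|\le Dh_n^\rho\}}$; $\tilde N_n=N_n$ if $N_n\ne0$ and $\tilde N_n=n$ if $N_n=0$; $$\hat\Sigma_n=\frac{1}{\tilde N_nh_n}\sum_{i=1}^n(\Delta_i^nX)(\Delta_i^nX)^\top\mathbf{1}_{\{|\Delta_i^nX|\le Dh_n^\rho\}},$$ $$\mathbf{H}_n(\theta)=-\frac12\sum_{i=1}^n\log\det\Sigma(\theta)\,\mathbf{1}_{\{|\Delta_i^nX|\le Dh_n^\rho\}}-\frac{1}{2h_n}\sum_{i=1}^n(\Delta_i^nX)^\top\Sigma(\theta)^{-1}(\Delta_i^nX)\,\mathbf{1}_{\{|\Delta_i^nX|\le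 Dh_n^\rho\}},$$ and $\hat\theta_n\in\Theta$ satisfies $\mathbf{H}_n(\hat\theta_n)=\sup_{\theta\in\Theta}\mathbf{H}_n(\theta)$. With $J_n=\{\hat\Sigma_n\text{ is positive definite}\}$, let $\tilde\Sigma_n=\hat\Sigma_n$ on $J_n$ and $\tilde\Sigma_n=\mathbb{I}_p$ on $J_n^c$. The quasi-likelihood ratio statistic is $$\mathbf{T}_n=N_n\log\det\Sigma(\hat\theta_n)-N_n\log\det\tilde\Sigma_n+N_n\operatorname{tr}\{\Sigma(\hat\theta_n)^{-1}\tilde\Sigma_n\}-N_np.$$ Notation. $\chi^2_r(\alpha)$ is the upper $\alpha$ point of the chi-squared distribution with $r$ degrees of freedom. $|\cdot|$ is the Euclidean (Frobenius) norm. *)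

(* Defs.v *)
From HB Require Import structures.
From mathcomp Require Import all_boot all_order all_algebra.
From mathcomp Require Import all_classical all_reals all_analysis.
From mathcomp Require Import measurable_realfun.

Set Implicit Arguments.
Unset Strict Implicit.
Unset Printing Implicit Defensive.

Import Order.TTheory GRing.Theory Num.Theory.
Import numFieldNormedType.Exports.

Local Open Scope classical_set_scope.
Local Open Scope ring_scope.

Definition measure_mx_display : measure_display.
Proof. exact: default_measure_display. Qed.

(* 'M[R]_(m, n) carries the product sigma-algebra, generated by the entries;
   this is the Borel sigma-algebra of R^(m x n). *)
Section measurable_mx.
Context {R : realType} (m n : nat).

Definition mx_cylinders : set (set 'M[R]_(m, n)) :=
  [set A | exists i j (B : set R),
    measurable B /\ A = (fun M : 'M[R]_(m, n) => M i j) @^-1` B].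

HB.instance Definition _ := @isMeasurable.Build measure_mx_display
  'M[R]_(m, n) <<s mx_cylinders >> (@sigma_algebra0 _ setT mx_cylinders)
  (@sigma_algebraC _ mx_cylinders) (@sigma_algebra_bigcup _ setT mx_cylinders).

End measurable_mx.

Section measurable_mx_lemmas.
Context {R : realType}.

Lemma measurable_mx_entry m n (i : 'I_m) (j : 'I_n) :
  measurable_fun setT (fun M : 'M[R]_(m, n) => M i j).
Proof.
move=> _ B mB; rewrite setTI; apply: sub_sigma_algebra.
by exists i, j, B.
Qed.

Lemma measurable_fun_mxP d (T : measurableType d) m n (f : T -> 'M[R]_(m, n)) :
  measurable_fun setT f <->
  forall i j, measurable_fun setT (fun x => f x i j).
Proof.
split=> [mf i j|mf].
  exact: (measurableT_comp (measurable_mx_entry i j) mf).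
move=> _ A mA; rewrite setTI; pose G := [set B | measurable (f @^-1` B)].
suff: <<s @mx_cylinders R m n >> `<=` G by apply.
apply: smallest_sub.
  split=> [|B GB|F GF]; rewrite /G /=.
  - by rewrite preimage_set0.
  - by rewrite setTD preimage_setC; exact: measurableC.
  - by rewrite preimage_bigcup; apply: bigcup_measurable => k _; exact: GF.
move=> _ [i [j [B [mB ->]]]]; rewrite /G /= -comp_preimage.
by rewrite -[X in measurable X]setTI; exact: mf.
Qed.

End measurable_mx_lemmas.

(* Lebesgue measure on R^d, by induction on d: it is the Dirac mass on R^0, and
   the image of lebesgue_measure \x (Lebesgue measure on R^d) under
   (x, v) |-> (x, v^T)^T on R^d.+1. *)
Section lebesgue_cV.
Context {R : realType}.

Definition cV_cons d (q : measurableTypeR R * 'cV[R]_d) : 'cV[R]_d.+1 :=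
  col_mx (q.1 : R)%:M q.2.

Lemma cV_consE0 d (q : measurableTypeR R * 'cV[R]_d) :
  cV_cons q (lshift d (ord0 : 'I_1)) ord0 = q.1.
Proof. by rewrite [LHS](col_mxEu (q.1 : R)%:M q.2) mxE eqxx mulr1n. Qed.

Lemma cV_consES d (q : measurableTypeR R * 'cV[R]_d) k :
  cV_cons q (rshift 1 k) ord0 = q.2 k ord0.
Proof. exact: (col_mxEd (q.1 : R)%:M q.2). Qed.

Lemma measurable_cV_cons d : measurable_fun setT (@cV_cons d).
Proof.
apply/measurable_fun_mxP => i j; rewrite ord1.
have [k ->|k ->] := split_ordP (i : 'I_(1 + d)).
  rewrite (ord1 k) (_ : (fun q => _) = fst); first exact: measurable_fst.
  by apply/funext => q; exact: cV_consE0.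
rewrite (_ : (fun q => _) = (fun v : 'cV[R]_d => v k ord0) \o snd).
  exact: (measurableT_comp (measurable_mx_entry k ord0) measurable_snd).
by apply/funext => q; exact: cV_consES.
Qed.

Definition lebesgue_cV_step d (m : {sigma_finite_measure set 'cV[R]_d -> \bar R})
    : set 'cV[R]_d.+1 -> \bar R :=
  pushforward (lebesgue_measure \x m)%E (@cV_cons d).

Section step.
Context d (m : {sigma_finite_measure set 'cV[R]_d -> \bar R}).

Let step0 : lebesgue_cV_step m set0 = 0%E.
Proof. by rewrite /lebesgue_cV_step /pushforward preimage_set0 measure0. Qed.

Let step_ge0 A : (0 <= lebesgue_cV_step m A)%E.
Proof. by rewrite /lebesgue_cV_step /pushforward; exact: measure_ge0. Qed.

Let step_additive : semi_sigma_additive (lebesgue_cV_step m).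
Proof.
have mf := @measurable_cV_cons d.
move=> F mF tF mUF; rewrite /lebesgue_cV_step /pushforward preimage_bigcup.
apply: measure_semi_sigma_additive.
- by move=> n; rewrite -[X in measurable X]setTI; exact: mf.
- apply/trivIsetP => /= i j _ _ ij; rewrite -preimage_setI.
  by move/trivIsetP : tF => /(_ _ _ _ _ ij) ->//; rewrite preimage_set0.
- by rewrite -preimage_bigcup -[X in measurable X]setTI; exact: mf.
Qed.

HB.instance Definition _ := isMeasure.Build _ _ _
  (lebesgue_cV_step m) step0 step_ge0 step_additive.

Let step_sigma_finite : sigma_finite setT (lebesgue_cV_step m).
Proof.
have /sigma_finiteP[F [FT Fnd Ffin]] :=
  sigma_finiteT (@lebesgue_measure R).
have /sigma_finiteP[G [GT Gnd Gfin]] := sigma_finiteT m.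
pose hd (v : 'cV[R]_d.+1) : R := v ord0 ord0.
pose tl (v : 'cV[R]_d.+1) : 'cV[R]_d := dsubmx (v : 'cV[R]_(1 + d)).
have mhd : measurable_fun setT hd by exact: measurable_mx_entry.
have mtl : measurable_fun setT tl.
  apply/measurable_fun_mxP => i j; rewrite /tl.
  by under eq_fun do rewrite mxE; exact: measurable_mx_entry.
exists (fun n => (hd @^-1` F n) `&` (tl @^-1` G n)).
  apply/seteqP; split=> // v _.
  have [n _ Fn] : (\bigcup_i F i) (hd v) by rewrite -FT.
  have [k _ Gk] : (\bigcup_i G i) (tl v) by rewrite -GT.
  exists (maxn n k) => //; split.
    by have /subsetPset := Fnd _ _ (leq_maxl n k); apply.
  by have /subsetPset := Gnd _ _ (leq_maxr n k); apply.
move=> n; split.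
  apply: measurableI; rewrite -[X in measurable X]setTI.
    by apply: mhd => //; exact: (Ffin n).1.
  by apply: mtl => //; exact: (Gfin n).1.
rewrite /lebesgue_cV_step /pushforward.
have -> : @cV_cons d @^-1` ((hd @^-1` F n) `&` (tl @^-1` G n)) = F n `*` G n.
  have hdE q : hd (@cV_cons d q) = q.1.
    by rewrite -[RHS]cV_consE0 /hd; congr (_ _ _); exact: val_inj.
  have tlE q : tl (@cV_cons d q) = q.2.
    by apply/matrixP => i j; rewrite /tl mxE ord1 cV_consES.
  by apply/seteqP; split=> q; rewrite /= hdE tlE.
rewrite product_measure1E; [|exact: (Ffin n).1|exact: (Gfin n).1].
by apply: lte_mul_pinfty => //; [rewrite ge0_fin_numE//; exact: (Ffin n).2|
  exact: (Gfin n).2].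
Qed.

HB.instance Definition _ := @Measure_isSigmaFinite.Build _ _ _
  (lebesgue_cV_step m) step_sigma_finite.

End step.

Fixpoint lebesgue_cV d : {sigma_finite_measure set 'cV[R]_d -> \bar R} :=
  match d with
  | 0%N => (@dirac _ 'cV[R]_0 0 R : {sigma_finite_measure set _ -> \bar R})
  | d'.+1 => lebesgue_cV_step (lebesgue_cV d')
  end.

End lebesgue_cV.

Section euclidean.
Context {R : realType}.

(* The library norm of a matrix is the max norm; this one is the Euclidean
   (Frobenius) norm. *)
Definition enorm m n (A : 'M[R]_(m, n)) : R :=
  Num.sqrt (\sum_i \sum_j A i j ^+ 2).

(* E = R^d \ {0}. *)
Definition nonzero {d} : set 'cV[R]_d := [set z | z != 0].

Definition posdef n (A : 'M[R]_n) : Prop :=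
  A^T = A /\ forall x : 'cV[R]_n, x != 0 -> 0 < (x^T *m A *m x) ord0 ord0.

Definition poly_growth d (D : set 'cV[R]_d) (f : 'cV[R]_d -> R) : Prop :=
  exists (C : R) (k : nat), forall x, D x -> `|f x| <= C * (1 + enorm x) ^+ k.

(* The iterated partial derivative along the coordinates listed in l (the last
   one is taken first). *)
Definition pderiv d (W : normedModType R) (l : seq 'I_d) (f : 'cV[R]_d -> W)
    : 'cV[R]_d -> W :=
  foldr (fun i g => 'D_(delta_mx i ord0) g) f l.

Definition Ck_on d (W : normedModType R) (k : nat) (O : set 'cV[R]_d)
    (f : 'cV[R]_d -> W) : Prop :=
  forall l : seq 'I_d, (size l <= k)%N ->
    (forall x, O x -> {for x, continuous (pderiv l f)}) /\
    ((size l < k)%N -> forall i x, O x ->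
      derivable (pderiv l f) x (delta_mx i ord0)).

(* On a set which need not be open, C^k means having a C^k extension to an open
   neighbourhood. *)
Definition Ck_near d (W : normedModType R) (k : nat) (D : set 'cV[R]_d)
    (f : 'cV[R]_d -> W) : Prop :=
  exists (O : set 'cV[R]_d) (g : 'cV[R]_d -> W),
    [/\ open O, D `<=` O, (forall x, D x -> g x = f x) & Ck_on k O g].

Definition vintegral d (T : measurableType d)
    (mu : {measure set T -> \bar R}) (D : set T) n (f : T -> 'cV[R]_n)
    : 'cV[R]_n :=
  \col_j \int[mu]_(x in D) (f x j ord0).

(* P(Z_1^2 + ... + Z_r^2 > c) for independent standard normal Z_1, ..., Z_r. *)
Definition chi2_tail (r : nat) (c : R) : \bar R :=
  (\int[lebesgue_cV r]_(z in [set z | (c < enorm z ^+ 2)%R])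
    (\prod_(j < r) normal_pdf 0 1 (z j ord0))%:E)%E.

Definition chi2_upper (r : nat) (alpha : R) : R :=
  get [set c | chi2_tail r c = alpha%:E].

End euclidean.

Section processes.
Context {R : realType} {dO : measure_display} {Omega : measurableType dO}.
Variable P : probability Omega R.

Definition filtration (F : R -> set (set Omega)) : Prop :=
  [/\ forall t, 0 <= t -> sigma_algebra setT (F t),
      forall t, 0 <= t -> F t `<=` measurable &
      forall s t, 0 <= s -> s <= t -> F s `<=` F t].

Definition sigma_gen (I : Type) (D : set I) d (T : measurableType d)
    (X : I -> Omega -> T) : set (set Omega) :=
  <<s [set A | exists i (B : set T), [/\ D i, measurable B & A = X i @^-1` B]] >>.

Definition mutually_independent (I : finType) (G : I -> set (set Omega)) : Prop :=
  forall (J : {set I}) (E : I -> set Omega),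
    (forall i, i \in J -> G i (E i)) ->
    fine (P (\bigcap_(i in [set` J]) E i)) = \prod_(i in J) fine (P (E i)).

Definition adapted d (T : measurableType d) (F : R -> set (set Omega))
    (X : R -> Omega -> T) : Prop :=
  forall t, 0 <= t -> forall B, measurable B -> F t (X t @^-1` B).

Definition cadlag d (X : R -> Omega -> 'cV[R]_d) : Prop :=
  forall w, (forall t, 0 <= t -> (X u w @[u --> t^'+] --> X t w)) /\
            (forall t, 0 < t -> cvg (X u w @[u --> t^'-])).

Definition left_limit d (X : R -> Omega -> 'cV[R]_d) (t : R) (w : Omega)
    : 'cV[R]_d := lim (X u w @[u --> t^'-]).

Record wiener_process (F : R -> set (set Omega)) r (W : R -> Omega -> 'cV[R]_r)
    : Prop := WienerProcess {
  wiener_adapted : adapted F W ;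
  wiener_start : {ae P, forall w, W 0 w = 0} ;
  wiener_continuous :
    {ae P, forall w, {within `[0, +oo[, continuous (fun t => W t w)}} ;
  wiener_independent : forall s t, 0 <= s -> s <= t -> forall A B,
    F s A -> measurable B ->
    let E := [set w | B (W t w - W s w)] in P (A `&` E) = (P A * P E)%E ;
  wiener_normal : forall s t, 0 <= s -> s < t -> forall B : 'I_r -> set R,
    (forall j, measurable (B j)) ->
    fine (P [set w | forall j, B j ((W t w - W s w) j ord0)]) =
    \prod_(j < r) fine (normal_prob 0 (Num.sqrt (t - s)) (B j)) }.

Definition jump_space d : set (R * 'cV[R]_d) := `[0, +oo[ `*` nonzero.

(* The measure f(z) dz dt. *)
Definition intensity d (f : 'cV[R]_d -> R) (A : set (R * 'cV[R]_d)) : \bar R :=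
  (\int[(lebesgue_measure \x lebesgue_cV d)%E]_(q in A) (f q.2)%:E)%E.

(* Only the values on subsets of jump_space matter. *)
Record poisson_random_measure (F : R -> set (set Omega)) d
    (mu : Omega -> {measure set (R * 'cV[R]_d) -> \bar R})
    (f : 'cV[R]_d -> R) : Prop := PoissonRandomMeasure {
  prm_integer : forall w A, measurable A -> A `<=` @jump_space d ->
    mu w A = +oo%E \/ exists k : nat, mu w A = (k%:R)%:E ;
  prm_adapted : forall t, 0 <= t -> forall A, measurable A ->
    A `<=` @jump_space d `&` (`[0, t] `*` setT) ->
    forall B : set (\bar R), measurable B -> F t ((fun w => mu w A) @^-1` B) ;
  prm_measurable : forall A, measurable A -> A `<=` @jump_space d ->
    measurable_fun setT (fun w => mu w A) ;
  prm_law : forall A, measurable A -> A `<=` @jump_space d ->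
    (intensity f A < +oo)%E -> forall k : nat,
    P [set w | mu w A = (k%:R)%:E] =
    (let m := fine (intensity f A) in expR (- m) * m ^+ k / k`!%:R)%:E ;
  prm_independent : forall n (A : 'I_n -> set (R * 'cV[R]_d)),
    (forall j, measurable (A j)) -> (forall j, A j `<=` @jump_space d) ->
    trivIset setT A ->
    mutually_independent
      (fun j => sigma_gen [set A j] (fun C w => mu w C)) }.

(* dS_t = a(S_{t-}) dt + M dW_t + \int_E c(S_{t-}, z) mu(dt, dz), S_0 = x0: as
   the Wiener coefficient is constant and mu has finite intensity, the equation
   is pathwise. *)
Definition sde_solution d r (x0 : 'cV[R]_d) (a : 'cV[R]_d -> 'cV[R]_d)
    (M : 'M[R]_(d, r)) (c : 'cV[R]_d -> 'cV[R]_d -> 'cV[R]_d)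
    (W : R -> Omega -> 'cV[R]_r)
    (mu : Omega -> {measure set (R * 'cV[R]_d) -> \bar R})
    (S : R -> Omega -> 'cV[R]_d) : Prop :=
  {ae P, forall w, forall t, 0 <= t ->
    S t w = x0
      + vintegral lebesgue_measure `]0, t] (fun s => a (left_limit S s w))
      + M *m W t w
      + vintegral (mu w) (`]0, t] `*` nonzero)
          (fun q => c (left_limit S q.1 w) q.2)}.

End processes.

(* The four latent processes xi, delta, epsilon, zeta. *)
Variant latent := Xi | Delta | Epsilon | Zeta.

Definition nat_of_latent (i : latent) : 'I_4 :=
  inord (match i with Xi => 0 | Delta => 1 | Epsilon => 2 | Zeta => 3 end).

Definition latent_of_nat (n : 'I_4) : latent :=
  match val n with 0 => Xi | 1 => Delta | 2 => Epsilon | _ => Zeta end.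

Lemma nat_of_latentK : cancel nat_of_latent latent_of_nat.
Proof. by case; rewrite /latent_of_nat /nat_of_latent /= inordK. Qed.

HB.instance Definition _ := Finite.copy latent (can_type nat_of_latentK).

Definition latent_dim (p1 p2 k1 k2 : nat) (i : latent) : nat :=
  match i with Xi => k1 | Delta => p1 | Epsilon => p2 | Zeta => k2 end.

Section latent_model.
Context {R : realType} {dO : measure_display} {Omega : measurableType dO}.
Variable P : probability Omega R.

(* For every t, the sigma-fields F_t, sigma(W_{i,u} - W_{i,t}; u >= t) and
   sigma(mu_i(A `&` (t, oo) x E_i); A), i ranging over latent, are independent. *)
Definition independent_drivers (F : R -> set (set Omega)) (d r : latent -> nat)
    (W : forall i, R -> Omega -> 'cV[R]_(r i))
    (mu : forall i, Omega -> {measure set (R * 'cV[R]_(d i)) -> \bar R}) : Prop :=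
  forall t, 0 <= t ->
    mutually_independent P (fun j : option (latent + latent) =>
      match j with
      | None => F t
      | Some (inl i) =>
          sigma_gen [set u | t <= u] (fun u w => W i u w - W i t w)
      | Some (inr i) =>
          sigma_gen [set A | measurable A /\ A `<=` @jump_space R (d i)]
            (fun A w => mu i w (A `&` (`]t, +oo[ `*` nonzero)))
      end).

End latent_model.

Section assumptions.
Context {R : realType} (d : nat).

Definition probability_density (f : 'cV[R]_d -> R) : Prop :=
  [/\ measurable_fun nonzero f, forall z, z != 0 -> 0 <= f z &
      (\int[lebesgue_cV d]_(z in nonzero) (f z)%:E = 1)%E].

Implicit Types (a : 'cV[R]_d -> 'cV[R]_d) (c : 'cV[R]_d -> 'cV[R]_d -> 'cV[R]_d).

Definition lipschitz_coefficients a c : Prop :=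
  exists (L : R) (g : 'cV[R]_d -> R),
    [/\ 0 < L,
        (forall z, z != 0 -> 0 < g z) /\ poly_growth nonzero g,
        forall x y, enorm (a x - a y) <= L * enorm (x - y),
        forall x y z, z != 0 -> enorm (c x z - c y z) <= g z * enorm (x - y) &
        forall x z, z != 0 -> enorm (c x z) <= g z * (1 + enorm x)].

Definition smooth_drift a : Prop :=
  Ck_on 4 setT a /\
  forall l : seq 'I_d, (size l <= 4)%N -> 
    poly_growth setT (fun x => enorm (pderiv l a x)).

Definition jump_density_condition (f : 'cV[R]_d -> R) : Prop :=
  (exists rho K : R, [/\ 0 < rho, 0 < K & forall z, z != 0 ->
      f z * (enorm z <= rho)%R%:R <= K * enorm z ^ (1 - d%:Z)]) /\
  (forall l : nat, (1 <= l)%N ->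
    (\int[lebesgue_cV d]_(z in nonzero) (enorm z ^+ l * f z)%:E < +oo)%E).

Definition jump_size_condition c : Prop :=
  exists2 c0 : R, 0 < c0 &
    \forall z \near (0 : 'cV[R]_d)^',
      c0 * enorm z <= inf [set enorm (c x z) | x in setT].

End assumptions.

Section covariance_structure.
Context {R : realType} (p1 p2 k1 k2 : nat).

Definition model_cov (L1 : 'M[R]_(p1, k1)) (L2 : 'M[R]_(p2, k2))
    (Gam : 'M[R]_(k2, k1)) (Psi : 'M[R]_k2) (Sxx : 'M[R]_k1) (Sdd : 'M[R]_p1)
    (See : 'M[R]_p2) (Szz : 'M[R]_k2) : 'M[R]_(p1 + p2) :=
  let S11 := L1 *m Sxx *m L1^T + Sdd in
  let S12 := L1 *m Sxx *m Gam^T *m (invmx Psi)^T *m L2^T in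
  let S22 := L2 *m invmx Psi *m (Gam *m Sxx *m Gam^T + Szz)
               *m (invmx Psi)^T *m L2^T + See in
  block_mx S11 S12 S12^T S22.

End covariance_structure.

(* The k-th coordinate of th is an entry of the matrix M(th). *)
Definition is_entry (R : realType) q (Theta : set 'cV[R]_q) (k : 'I_q) m n
    (M : 'cV[R]_q -> 'M[R]_(m, n)) : Prop :=
  exists i j, forall th, Theta th -> M th i j = th k ord0.

Section statistics.
Context {R : realType} (p : nat).

Definition contrast (S Sstar : 'M[R]_p) : R :=
  ln (\det S) - ln (\det Sstar) + \tr (invmx S *m Sstar) - p%:R.

Definition increment (Omega : Type) (X : R -> Omega -> 'cV[R]_p) (h : R)
    (w : Omega) (i : nat) : 'cV[R]_p := X (i.+1%:R * h) w - X (i%:R * h) w.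

(* The increment number i.+1 of the sample is dx i. *)
Variables (D rho : R) (n : nat) (h : R) (dx : nat -> 'cV[R]_p).

Definition small (i : nat) : bool := enorm (dx i) <= D * h `^ rho.

Definition num_small : nat := \sum_(i < n) small i.

Definition num_small_pos : nat := if num_small == 0%N then n else num_small.

Definition cov_estimator : 'M[R]_p :=
  (num_small_pos%:R * h)^-1 *:
    \sum_(i < n) (small i)%:R *: (dx i *m (dx i)^T).

Definition quasi_loglik (S : 'M[R]_p) : R :=
  - 2^-1 * (\sum_(i < n) ln (\det S) * (small i)%:R)
  - (2 * h)^-1 *
    \sum_(i < n) ((dx i)^T *m invmx S *m dx i) ord0 ord0 * (small i)%:R.

Definition cov_estimator_pd : 'M[R]_p :=
  if `[< posdef cov_estimator >] then cov_estimator else 1%:M.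

(* S is the fitted covariance matrix Sigma(thetahat). *)
Definition quasi_lr (S : 'M[R]_p) : R :=
  num_small%:R * ln (\det S) - num_small%:R * ln (\det cov_estimator_pd)
  + num_small%:R * \tr (invmx S *m cov_estimator_pd) - num_small%:R * p%:R.

End statistics.

(* Main.v *)
(* T_n is N_n times the contrast (Stein loss) of Sigma(thetahat_n) and the truncated
   realized covariance, and thetahat_n lies in Theta. Under H_1 the contrast with
   Sigma* is positive at its minimizer theta*, hence bounded below on Theta; being
   continuous in its second argument uniformly on the compact Theta, it stays
   bounded below as soon as the realized covariance is close to Sigma*. Since
   N_n / n -> 1, T_n then exceeds any constant.
   The jumps have finite activity and the drift is Lipschitz along a cadlag path,
   so, for almost every path, all but boundedly many increments are within O(h_n)
   of increments of a Gaussian process, and truncation at D h_n^rho costs o(1) as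
   soon as the realized covariations and fourth powers of the driving noise are
   close to their means. That closeness holds in L^1, and pathwise implications are
   turned into convergence in probability by Markov's inequality. *)

From HB Require Import structures.
Require Import Defs.
From mathcomp Require Import all_boot all_order all_algebra.
From mathcomp Require Import all_classical all_reals all_analysis.
From mathcomp Require Import measurable_realfun.
From mathcomp Require Import ring lra.

Set Implicit Arguments.
Unset Strict Implicit.
Unset Printing Implicit Defensive.

Import Order.TTheory GRing.Theory Num.Theory.
Import numFieldNormedType.Exports.

Local Open Scope classical_set_scope.
Local Open Scope ring_scope.

(** * Positive definite matrices and the contrast *)

(** The bounds on the drift and on the number of jumps are constants that depend on the path, with
    no moment control, so the error of the truncated covariance is not estimated in mean. What is
    random but independent of [n] is frozen on one path; only the Gaussian noise, whose law is
    explicit, is averaged. Its error tends to 0 in L^1 and not path by path, so the pathwise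
    argument runs along a filter on [nat] that forces the error to 0; this takes the place of
    extracting subsequences. Fourth powers enter because a jump-free increment is discarded only if
    its Gaussian part [y] satisfies [|y| >= tau / 2], where [|y|^2 <= 4 |y|^4 / tau^2]. The expected
    total is of order [n h^2 / tau^2 = T h / tau^2], which vanishes since [h / tau^2] is a multiple
    of [h^(1 - 2 rho)] and [rho < 1/2]. The Stein loss is treated by eliminating one variable at a
    time, so no eigenvalues appear. *)

Lemma posdef_congr (R : realType) n (E A : 'M[R]_n) :
  E \in unitmx -> posdef A -> posdef (E *m A *m E^T).
Proof.
move=> uE [symA posA]; split; first by rewrite !trmx_mul trmxK symA mulmxA.
move=> x x0; rewrite (_ : _ *m x = (E^T *m x)^T *m A *m (E^T *m x)).
  apply: posA; apply: contra_neq x0 => Ex0.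
  by rewrite -[x](@mulKmx _ _ _ E^T) ?unitmx_tr// Ex0 mulmx0.
by rewrite trmx_mul trmxK !mulmxA.
Qed.

Lemma trace_congr (R : realType) n (E A : 'M[R]_n) :
  \tr (E *m A *m E^T) = \tr (E^T *m E *m A).
Proof. by rewrite mxtrace_mulC mulmxA. Qed.

Lemma posdef_diag_block (R : realType) n (a : R) (B : 'M[R]_n) :
  posdef (block_mx (a%:M : 'M[R]_1) 0 0 B) -> 0 < a /\ posdef B.
Proof.
move=> [symA posA]; split.
  have := posA (col_mx 1%:M 0); rewrite tr_col_mx mul_row_block mul_row_col.
  rewrite !mulmx0 !trmx1 !mul1mx !addr0 mulmx1 mxE mulr1n; apply.
  apply/eqP => /matrixP/(_ (lshift n ord0) ord0); rewrite col_mxEu !mxE => /eqP.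
  by rewrite oner_eq0.
split.
  by move: symA; rewrite tr_block_mx => /eq_block_mx[_ _ _].
move=> x x0; have := posA (col_mx 0 x); rewrite tr_col_mx mul_row_block.
rewrite mul_row_col !trmx0 !mul0mx !mulmx0 add0r !add0r; apply.
by apply: contra_neq x0; rewrite -(col_mx0 R 1 n 1) => /eq_col_mx[].
Qed.

(* Elimination of the first variable: the lower right block of the congruent
   matrix is the Schur complement. *)
Lemma posdef_schur (R : realType) n (A : 'M[R]_(1 + n)) : posdef A ->
  exists E b (v : 'cV[R]_n) B, [/\ A = block_mx (b%:M : 'M[R]_1) v^T v B, 0 < b,
    posdef (B - b^-1 *: (v *m v^T)), \det E = 1 &
    E *m A *m E^T = block_mx (b%:M : 'M[R]_1) 0 0 (B - b^-1 *: (v *m v^T))].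
Proof.
move=> pA; have [symA posA] := pA.
pose b := A ord0 ord0; pose v : 'cV[R]_n := dlsubmx A; pose B := drsubmx A.
have ulE : ulsubmx A = b%:M.
  rewrite [LHS]mx11_scalar; congr (_%:M).
  by rewrite !mxE; congr (A _ _); exact: val_inj.
have AE : A = block_mx b%:M v^T v B.
  rewrite -[LHS]submxK ulE; congr (block_mx _ _ _ _).
  by rewrite -{1}symA -trmx_dlsub.
have b0 : 0 < b.
  have := posA (delta_mx ord0 ord0).
  rewrite trmx_delta -rowE -colE !mxE; apply.
  by apply/eqP => /matrixP/(_ ord0 ord0); rewrite !mxE => /eqP; rewrite oner_eq0.
pose E : 'M[R]_(1 + n) := block_mx 1%:M 0 (- b^-1 *: v) 1%:M.
have dE : \det E = 1 by rewrite det_lblock !det1 mulr1.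
have EAE : E *m A *m E^T = block_mx (b%:M : 'M[R]_1) 0 0 (B - b^-1 *: (v *m v^T)).
  rewrite {}AE tr_block_mx !mulmx_block !mul1mx !mul0mx !addr0 !trmx1 !trmx0.
  rewrite !mulmx1 !mulmx0 !addr0 linearZ/= -!scalemxAl -!scalemxAr.
  rewrite mul_scalar_mx scalerA mulNr mulVf ?gt_eqF// scaleN1r addNr.
  rewrite mul_mx_scalar scalerA mulNr mulVf ?gt_eqF// scaleN1r addNr.
  by rewrite mul0mx scaler0 add0r scaleNr addrC.
exists E, b, v, B; split=> //.
have : posdef (E *m A *m E^T) by apply: posdef_congr; rewrite // unitmxE dE unitr1.
by rewrite EAE => /posdef_diag_block[].
Qed.

(** With pivot [b], column [v] and Schur complement [C], one has [\det A = b * \det C] and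
    [\tr A = b + \tr C + \tr (v *m v^T) / b], so induction reduces everything to the scalar
    inequality [ln b <= b - 1]. Equality forces [b = 1], [v = 0] and [C = 1]. *)
Lemma posdef_stein (R : realType) n (A : 'M[R]_n) : posdef A ->
  [/\ 0 < \det A, ln (\det A) <= \tr A - n%:R &
      ln (\det A) = \tr A - n%:R -> A = 1%:M].
Proof.
elim: n A => [|n IHn] A pA.
  by rewrite det_mx00 ln1 /mxtrace big_ord0 subrr ltr01 lexx; split=> // _;
    apply/matrixP => -[].
have [E [b [v [B [AE b0 pB dE EAE]]]]] := @posdef_schur R n A pA.
have [dB lnB eqB] := IHn _ pB.
set C := B - _ in pB EAE dB lnB eqB.
have dA : \det A = b * \det C.
  have : \det (E *m A *m E^T) = \det A by rewrite !det_mulmx det_tr dE mul1r mulr1.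
  by rewrite EAE det_ublock det_scalar expr1.
have vv0 : 0 <= \tr (v *m v^T).
  by rewrite mxtrace_mulC mxtrace_mulC; apply: sumr_ge0 => i _; rewrite mxE;
    apply: sumr_ge0 => j _; rewrite !mxE -expr2 sqr_ge0.
have trA : \tr A = b + \tr C + b^-1 * \tr (v *m v^T).
  have -> : \tr A = \tr (block_mx (b%:M : 'M[R]_1) v^T v B) by rewrite -AE.
  rewrite mxtrace_block mxtrace_scalar mulr1n -addrA; congr (_ + _).
  by rewrite /C linearB/= linearZ/= subrK.
have lnb : ln b <= b - 1.
  by have := @le_ln1Dx R (b - 1); rewrite subrKC; apply; lra.
have bv0 : 0 <= b^-1 * \tr (v *m v^T) by rewrite mulr_ge0// invr_ge0 ltW.
rewrite dA lnM ?posrE//; split; first exact: mulr_gt0.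
  by rewrite trA -natr1; lra.
rewrite trA -natr1 => eqA.
have b1 : b = 1.
  apply/eqP/negPn/negP => bn1.
  have lnb0 : ln b != 0 by rewrite ln_eq0.
  by have := expR_gt1Dx lnb0; rewrite lnK ?posrE//; lra.
have v0 : v = 0.
  have : \tr (v *m v^T) = 0.
    apply/eqP; rewrite eq_le vv0 andbT.
    by move: eqA bv0; rewrite b1 ln1 invr1 mul1r; lra.
  move/eqP; rewrite psumr_eq0; last first.
    by move=> i _; rewrite mxE; apply: sumr_ge0 => j _; rewrite !mxE -expr2 sqr_ge0.
  move=> /allP v0; apply/matrixP => i j; rewrite ord1 mxE.
  have := v0 i; rewrite mem_index_enum => /(_ isT)/=.
  by rewrite mxE big_ord1 mxE -expr2 sqrf_eq0 => /eqP.
have C1 : C = 1%:M by apply: eqB; lra.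
move: C1; rewrite AE /C b1 v0 mul0mx scaler0 subr0 => ->.
by rewrite trmx0 -scalar_mx_block.
Qed.

(** A Cholesky-type factor from the same elimination: the pivot is normalised by its square root and
    the Schur complement is whitened by induction. *)
Lemma posdef_whiten (R : realType) n (A : 'M[R]_n) : posdef A ->
  exists2 C, C \in unitmx & C *m A *m C^T = 1%:M.
Proof.
elim: n A => [|n IHn] A pA.
  exists 1%:M; first exact: unitmx1.
  by apply/matrixP => -[].
have [E [b [v [B [_ b0 pB dE EAE]]]]] := @posdef_schur R n A pA.
have [C uC CBC] := IHn _ pB.
pose s := Num.sqrt b.
have s0 : 0 < s by rewrite sqrtr_gt0.
pose G : 'M[R]_(1 + n) := block_mx ((s^-1)%:M : 'M[R]_1) 0 0 C.
have uG : G \in unitmx.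
  rewrite unitmxE det_ublock det_scalar expr1 unitrM -unitmxE uC andbT.
  by rewrite unitfE invr_eq0 gt_eqF.
exists (G *m E); first by rewrite unitmx_mul uG unitmxE dE unitr1.
have -> : G *m E *m A *m (G *m E)^T = G *m (E *m A *m E^T) *m G^T.
  by rewrite trmx_mul !mulmxA.
rewrite EAE /G tr_block_mx !mulmx_block !mul0mx !mulmx0 !addr0 !add0r.
rewrite !trmx0 !mulmx0 !mul0mx ?addr0 ?add0r CBC tr_scalar_mx -!scalar_mxM.
rewrite (_ : s^-1 * b * s^-1 = 1) -?scalar_mx_block//.
by rewrite -[b]sqr_sqrtr ?ltW// -/s; field; rewrite gt_eqF.
Qed.

(* With C *m S *m C^T = 1, the contrast of S and A is the Stein loss of
   C *m A *m C^T. *)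
Lemma contrast_ge0 (R : realType) p (S A : 'M[R]_p) : posdef S -> posdef A ->
  0 <= contrast S A /\ (contrast S A = 0 -> A = S).
Proof.
move=> pS pA; have [C uC CSC] := posdef_whiten pS.
have [dS _ _] := posdef_stein pS; have [dA _ _] := posdef_stein pA.
have uCT : C^T \in unitmx by rewrite unitmx_tr.
have uS : S \in unitmx by rewrite unitmxE unitfE gt_eqF.
have [dB lnB eqB] := posdef_stein (posdef_congr uC pA).
have VS : invmx S = C^T *m C.
  have : C^T *m C *m S = 1%:M.
    apply: (can_inj (mulmxK uCT)).
    by rewrite -!mulmxA (mulmxA C) CSC mulmx1 mul1mx.
  by move=> /(congr1 (mulmx^~ (invmx S))); rewrite mulmxK// mul1mx => ->.
have dC : \det C * \det S * \det C = 1.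
  by have /(congr1 (fun M => \det M)) := CSC; rewrite !det_mulmx det_tr det1.
have dBE : \det (C *m A *m C^T) = \det A / \det S.
  rewrite !det_mulmx det_tr; apply: (mulIf (x := \det S)); first by rewrite gt_eqF.
  rewrite divfK ?gt_eqF// -[RHS]mulr1 -dC; ring.
have cE : contrast S A = \tr (C *m A *m C^T) - p%:R - ln (\det (C *m A *m C^T)).
  rewrite /contrast VS trace_congr dBE ln_div ?posrE//; ring.
rewrite cE subr_ge0; split=> // /eqP; rewrite subr_eq0 => /eqP/esym/eqB CAC.
move: CAC; rewrite -CSC => /(can_inj (mulmxK uCT)).
exact: (can_inj (mulKmx uC)).
Qed.

Section matrix_limits.
Context {R : realType} {T : Type} (F : set_system T) {FF : Filter F}.

Lemma cvg_sumr (I : Type) (s : seq I) (P : pred I) (f : I -> T -> R) (l : I -> R) :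
  (forall i, P i -> f i t @[t --> F] --> l i) ->
  \sum_(i <- s | P i) f i t @[t --> F] --> \sum_(i <- s | P i) l i.
Proof. by apply: cvg_big => //; exact: add_continuous. Qed.

Lemma cvg_prodr (I : Type) (s : seq I) (P : pred I) (f : I -> T -> R) (l : I -> R) :
  (forall i, P i -> f i t @[t --> F] --> l i) ->
  \prod_(i <- s | P i) f i t @[t --> F] --> \prod_(i <- s | P i) l i.
Proof. by apply: cvg_big => //; exact: mul_continuous. Qed.

Lemma cvg_det n (A : T -> 'M[R]_n) (B : 'M[R]_n) :
  (forall i j, A t i j @[t --> F] --> B i j) -> \det (A t) @[t --> F] --> \det B.
Proof.
move=> AB; apply: cvg_sumr => s _; apply: cvgM; first exact: cvg_cst.
by apply: cvg_prodr => i _; exact: AB.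
Qed.

Lemma cvg_adj n (A : T -> 'M[R]_n) (B : 'M[R]_n) i j :
  (forall i j, A t i j @[t --> F] --> B i j) ->
  (\adj (A t)) i j @[t --> F] --> (\adj B) i j.
Proof.
move=> AB; rewrite mxE; under eq_cvg do rewrite mxE.
apply: cvgM; first exact: cvg_cst.
by apply: cvg_det => k l; rewrite !mxE; under eq_cvg do rewrite !mxE; exact: AB.
Qed.

Lemma cvg_invmx n (A : T -> 'M[R]_n) (B : 'M[R]_n) i j : B \in unitmx ->
  (forall i j, A t i j @[t --> F] --> B i j) ->
  invmx (A t) i j @[t --> F] --> invmx B i j.
Proof.
move=> uB AB; have dB0 : \det B != 0 by move: uB; rewrite unitmxE unitfE.
have dA := cvg_det AB.
(* [invmx] is given by the cofactor formula only on invertible matrices; as the determinants tend to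
   [\det B != 0], the two agree eventually along [F]. *)
suff : (\det (A t))^-1 * (\adj (A t)) i j @[t --> F] --> invmx B i j.
  apply: cvg_trans; apply: near_eq_cvg.
  apply: filterS (cvgr_neq0 _ dA dB0) => t /= dA0.
  by rewrite /invmx unitmxE unitfE dA0 [RHS]mxE.
rewrite /invmx uB mxE; apply: cvgM; last exact: cvg_adj.
exact: cvgV.
Qed.

End matrix_limits.

Lemma invmx_bounded (R : realType) q p (D : set 'cV[R]_q) (g : 'cV[R]_q -> 'M[R]_p) :
  compact D -> (forall x, D x -> {for x, continuous g}) ->
  (forall x, D x -> g x \in unitmx) ->
  exists K, forall x i j, D x -> `|invmx (g x) i j| <= K.
Proof.
move=> cD cg ug.
have gij x i j : D x -> g y i j @[y --> x] --> g x i j.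
  move=> Dx; exact: (@cvg_comp _ _ _ g (fun M : 'M[R]_p => M i j) _ _ _
    (cg x Dx) (@coord_continuous R p p i j (g x))).
have : \forall K \near +oo, D `<=` [set x | forall i j, `|invmx (g x) i j| <= K].
  have /compact_near_coveringP := cD.
  apply => x Dx /=.
  (* Summing over all entries gives one bound for every [i] and [j]; the [+ 1] is the slack that
     continuity leaves near [x]. *)
  pose K0 : R := \sum_i \sum_j (`|invmx (g x) i j| + 1).
  near=> y K.
  have K0K : K0 <= K by near: K; apply: nbhs_pinfty_ge; exact: num_real.
  move=> i j; apply: le_trans K0K.
  rewrite /K0 (bigD1 i)//= (bigD1 j)//= -addrA ler_wpDr//.
    by rewrite addr_ge0// sumr_ge0// => *; rewrite ?sumr_ge0// => *; rewrite addr_ge0.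
  move: i j; near: y => /=.
  apply: filter_forall => i; apply: filter_forall => j.
  have gx : invmx (g y) i j @[y --> x] --> invmx (g x) i j.
    exact: (@cvg_invmx R _ (nbhs x) _ p g (g x) i j (ug x Dx) (fun i j => gij x i j Dx)).
  by apply: (cvgr_norm_le _ gx); rewrite ltrDl.
move=> [K [_ KP]].
by exists (K + 1) => x i j Dx; apply: KP => //; rewrite ?ltrDl.
Unshelve. all: by end_near. Qed.

(* The contrast is affine in its second argument up to ln det, with the entries
   of invmx (Sigma th) bounded, so it varies uniformly in th. *)
Lemma contrast_lower_bound (R : realType) q p (Theta : set 'cV[R]_q)
    (Sigma : 'cV[R]_q -> 'M[R]_p) (A : 'M[R]_p) th0 :
  compact Theta -> Ck_near 2 Theta Sigma ->
  (forall th, Theta th -> posdef (Sigma th)) -> posdef A ->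
  Theta th0 -> A <> Sigma th0 ->
  contrast (Sigma th0) A = inf [set contrast (Sigma th) A | th in Theta] ->
  exists2 c, 0 < c & forall (T : Type) (F : set_system T) (B : T -> 'M[R]_p),
    Filter F -> (forall i j, B t i j @[t --> F] --> A i j) ->
    \forall t \near F, forall th, Theta th -> c <= contrast (Sigma th) (B t).
Proof.
move=> cT [V [g [oO TO gS Cg]]] pS pA Th0 An0 infE.
have [dA _ _] := posdef_stein pA.
(* The bound is proved for the extension [g], which is continuous in the ambient space at each point
   of [Theta], and then transferred to [Sigma]. *)
have [K KP] : exists K, forall x i j, Theta x -> `|invmx (Sigma x) i j| <= K.
  have [K KP] : exists K, forall x i j, Theta x -> `|invmx (g x) i j| <= K.
    apply: (@invmx_bounded _ _ _ Theta g) => // [x Tx|x Tx].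
      by have [+ _] := Cg [::] isT; apply; exact: TO.
    have [dx _ _] := posdef_stein (pS _ Tx).
    by rewrite gS// unitmxE unitfE gt_eqF.
  by exists K => x i j Tx; rewrite -gS//; exact: KP.
pose c0 := contrast (Sigma th0) A.
have c0_gt0 : 0 < c0.
  have [c0_ge0 c0_eq0] := contrast_ge0 (pS _ Th0) pA.
  by rewrite lt_neqAle c0_ge0 andbT eq_sym; apply/eqP => /c0_eq0.
have c0_le th : Theta th -> c0 <= contrast (Sigma th) A.
  move=> Tth; rewrite /c0 infE; apply: ge_inf; last by exists th.
  (* Nonnegativity of the contrast makes the set bounded below, so that [inf] is a genuine lower
     bound. *)
  by exists 0 => _ [x Tx <-]; have [] := contrast_ge0 (pS _ Tx) pA.
exists (c0 / 2) => [|T F B FF BA]; first by rewrite divr_gt0.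
pose err t := `|ln (\det A) - ln (\det (B t))| + `|K| * \sum_i \sum_j `|A i j - B t i j|.
have err0 : err t @[t --> F] --> `|ln (\det A) - ln (\det A)| +
    `|K| * \sum_i \sum_j `|A i j - A i j|.
  apply: cvgD.
    apply: cvg_norm; apply: cvgB; first exact: cvg_cst.
    apply: continuous_cvg; first exact: continuous_ln.
    exact: cvg_det.
  apply: cvgM; first exact: cvg_cst.
  apply: cvg_sumr => i _; apply: cvg_sumr => j _.
  by apply: cvg_norm; apply: cvgB; [exact: cvg_cst|exact: BA].
have {}err0 : \forall t \near F, err t <= c0 / 2.
  apply: (cvgr_le _ err0).
  rewrite subrr normr0 add0r big1 ?mulr0 ?divr_gt0// => i _.
  by rewrite big1// => j _; rewrite subrr normr0.
apply: filterS err0 => t err_le th Tth.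
have -> : contrast (Sigma th) (B t) = contrast (Sigma th) A +
    (ln (\det A) - ln (\det (B t))) - \tr (invmx (Sigma th) *m (A - B t)).
  by rewrite /contrast mulmxBr linearB/=; ring.
have trle : `|\tr (invmx (Sigma th) *m (A - B t))| <=
    `|K| * \sum_i \sum_j `|A i j - B t i j|.
  rewrite mxtrace_mulC (le_trans (ler_norm_sum _ _ _))// mulr_sumr ler_sum// => i _.
  rewrite mxE (le_trans (ler_norm_sum _ _ _))// mulr_sumr ler_sum// => j _.
  rewrite !mxE normrM mulrC ler_wpM2r//.
  by rewrite (le_trans (KP _ _ _ Tth))// ler_norm.
have := c0_le _ Tth.
have := ler_norm (- (ln (\det A) - ln (\det (B t)))).
have := ler_norm (\tr (invmx (Sigma th) *m (A - B t))).
move: err_le trle; rewrite /err normrN; lra.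
Qed.

(** * Truncated realized covariance *)

Section euclidean_norm.
Context {R : realType}.

Lemma enorm_ge0 m n (A : 'M[R]_(m, n)) : 0 <= enorm A.
Proof. exact: sqrtr_ge0. Qed.

Lemma sqr_enorm m n (A : 'M[R]_(m, n)) : enorm A ^+ 2 = \sum_i \sum_j A i j ^+ 2.
Proof. by rewrite sqr_sqrtr//; do 2![apply: sumr_ge0 => *]; rewrite sqr_ge0. Qed.

Lemma sqr_enorm_cV n (v : 'cV[R]_n) : enorm v ^+ 2 = \sum_i v i ord0 ^+ 2.
Proof. by rewrite sqr_enorm; apply: eq_bigr => i _; rewrite big_ord1. Qed.

Lemma ler_norm_enorm m n (A : 'M[R]_(m, n)) i j : `|A i j| <= enorm A.
Proof.
rewrite -(@ler_pXn2r _ 2) ?nnegrE ?enorm_ge0// sqr_enorm real_normK ?num_real//.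
rewrite (bigD1 i)//= (bigD1 j)//= -addrA lerDl addr_ge0//; last first.
  by do 2![apply: sumr_ge0 => *]; rewrite sqr_ge0.
by apply: sumr_ge0 => *; rewrite sqr_ge0.
Qed.

Lemma sqr_enormD n (u v : 'cV[R]_n) :
  enorm (u + v) ^+ 2 <= 2 * (enorm u ^+ 2 + enorm v ^+ 2).
Proof.
rewrite !sqr_enorm_cV -big_split/= mulr_sumr ler_sum// => i _; rewrite mxE.
by have := sqr_ge0 (u i ord0 - v i ord0); nra.
Qed.

End euclidean_norm.

(* dx m is an observed increment, y m its Gaussian part, and J marks the at most
   K increments that contain a jump. *)
Section truncation.
Context {R : realType} (p : nat).
Variables (D rho : R) (n : nat) (h : R) (dx y : nat -> 'cV[R]_p).
Variables (J : pred nat) (K : nat) (C : R).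
Let tau := D * h `^ rho.
Let V := \sum_(m < n) enorm (y m) ^+ 4.
Hypotheses (tau_gt0 : 0 < tau) (Ch_ge0 : 0 <= C * h) (Ch_tau : C * h <= tau / 2).
Hypothesis dxy : forall m, (m < n)%N -> ~~ J m -> enorm (dx m - y m) <= C * h.
Hypothesis JK : (\sum_(m < n) J m <= K)%N.

(** A discarded increment exceeds [tau] while its non-Gaussian part is at most [tau / 2], so the
    Gaussian part is at least [tau / 2]. This form bounds the indicator of a discarded jump-free
    increment by powers of [enorm (y m) / tau]. *)
Let not_small m : (m < n)%N -> ~~ J m -> ~~ small D rho h dx m ->
  1 <= 4 * (enorm (y m) / tau) ^+ 2.
Proof.
move=> mn Jm; rewrite /small -ltNge -/tau => taudx.
have := sqr_enormD (dx m - y m) (y m); rewrite subrK => dxle.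
have dxy2 : enorm (dx m - y m) ^+ 2 <= tau ^+ 2 / 4.
  rewrite (_ : tau ^+ 2 / 4 = (tau / 2) ^+ 2); last by field.
  rewrite lerXn2r ?nnegrE ?enorm_ge0 ?divr_ge0 ?(ltW tau_gt0)//.
  exact: le_trans (dxy mn Jm) Ch_tau.
have : tau ^+ 2 <= enorm (dx m) ^+ 2.
  by rewrite lerXn2r ?nnegrE ?enorm_ge0 ?(ltW tau_gt0)// ltW.
rewrite expr_div_n mulrA ler_pdivlMr ?exprn_gt0//; lra.
Qed.

(** Every index is kept, or marked by [J], or contributes at least 1 to the last term, by the square
    of [not_small]. *)
Lemma num_small_ge :
  n%:R - K%:R - 16 * (V / tau ^+ 4) <= (num_small D rho n h dx)%:R.
Proof.
have : n%:R <= \sum_(m < n) ((small D rho h dx m)%:R + (J m)%:R +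
    16 * (enorm (y m) / tau) ^+ 4).
  rewrite -[n in leLHS]card_ord -sum1_card natr_sum ler_sum// => -[m mn] _ /=.
  have z0 : 0 <= 16 * (enorm (y m) / tau) ^+ 4.
    by rewrite mulr_ge0// exprn_even_ge0.
  case: (boolP (small _ _ _ _ m)) => [_|ns]; first by case: (J m); rewrite ?mulr0n ?mulr1n; lra.
  case: (boolP (J m)) => Jm; rewrite ?mulr0n ?mulr1n; first by lra.
  have := not_small mn Jm ns.
  by rewrite (_ : (_ / _) ^+ 4 = ((enorm (y m) / tau) ^+ 2) ^+ 2) -?exprM//; nra.
rewrite !big_split/= -!natr_sum -/(num_small _ _ _ _ _) -mulr_sumr.
have -> : \sum_(m < n) (enorm (y m) / tau) ^+ 4 = V / tau ^+ 4.
  by rewrite /V mulr_suml; apply: eq_bigr => i _; rewrite expr_div_n.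
have : (\sum_(m < n) J m)%:R <= K%:R :> R by rewrite ler_nat.
lra.
Qed.

(** Summand by summand: a marked index costs at most [2 * tau ^+ 2] plus a fourth-power term; an
    unmarked discarded one costs [|y|^2 <= 4 |y|^4 / tau^2]; an unmarked kept one costs the cross
    terms between [y] and a perturbation of size [C * h]. *)
Lemma truncated_sum_error j k :
  `|\sum_(m < n) (small D rho h dx m)%:R * (dx m j ord0 * dx m k ord0)
     - \sum_(m < n) y m j ord0 * y m k ord0|
  <= 2 * K%:R * tau ^+ 2 + 4 * (V / tau ^+ 2) + 3 * (C * h * n%:R * tau).
Proof.
rewrite -sumrB (le_trans (ler_norm_sum _ _ _))//.
have -> : 4 * (V / tau ^+ 2) = \sum_(m < n) 4 * (enorm (y m) ^+ 4 / tau ^+ 2).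
  by rewrite -mulr_sumr /V mulr_suml.
have -> : 3 * (C * h * n%:R * tau) = \sum_(m < n) 3 * (C * h * tau).
  by rewrite sumr_const card_ord -mulr_natr; ring.
apply: (@le_trans _ _ (\sum_(m < n) ((J m)%:R * (2 * tau ^+ 2) +
    4 * (enorm (y m) ^+ 4 / tau ^+ 2) + 3 * (C * h * tau)))); last first.
  rewrite !big_split/= !lerD2r -mulr_suml -natr_sum mulrAC mulrC ler_wpM2l//.
    by rewrite mulr_ge0// sqr_ge0.
  by rewrite ler_nat.
apply: ler_sum => -[m mn] _ /=.
set x1 := dx m j ord0; set x2 := dx m k ord0.
set y1 := y m j ord0; set y2 := y m k ord0.
pose e := C * h; rewrite -/e.
(* The Gaussian part in units of the threshold; all bounds below are polynomials in [z], and its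
   lower powers are traded for [1 + z ^+ 4]. *)
pose z := enorm (y m) / tau.
have z0 : 0 <= z by rewrite divr_ge0 ?enorm_ge0// ltW.
have yE : enorm (y m) = tau * z by rewrite /z mulrC divfK// gt_eqF.
have -> : enorm (y m) ^+ 4 / tau ^+ 2 = tau ^+ 2 * z ^+ 4.
  by rewrite yE; field; rewrite gt_eqF.
have y1z : `|y1| <= tau * z by rewrite -yE ler_norm_enorm.
have y2z : `|y2| <= tau * z by rewrite -yE ler_norm_enorm.
have yyz : `|y1 * y2| <= tau ^+ 2 * z ^+ 2.
  rewrite normrM (le_trans (ler_pM _ _ y1z y2z))//.
  by rewrite le_eqVlt; apply/orP; left; apply/eqP; ring.
have z4 : z ^+ 4 = z ^+ 2 * z ^+ 2 by rewrite -exprD.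
have z24 : z ^+ 2 <= 1 + z ^+ 4 by rewrite z4; have := sqr_ge0 (z ^+ 2 - 1); nra.
have zz4 : z <= 1 + z ^+ 4 by have := sqr_ge0 (z - 1); nra.
have tau2 : 0 < tau ^+ 2 by rewrite exprn_gt0.
have e0 : 0 <= e by [].
have z4_ge0 : 0 <= z ^+ 4 by rewrite exprn_ge0.
have et : 0 <= e * tau by rewrite mulr_ge0// ltW.
have tz4 : 0 <= tau ^+ 2 * z ^+ 4 by rewrite mulr_ge0// ltW.
have yy4 : `|y1 * y2| <= tau ^+ 2 + tau ^+ 2 * z ^+ 4.
  by apply: (le_trans yyz); rewrite -[X in X + _]mulr1 -mulrDr ler_wpM2l// ltW.
case: (boolP (small _ _ _ _ m)) => [sm|ns]; last first.
  rewrite mul0r sub0r normrN; case: (boolP (J m)) => Jm; rewrite ?mulr0n ?mulr1n; first by lra.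
  have := not_small mn Jm ns; rewrite -/z => z41.
  have : tau ^+ 2 * z ^+ 2 <= 4 * (tau ^+ 2 * z ^+ 4).
    have z2 : z ^+ 2 <= 4 * z ^+ 4 by rewrite z4; have := sqr_ge0 z; nra.
    by apply: le_trans (ler_wpM2l (ltW tau2) z2) _; rewrite le_eqVlt mulrCA eqxx.
  by lra.
rewrite mul1r; case: (boolP (J m)) => Jm; rewrite ?mulr0n ?mulr1n.
  have xx : `|x1 * x2| <= tau ^+ 2.
    rewrite normrM expr2 ler_pM//; apply: le_trans sm; exact: ler_norm_enorm.
  have := ler_normB (x1 * x2) (y1 * y2); lra.
have d1 : `|x1 - y1| <= e.
  apply: le_trans (dxy mn Jm).
  by have := @ler_norm_enorm R _ _ (dx m - y m) j ord0; rewrite !mxE.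
have d2 : `|x2 - y2| <= e.
  apply: le_trans (dxy mn Jm).
  by have := @ler_norm_enorm R _ _ (dx m - y m) k ord0; rewrite !mxE.
have -> : x1 * x2 - y1 * y2 = (x1 - y1) * (x2 - y2) + (x1 - y1) * y2 + y1 * (x2 - y2).
  by ring.
have b1 : `|(x1 - y1) * (x2 - y2)| <= e * e by rewrite normrM ler_pM.
have b2 : `|(x1 - y1) * y2| <= e * (tau * z) by rewrite normrM ler_pM.
have b3 : `|y1 * (x2 - y2)| <= e * (tau * z) by rewrite normrM mulrC ler_pM.
have b4 : e * e <= e * tau by rewrite ler_wpM2l//; move: Ch_tau; rewrite -/e; lra.
(* From [z <= 1 + z ^+ 4], with [e <= tau / 2] used on the fourth-power part only. *)
have b5 : e * (tau * z) <= e * tau + tau ^+ 2 * z ^+ 4 / 2.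
  apply: (@le_trans _ _ (e * tau * (1 + z ^+ 4))); first by rewrite -mulrA !ler_wpM2l// ltW.
  have et2 : e * tau <= tau ^+ 2 / 2.
    by rewrite expr2 [leRHS]mulrAC; apply: ler_wpM2r; [exact: ltW|exact: Ch_tau].
  by rewrite mulrDr mulr1 lerD2l [leRHS]mulrAC ler_wpM2r.
have := ler_normD ((x1 - y1) * (x2 - y2) + (x1 - y1) * y2) (y1 * (x2 - y2)).
have := ler_normD ((x1 - y1) * (x2 - y2)) ((x1 - y1) * y2).
rewrite mul0r add0r; lra.
Qed.

End truncation.

Lemma cvg_powR0 (R : realType) (T : Type) (F : set_system T) (u : T -> R) r :
  Filter F -> 0 < r -> (\forall t \near F, 0 <= u t) -> u t @[t --> F] --> 0 ->
  u t `^ r @[t --> F] --> 0.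
Proof.
move=> FF r0 u0 /cvgr0Pnorm_lt ucvg; apply/cvgr0Pnorm_lt => e e0.
have := ucvg (e `^ r^-1) (powR_gt0 _ e0); near_simpl => ue.
near=> t; rewrite ger0_norm ?powR_ge0//.
have ut0 : 0 <= u t by near: t.
have ute : u t < e `^ r^-1.
  by rewrite -[ltLHS]ger0_norm//; near: t.
rewrite -[ltRHS](@powRr1 _ e) ?ltW// -[in ltRHS](mulVf (lt0r_neq0 r0)) powRrM.
by apply: gt0_ltr_powR; rewrite ?nnegrE ?powR_ge0.
Unshelve. all: by end_near. Qed.

(** * Deterministic limits of the truncated covariance, along any filter finer than [\oo] *)

Section truncated_covariance.
Context {R : realType} (p : nat) (F : set_system nat) {FF : Filter F}.
Variables (T D rho : R) (dx y : nat -> nat -> 'cV[R]_p).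
Variables (J : nat -> pred nat) (K : nat) (C : R) (S : 'M[R]_p).
Let h n := T / n%:R.
Let V n := \sum_(m < n) enorm (y n m) ^+ 4.
Hypotheses (T0 : 0 < T) (D0 : 0 < D) (rho0 : 0 < rho) (rho_lt : rho < 2^-1).
Hypothesis (Foo : F `=>` \oo) (C0 : 0 <= C).
Hypothesis dxy : forall n m, (m < n)%N -> ~~ J n m ->
  enorm (dx n m - y n m) <= C * h n.
Hypothesis JK : forall n, (\sum_(m < n) J n m <= K)%N.
Hypothesis V0 : V n / (D * h n `^ rho) ^+ 2 @[n --> F] --> 0.
Hypothesis yS : forall j k,
  \sum_(m < n) y n m j ord0 * y n m k ord0 @[n --> F] --> T * S j k.

Let tau n := D * h n `^ rho.

Let F_gt0 : \forall n \near F, (0 < n)%N.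
Proof. by apply: Foo; exists 1%N. Qed.

Let h0 : h n @[n --> F] --> 0.
Proof.
have : h n @[n --> \oo] --> 0.
  rewrite -[X in _ --> X](mulr0 T); apply: cvgM; first exact: cvg_cst.
  by apply/gtr0_cvgV0; [near=> n; rewrite ltr0n; near: n; exists 1%N|exact: cvgr_idn].
by apply: cvg_trans; exact: cvg_app.
Unshelve. all: by end_near. Qed.

Let h_ge0 : \forall n \near F, 0 <= h n.
Proof. by near=> n; rewrite divr_ge0// ltW. Unshelve. all: by end_near. Qed.

Let h_gt0 n : (0 < n)%N -> 0 < h n.
Proof. by move=> n0; rewrite divr_gt0// ltr0n. Qed.

Let tau_gt0 n : (0 < n)%N -> 0 < tau n.
Proof. by move=> n0; rewrite mulr_gt0// powR_gt0// h_gt0. Qed.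

Let tau0 : tau n @[n --> F] --> 0.
Proof.
rewrite -[X in _ --> X](mulr0 D); apply: cvgM; first exact: cvg_cst.
exact: cvg_powR0.
Qed.

Let h_tau2 : h n / tau n ^+ 2 @[n --> F] --> 0.
Proof.
suff : h n `^ (1 - 2 * rho) / D ^+ 2 @[n --> F] --> 0.
  apply: cvg_trans; apply: near_eq_cvg; near=> n.
  have n0 : (0 < n)%N by near: n.
  rewrite /tau exprMn powRB ?(gt_eqF (h_gt0 n0)) ?implybT// powRr1 ?ltW ?h_gt0//.
  rewrite [2 * rho]mulrC powRrM powR_mulrn ?powR_ge0//; field.
  by rewrite !gt_eqF// powR_gt0// h_gt0.
rewrite -[X in _ --> X](mul0r (D ^+ 2)^-1); apply: cvgM; last exact: cvg_cst.
apply: cvg_powR0 => //; move: rho_lt; lra.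
Unshelve. all: by end_near. Qed.

Let Ch_tau : \forall n \near F, C * h n <= tau n / 2.
Proof.
have : 2 * C * (h n / tau n ^+ 2) * tau n @[n --> F] --> 0.
  rewrite [X in _ --> X](_ : _ = 2 * C * 0 * 0); last by ring.
  by apply: cvgM => //; apply: cvgM => //; exact: cvg_cst.
move=> /(cvgr_le _)/(_ 1 ltr01) H; near=> n.
have n0 : (0 < n)%N by near: n.
have : 2 * C * (h n / tau n ^+ 2) * tau n <= 1 by near: n.
have t0 := tau_gt0 n0.
have -> : 2 * C * (h n / tau n ^+ 2) * tau n = 2 * C * h n / tau n.
  by field; rewrite gt_eqF.
by rewrite ler_pdivrMr// mul1r; lra.
Unshelve. all: by end_near. Qed.

Let frac n := (num_small D rho n (h n) (dx n))%:R / n%:R : R.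

Lemma frac_small_cvg1 : frac n @[n --> F] --> (1 : R).
Proof.
(* The error of [num_small_ge] divided by [n], rewritten with [1 / n = h n / T] so that each term
   contains a null sequence. *)
pose r n := K%:R * T^-1 * h n + 16 / T * (V n / tau n ^+ 2) * (h n / tau n ^+ 2).
have r0 : 1 - r n @[n --> F] --> (1 : R).
  rewrite -[X in _ --> X]subr0; apply: cvgB; first exact: cvg_cst.
  rewrite -[X in _ --> X]addr0; apply: cvgD.
    by rewrite -[X in _ --> X](mulr0 (K%:R * T^-1)); apply: cvgM => //; exact: cvg_cst.
  rewrite [X in _ --> X](_ : _ = 16 / T * 0 * 0); last by ring.
  by apply: cvgM => //; apply: cvgM => //; exact: cvg_cst.
apply: (squeeze_cvgr _ r0 (cvg_cst (1 : R))); near=> n.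
have n0 : (0 < n)%N by near: n.
have nR : 0 < n%:R :> R by rewrite ltr0n.
apply/andP; split; last first.
  rewrite /frac ler_pdivrMr// mul1r ler_nat -[leqRHS]card_ord -sum1_card.
  by apply: leq_sum => i _; exact: leq_b1.
rewrite /frac ler_pdivlMr//.
have Chtn : C * h n <= tau n / 2 by near: n.
have := num_small_ge (tau_gt0 n0) Chtn (@dxy n) (JK n).
apply: le_trans; rewrite le_eqVlt; apply/orP; left; apply/eqP.
rewrite /r -/(V n) -/(tau n); have := tau_gt0 n0; rewrite /h => t0.
by field; rewrite !gt_eqF.
Unshelve. all: by end_near. Qed.

Lemma num_small_near_pos : \forall n \near F, n%:R / 2 <= (num_small D rho n (h n) (dx n))%:R :> R.
Proof.
have h1 : 2^-1 < 1 :> R by lra.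
have H := cvgr_ge _ frac_small_cvg1 _ h1.
near=> n; have n0 : (0 < n)%N by near: n.
have : 2^-1 <= frac n by near: n; exact: H.
by rewrite /frac ler_pdivlMr ?ltr0n// mulrC.
Unshelve. all: by end_near. Qed.

Lemma cov_estimator_cvg j k :
  cov_estimator D rho n (h n) (dx n) j k @[n --> F] --> S j k.
Proof.
pose s n := \sum_(m < n) (small D rho (h n) (dx n) m)%:R *
  (dx n m j ord0 * dx n m k ord0).
pose s' n := \sum_(m < n) y n m j ord0 * y n m k ord0.
pose e n := 2 * K%:R * tau n ^+ 2 + 4 * (V n / tau n ^+ 2) + 3 * C * T * tau n.
have e0 : e n @[n --> F] --> 0.
  rewrite [X in _ --> X](_ : _ = 2 * K%:R * (0 * 0) + 4 * 0 + 3 * C * T * 0); last by ring.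
  apply: cvgD; [apply: cvgD|]; (apply: cvgM; first exact: cvg_cst) => //.
  exact: cvgM.
have ss' : s n - s' n @[n --> F] --> 0.
  apply/cvgr0Pnorm_le => eps eps0; have e_le := cvgr_le _ e0 _ eps0; near=> n.
  have n0 : (0 < n)%N by near: n.
  have Chtn : C * h n <= tau n / 2 by near: n.
  have Ch0 : 0 <= C * h n by rewrite mulr_ge0// ltW ?h_gt0.
  have := truncated_sum_error (tau_gt0 n0) Ch0 Chtn (@dxy n) (JK n) j k.
  rewrite -/(s n) -/(s' n) -/(V n) -/(tau n) => /le_trans; apply.
  have -> : 3 * (C * h n * n%:R * tau n) = 3 * C * T * tau n.
    by rewrite /h; field; rewrite gt_eqF ?ltr0n.
  by rewrite -/(e n); near: n; exact: e_le.
have sS : s n @[n --> F] --> T * S j k.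
  rewrite -[X in _ --> X]add0r (_ : s = (fun n => (s n - s' n) + s' n)).
    by apply: cvgD => //; exact: yS.
  by apply/funext => n; rewrite subrK.
(* [frac n * T] is the number of kept increments times [h n]. That number is eventually positive,
   which rules out the default value in [num_small_pos]. *)
suff : (frac n * T)^-1 * s n @[n --> F] --> S j k.
  apply: cvg_trans; apply: near_eq_cvg; near=> n.
  have n0 : (0 < n)%N by near: n.
  have : n%:R / 2 <= (num_small D rho n (h n) (dx n))%:R :> R.
    by near: n; exact: num_small_near_pos.
  have nR : 0 < n%:R :> R by rewrite ltr0n.
  move=> N2; rewrite /cov_estimator /num_small_pos ifF; last first.
    by apply/eqP => N0; move: N2; rewrite N0; lra.
  rewrite !mxE summxE; congr (_ * _).
    by rewrite /frac /h mulrA mulrAC.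
  apply: eq_bigr => m _; rewrite !mxE big_ord1 !mxE.
  by [].
rewrite [X in _ --> X](_ : _ = (1 * T)^-1 * (T * S j k)); last by field; rewrite gt_eqF.
apply: cvgM => //; apply: cvgV; first by rewrite mul1r gt_eqF.
by apply: cvgM; [exact: frac_small_cvg1|exact: cvg_cst].
Unshelve. all: by end_near. Qed.

End truncated_covariance.

(** * Moments of the driving noise *)

Section normal_moments.
Context {R : realType} (s : R).
Hypothesis s0 : 0 < s.
Local Notation mu := (@lebesgue_measure R).
Let phi := normal_pdf 0 s.

Let phiE x : phi x = normal_peak s * expR (- x ^+ 2 / (s ^+ 2 *+ 2)).
Proof. by rewrite /phi /normal_pdf (gt_eqF s0) /normal_fun subr0. Qed.

Let dphi (x : R) : is_derive x 1 phi (- x / s ^+ 2 * phi x).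
Proof.
rewrite (_ : phi = (fun x => normal_peak s * expR (- (s ^+ 2 *+ 2)^-1 * x ^+ 2))).
  apply: is_derive_eq.
  rewrite /= /GRing.scale/=; field.
  by rewrite gt_eqF.
by apply/funext => y; rewrite phiE; congr (_ * expR _); rewrite !mulNr mulrC.
Qed.

(** Since [phi' = - x / s ^+ 2 * phi], the derivative of [F k] is [x ^+ k.+2 * phi - k.+1 * s ^+ 2 *
    x ^+ k * phi]: integration by parts, giving the recursion between moments of order [k] and
    [k.+2] with boundary term [F k]. *)
Let F k (x : R) : R := - s ^+ 2 * x ^+ k.+1 * phi x.

Let dF k (x : R) : is_derive x 1 (F k)
  (x ^+ k.+2 * phi x - k.+1%:R * s ^+ 2 * x ^+ k * phi x).
Proof.
have dphix := dphi x.
have dX : is_derive x 1 (fun y : R => y ^+ k.+1) (k.+1%:R * x ^+ k).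
  have := is_deriveX k.+1 (is_derive_id x (1 : R)).
  by rewrite exprfctE => /is_derive_eq; apply; rewrite /GRing.scale/= mulr1.
have := is_deriveM (is_deriveM (is_derive_cst (- s ^+ 2) x 1) dX) dphix.
rewrite !mulrfctE /= => /is_derive_eq; apply.
rewrite /GRing.scale/= !exprS; field.
by rewrite gt_eqF.
Qed.

Let cphi : continuous phi.
Proof. by apply: continuous_normal_pdf; rewrite gt_eqF. Qed.

Let cXphi (k : nat) : continuous (fun x : R => x ^+ k * phi x : R).
Proof. by move=> x; apply: cvgM; [exact: exprn_continuous|exact: cphi]. Qed.

Let intXphi k (a b : R) : mu.-integrable `[a, b] (fun x => (x ^+ k * phi x)%:E).
Proof.
apply: continuous_compact_integrable; first exact: segment_compact.
by apply: continuous_subspaceT; exact: cXphi.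
Qed.

Lemma integral_normal_itv k (a b : R) : a < b ->
  (\int[mu]_(x in `[a, b]) (x ^+ k.+2 * phi x)%:E =
   (k.+1%:R * s ^+ 2)%:E * \int[mu]_(x in `[a, b]) (x ^+ k * phi x)%:E +
   (F k b - F k a)%:E)%E.
Proof.
move=> ab.
have FTC := @continuous_FTC2 R
  (fun x => x ^+ k.+2 * phi x - k.+1%:R * s ^+ 2 * x ^+ k * phi x) (F k) a b ab.
rewrite EFinB -FTC; last 3 first.
- apply: continuous_subspaceT => x; apply: cvgB; first exact: cXphi.
  under eq_fun do rewrite -mulrA; rewrite -mulrA.
  by apply: cvgM; [exact: cvg_cst|exact: cXphi].
- split.
  + by move=> x _; exact: ex_derive.
  + apply: cvg_at_right_filter; apply: differentiable_continuous.
    by apply/derivable1_diffP; exact: ex_derive.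
  + apply: cvg_at_left_filter; apply: differentiable_continuous.
    by apply/derivable1_diffP; exact: ex_derive.
- by move=> x _; have dFx := dF k x; rewrite derive1E derive_val.
rewrite -integralZl//=; under [in RHS]eq_integral do rewrite -EFinM.
have iZ : mu.-integrable `[a, b] (fun x => (k.+1%:R * s ^+ 2 * (x ^+ k * phi x))%:E).
  exact: (integrableZl _ (k.+1%:R * s ^+ 2) (intXphi k a b)).
rewrite -integralD//=; last first.
  apply: eq_integrable (integrableB _ (intXphi k.+2 a b) iZ) => // x _.
  by rewrite -EFinB mulrA.
apply: eq_integral => x _; rewrite -EFinD; congr EFin; ring.
Qed.

Let I (n : nat) : set R := `[- n.+1%:R, n.+1%:R].

(** For even [k] the integrand is nonnegative, so monotone convergence applies to the growing
    intervals. *)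
Let cvgI k : ~~ odd k ->
  (\int[mu]_(x in I n) (x ^+ k * phi x)%:E @[n --> \oo] -->
   \int[mu]_x (x ^+ k * phi x)%:E)%E.
Proof.
move=> k_even.
have <- : \bigcup_n I n = setT.
  rewrite -subTset => x _; exists (Num.truncn `|x|) => //=.
  by rewrite /I/= in_itv/= -ler_norml ltW// truncnS_gt.
apply: ge0_nondecreasing_set_cvg_integral => //=.
- apply/nondecreasing_seqP => n; rewrite subsetEset; apply: subset_itv.
    by rewrite bnd_simp lerN2 ler_nat.
  by rewrite bnd_simp ler_nat.
- by move=> n; exact: measurable_itv.
- move=> n; apply: measurable_funTS; apply/measurable_EFinP; exact: continuous_measurable_fun.
- by move=> n x _; rewrite lee_fin mulr_ge0 ?normal_pdf_ge0// exprn_even_ge0.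
Qed.

Let integralI k n : (\int[mu]_(x in I n) (x ^+ k.+2 * phi x)%:E =
   (k.+1%:R * s ^+ 2)%:E * \int[mu]_(x in I n) (x ^+ k * phi x)%:E +
   (F k n.+1%:R - F k (- n.+1%:R))%:E)%E.
Proof.
apply: integral_normal_itv; apply: (@lt_trans _ _ 0); last by rewrite ltr0n.
by rewrite oppr_lt0 ltr0n.
Qed.

(** The bound [1 + t <= expR t] already gives the decay that kills the boundary term of the second
    moment. *)
Let phi_le (x : R) : 0 < x -> x * phi x <= normal_peak s * (s ^+ 2 *+ 2) * x^-1.
Proof.
move=> x0; rewrite phiE mulrCA -mulrA ler_wpM2l ?normal_peak_ge0//.
have c0 : 0 < s ^+ 2 *+ 2 by rewrite pmulrn_lgt0// exprn_gt0.
have e_le : expR (- x ^+ 2 / (s ^+ 2 *+ 2)) <= (s ^+ 2 *+ 2) / x ^+ 2.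
  rewrite mulNr expRN -[leRHS]invf_div lef_pV2 ?posrE ?expR_gt0 ?divr_gt0 ?exprn_gt0//.
  by apply: le_trans (expR_ge1Dx _); rewrite lerDr.
apply: (le_trans (ler_wpM2l (ltW x0) e_le)).
by rewrite le_eqVlt; apply/orP; left; apply/eqP; field; rewrite gt_eqF.
Qed.

Let phiN (x : R) : phi (- x) = phi x.
Proof. by rewrite !phiE sqrrN. Qed.

Lemma integral_normal_sqr : (\int[mu]_x (x ^+ 2 * phi x)%:E = (s ^+ 2)%:E)%E.
Proof.
apply: (cvg_unique _ (@cvgI 2 isT)) => //.
have c1 := @cvgI 0 isT.
have -> : (s ^+ 2)%:E = ((1%:R * s ^+ 2)%:E * \int[mu]_x (x ^+ 0 * phi x)%:E + 0%:E)%E.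
  under eq_integral do rewrite expr0 mul1r.
  by rewrite integral_normal_pdf mule1 adde0 mul1r.
rewrite /=; under eq_cvg do rewrite integralI.
apply: cvgeD.
- by rewrite fin_num_adde_defl.
- by apply: cvgeZl.
- apply: cvg_EFin; first by near=> n.
  have c0 : (- 2 * s ^+ 2 * (normal_peak s * (s ^+ 2 *+ 2))) * n.+1%:R^-1 @[n --> \oo] --> (0 : R).
    rewrite -[X in _ --> X](mulr0 (- 2 * s ^+ 2 * (normal_peak s * (s ^+ 2 *+ 2)))).
    by apply: cvgM; [exact: cvg_cst|exact: cvg_harmonic].
  apply: (squeeze_cvgr _ c0 (cvg_cst (0 : R))); near=> n.
  rewrite /F/= phiN !expr1.
  have n0 : 0 < n.+1%:R :> R by rewrite ltr0n.
  have := phi_le n0; have := normal_pdf_ge0 0 s n.+1%:R; rewrite -/phi.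
  have s2 : 0 < s ^+ 2 by rewrite exprn_gt0.
  move: n0; move: (n.+1%:R) => N N0 p0 pl.
  have Np : 0 <= N * phi N by rewrite mulr_ge0// ltW.
  by apply/andP; split; nra.
Unshelve. all: end_near. Qed.

(** An upper bound suffices later, and for it the boundary term, being nonpositive, is simply
    dropped on each interval. *)
Lemma integral_normal_fourth : (\int[mu]_x (x ^+ 4 * phi x)%:E <= (3 * s ^+ 4)%:E)%E.
Proof.
have /cvg_lim <- // := @cvgI 4 isT; apply: lime_le.
  by apply/cvg_ex; eexists; exact: (@cvgI 4 isT).
near=> n.
rewrite integralI.
have : (\int[mu]_(x in I n) (x ^+ 2 * phi x)%:E <= (s ^+ 2)%:E)%E.
  rewrite -integral_normal_sqr; apply: ge0_subset_integral => //=.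
  - exact: measurable_itv.
  - by apply/measurable_EFinP; exact: continuous_measurable_fun.
  - by move=> x _; rewrite lee_fin mulr_ge0 ?normal_pdf_ge0// sqr_ge0.
move=> I2; apply: (@le_trans _ _ ((2.+1%:R * s ^+ 2)%:E * (s ^+ 2)%:E + 0%:E)%E).
  apply: leeD; first by apply: lee_wpmul2l I2; rewrite lee_fin mulr_ge0// sqr_ge0.
  rewrite lee_fin /F phiN -[X in _ - X]mulrA [(- _) ^+ _]exprNn !exprS expr0.
  have : 0 <= s ^+ 2 * (n.+1%:R ^+ 3 * phi n.+1%:R).
    apply: mulr_ge0; first exact: sqr_ge0.
    by apply: mulr_ge0; [rewrite exprn_ge0|exact: normal_pdf_ge0].
  rewrite !exprS expr0; lra.
by rewrite adde0 -EFinM lee_fin le_eqVlt; apply/orP; left; apply/eqP; ring.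
Unshelve. all: end_near. Qed.

(** Symmetry of [phi] under [x |-> - x]. Stated for the positive and negative parts, it compares
    integrals of nonnegative functions, before integrability is known; it yields the zero mean. *)
Lemma integral_normal_pos_neg :
  (\int[mu]_x (Num.max x 0 * phi x)%:E = \int[mu]_x (Num.max (- x) 0 * phi x)%:E)%E.
Proof.
transitivity (\int[mu]_(x in `[0%R, +oo[) (x * phi x)%:E)%E.
  rewrite [RHS]integral_mkcond; apply: eq_integral => x _; rewrite patchE.
  case: ifPn; rewrite ?inE ?notin_setE/= in_itv/= andbT => x0.
    by rewrite max_l.
  by rewrite max_r ?mul0r// ltW// ltNge; apply/negP.
transitivity (\int[mu]_(x in `]-oo, (- 0)%R]) (- x * phi x)%:E)%E; last first.
  rewrite integral_mkcond; apply: eq_integral => x _; rewrite patchE.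
  case: ifPn; rewrite ?inE ?notin_setE/= in_itv/= oppr0 => x0.
    by rewrite max_l// oppr_ge0.
  by rewrite max_r ?mul0r// oppr_le0 ltW// ltNge; apply/negP.
rewrite ge0_integration_by_substitutionNy//=.
- by apply: eq_integral => x _; rewrite /= opprK phiN.
- apply: continuous_subspaceT => x; apply: cvgM; last exact: cphi.
  by apply: cvgN; exact: cvg_id.
- move=> x; rewrite in_itv/= oppr0 => x0.
  by rewrite mulr_ge0 ?normal_pdf_ge0// oppr_ge0 ltW.
Qed.

End normal_moments.

(** Change of variables holds with the Radon-Nikodym derivative, which equals the density almost
    everywhere since both have the same integral over every measurable set. *)
Lemma ge0_integral_normal_prob (R : realType) (s : R) (f : R -> \bar R) :
  s != 0 -> measurable_fun setT f -> (forall x, 0 <= f x)%E ->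
  (\int[normal_prob 0 s]_x f x =
   \int[@lebesgue_measure R]_x (f x * (normal_pdf 0 s x)%:E))%E.
Proof.
move=> s0 mf f0.
have dom := @normal_prob_dominates R 0 s.
rewrite -(Radon_Nikodym_SigmaFinite.change_of_variables dom)//.
have intRN := Radon_Nikodym_SigmaFinite.f_integrable dom.
have mpdf := @measurable_normal_pdf R 0 s.
apply: ae_eq_integral => //.
- by apply: emeasurable_funM => //; exact: (measurable_int _ intRN).
- by apply: emeasurable_funM => //; apply/measurable_EFinP.
- apply: ae_eqe_mul2l; apply: integral_ae_eq => //; first exact/measurable_EFinP.
  by move=> E _ mE; rewrite -Radon_Nikodym_SigmaFinite.f_integral.
Qed.

(** * Independence and second moments *)

Definition independent_rvs d d1 d2 (T : measurableType d) (T1 : measurableType d1)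
    (T2 : measurableType d2) (R : realType) (P : probability T R)
    (X : T -> T1) (Y : T -> T2) :=
  forall A B, measurable A -> measurable B ->
    P (X @^-1` A `&` Y @^-1` B) = (P (X @^-1` A) * P (Y @^-1` B))%E.

Section independence.
Context d (T : measurableType d) (R : realType) (P : probability T R).

Lemma independent_rvs_comp d1 d2 d1' d2' (T1 : measurableType d1)
    (T2 : measurableType d2) (T1' : measurableType d1') (T2' : measurableType d2')
    (X : T -> T1) (Y : T -> T2) (f : T1 -> T1') (g : T2 -> T2') :
  measurable_fun setT f -> measurable_fun setT g ->
  independent_rvs P X Y -> independent_rvs P (f \o X) (g \o Y).
Proof.
move=> mf mg XY A B mA mB; apply: (XY (f @^-1` A) (g @^-1` B)).
  by rewrite -[X in measurable X]setTI; exact: mf.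
by rewrite -[X in measurable X]setTI; exact: mg.
Qed.

Section pair.
Context d1 d2 (T1 : measurableType d1) (T2 : measurableType d2).
Variables (X : T -> T1) (Y : T -> T2).
Hypotheses (mX : measurable_fun setT X) (mY : measurable_fun setT Y).

(** The law of [(X, Y)] restricted to [E] and the law of [(X, Y)] scaled by [P E] are finite
    measures that agree on rectangles, a pi-system generating the product sigma-algebra. [X] and [Y]
    may depend on each other. *)
Lemma independent_pair (E : set T) : measurable E ->
  (forall A B, measurable A -> measurable B ->
    P (E `&` (X @^-1` A `&` Y @^-1` B)) = (P E * P (X @^-1` A `&` Y @^-1` B))%E) ->
  forall C : set (T1 * T2), measurable C ->
    P (E `&` (fun w => (X w, Y w)) @^-1` C) = (P E * P ((fun w => (X w, Y w)) @^-1` C))%E.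
Proof.
move=> mE EAB C mC.
have mXY : measurable_fun setT (fun w => (X w, Y w)) by exact: measurable_fun_pair.
pose XY : {mfun T >-> (T1 * T2)%type} := HB.pack (fun w => (X w, Y w))
  (isMeasurableFun.Build _ _ _ _ _ mXY).
have PE0 : 0 <= fine (P E) by rewrite fine_ge0.
pose m1 := pushforward (mrestr P mE) XY.
pose m2 := mscale (NngNum PE0) (distribution P XY).
have PEE : P E = (fine (P E))%:E by rewrite fineK// fin_num_measure.
suff : m1 C = m2 C.
  by rewrite /m1 /m2 /mscale /distribution /pushforward /mrestr/= setIC PEE.
apply: (@measure_unique _ _ _ [set A `*` B | A in measurable & B in measurable]
  (fun=> setT)) => //.
- exact: measurable_prod_measurableType.
- move=> _ _ [A mA [B mB <-]] [A' mA' [B' mB' <-]]; rewrite -setXI.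
  by exists (A `&` A'); [exact: measurableI|exists (B `&` B'); [exact: measurableI|]].
- by move=> n; exists setT => //; exists setT => //; rewrite setXTT.
- by rewrite bigcup_const//; exists 0%N.
- move=> _ [A mA [B mB <-]].
  transitivity (P (E `&` (X @^-1` A `&` Y @^-1` B))); first by rewrite setIC.
  rewrite EAB//; transitivity ((fine (P E))%:E * P (X @^-1` A `&` Y @^-1` B))%E => //.
  by rewrite -PEE.
- move=> n; apply: (@le_lt_trans _ _ (P E)); last by rewrite ltey_eq fin_num_measure.
  by change (P (setT `&` E) <= P E)%E; rewrite setTI.
Qed.

(** Independence makes the joint law the product of the marginal laws; the rest is Tonelli. *)
Lemma independent_ge0_integral (f : T1 -> R) (g : T2 -> R) :
  independent_rvs P X Y ->
  measurable_fun setT f -> measurable_fun setT g ->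
  (forall x, 0 <= f x) -> (forall y, 0 <= g y) ->
  (\int[P]_w (f (X w) * g (Y w))%:E =
   \int[P]_w (f (X w))%:E * \int[P]_w (g (Y w))%:E)%E.
Proof.
move=> XYindep mf mg f0 g0.
have mXY : measurable_fun setT (fun w => (X w, Y w)) by exact: measurable_fun_pair.
pose X' : {mfun T >-> T1} := HB.pack X (isMeasurableFun.Build _ _ _ _ _ mX).
pose Y' : {mfun T >-> T2} := HB.pack Y (isMeasurableFun.Build _ _ _ _ _ mY).
pose XY : {mfun T >-> (T1 * T2)%type} := HB.pack (fun w => (X w, Y w))
  (isMeasurableFun.Build _ _ _ _ _ mXY).
pose h (z : T1 * T2) := (f z.1 * g z.2)%:E.
have mh : measurable_fun setT h.
  apply/measurable_EFinP; apply: measurable_funM.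
    exact: measurableT_comp.
  exact: measurableT_comp.
have h0 z : (0 <= h z)%E by rewrite lee_fin mulr_ge0.
have -> : (\int[P]_w (f (X w) * g (Y w))%:E = \int[distribution P XY]_z h z)%E.
  by rewrite ge0_integral_distribution.
have -> : (\int[P]_w (f (X w))%:E = \int[distribution P X']_x (f x)%:E)%E.
  rewrite (@ge0_integral_distribution _ _ _ _ _ P X')//.
  exact/measurable_EFinP.
have -> : (\int[P]_w (g (Y w))%:E = \int[distribution P Y']_x (g x)%:E)%E.
  rewrite (@ge0_integral_distribution _ _ _ _ _ P Y')//.
  exact/measurable_EFinP.
rewrite (eq_measure_integral (distribution P X' \x distribution P Y')%E); last first.
  move=> C mC _; apply/esym.
  apply: (@product_measure_unique _ _ _ _ _ (distribution P X') (distribution P Y')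
    (distribution P XY)) => //; exact: XYindep.
rewrite fubini_tonelli1// /fubini_F.
transitivity (\int[distribution P X']_x
    ((f x)%:E * \int[distribution P Y']_y (g y)%:E))%E.
  apply: eq_integral => x _; rewrite -ge0_integralZl//.
  - exact/measurable_EFinP.
  - by move=> y _; rewrite lee_fin.
  - by rewrite lee_fin.
rewrite ge0_integralZr//.
- exact/measurable_EFinP.
- by move=> x _; rewrite lee_fin.
- by apply: integral_ge0 => y _; rewrite lee_fin.
Qed.

End pair.
End independence.

Section second_moments.
Context d (T : measurableType d) (R : realType) (P : probability T R).
Implicit Types X Y : T -> R.
Local Notation intble X := (P.-integrable setT (EFin \o X)).

Lemma le_integrable_prob X Y : measurable_fun setT X -> intble Y ->
  (forall w, `|X w| <= Y w) -> intble X.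
Proof.
move=> mX iY XY; apply: le_integrable iY => //; first exact/measurable_EFinP.
by move=> w _ /=; rewrite lee_fin (le_trans (XY w))// ler_norm.
Qed.

Lemma integrable_EFinD X Y : intble X -> intble Y -> intble (fun w => X w + Y w).
Proof.
by move=> iX iY; apply: eq_integrable (integrableD measurableT iX iY).
Qed.

Lemma integrable_sqr X : measurable_fun setT X ->
  intble (fun w => X w ^+ 2) -> intble X.
Proof.
move=> mX iX2; apply: (@le_integrable_prob _ (fun w => 1 + X w ^+ 2)) => //.
  have i1 : intble (cst 1) by exact: finite_measure_integrable_cst.
  exact: (integrable_EFinD i1 iX2).
by move=> w; rewrite -[X w ^+ 2]real_normK ?num_real//;
  have := sqr_ge0 (`|X w| - 1); have := sqr_ge0 `|X w|; nra.
Qed.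

(** The nonnegative case is applied to the four products of positive and negative parts, which also
    yields integrability of the product. *)
Lemma independent_integralM X Y : measurable_fun setT X -> measurable_fun setT Y ->
  independent_rvs P X Y -> intble X -> intble Y ->
  intble (X \* Y) /\
  \int[P]_w (X w * Y w) = (\int[P]_w X w) * (\int[P]_w Y w).
Proof.
move=> mX mY XY iX iY.
have mid : measurable_fun setT (fun x : R => x) by exact: measurable_id.
have mpos : measurable_fun setT (fun x : R => Num.max x 0).
  by apply: measurable_maxr => //; exact: measurable_cst.
have mneg : measurable_fun setT (fun x : R => Num.max (- x) 0).
  by apply: measurable_maxr; [exact: oppr_measurable|exact: measurable_cst].
have iM (f g : R -> R) : measurable_fun setT f -> measurable_fun setT g ->
    (forall x, 0 <= f x <= `|x|) -> (forall x, 0 <= g x <= `|x|) ->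
    [/\ intble (f \o X), intble (g \o Y), intble ((f \o X) \* (g \o Y)) &
    \int[P]_w (f (X w) * g (Y w)) = (\int[P]_w f (X w)) * (\int[P]_w g (Y w))].
  move=> mf mg f0 g0.
  have ifX : intble (f \o X).
    apply: (@le_integrable_prob _ (fun w => `|X w|)).
    - exact: measurableT_comp.
    - exact: integrable_norm.
    - by move=> w /=; have /andP[? ?] := f0 (X w); rewrite ger0_norm.
  have igY : intble (g \o Y).
    apply: (@le_integrable_prob _ (fun w => `|Y w|)).
    - exact: measurableT_comp.
    - exact: integrable_norm.
    - by move=> w /=; have /andP[? ?] := g0 (Y w); rewrite ger0_norm.
  have f0' x : 0 <= f x by have /andP[] := f0 x.
  have g0' x : 0 <= g x by have /andP[] := g0 x.
  have E := independent_ge0_integral mX mY XY mf mg f0' g0'.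
  have fX := integrable_fin_num measurableT ifX.
  have gY := integrable_fin_num measurableT igY.
  split=> //; last by rewrite /Rintegral E fineM.
  apply/integrableP; split.
    by apply/measurable_EFinP; apply: measurable_funM; exact: measurableT_comp.
  under eq_integral do rewrite /= ger0_norm ?mulr_ge0//.
  by rewrite E ltey_eq fin_numM.
have max0 (x : R) : 0 <= Num.max x 0 <= `|x|.
  by rewrite le_max lexx orbT ge_max ler_norm normr_ge0.
have maxN (x : R) : 0 <= Num.max (- x) 0 <= `|x|.
  by have := max0 (- x); rewrite normrN.
have [iXp iYp ipp Epp] := iM _ _ mpos mpos max0 max0.
have [_ iYn ipn Epn] := iM _ _ mpos mneg max0 maxN.
have [iXn _ inp Enp] := iM _ _ mneg mpos maxN max0.
have [_ _ inn Enn] := iM _ _ mneg mneg maxN maxN.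
have decomp (x : R) : x = Num.max x 0 - Num.max (- x) 0.
  have [x0|x0] := leP x 0.
    by rewrite max_l ?oppr_ge0// sub0r opprK.
  by rewrite max_r ?subr0// oppr_le0 ltW.
have EX : \int[P]_w X w = \int[P]_w Num.max (X w) 0 - \int[P]_w Num.max (- X w) 0.
  by rewrite -RintegralB//; apply: eq_Rintegral => w _; exact: decomp.
have EY : \int[P]_w Y w = \int[P]_w Num.max (Y w) 0 - \int[P]_w Num.max (- Y w) 0.
  by rewrite -RintegralB//; apply: eq_Rintegral => w _; exact: decomp.
pose Q1 w := Num.max (X w) 0 * Num.max (Y w) 0 + Num.max (- X w) 0 * Num.max (- Y w) 0.
pose Q2 w := Num.max (X w) 0 * Num.max (- Y w) 0 + Num.max (- X w) 0 * Num.max (Y w) 0.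
have iQ1 : intble Q1 by exact: (integrable_EFinD ipp inn).
have iQ2 : intble Q2 by exact: (integrable_EFinD ipn inp).
have QE w : X w * Y w = Q1 w - Q2 w.
  by rewrite [in LHS](decomp (X w)) [in LHS](decomp (Y w)) /Q1 /Q2; ring.
split.
  apply: eq_integrable (integrableB measurableT iQ1 iQ2) => //.
  by move=> w _ /=; rewrite -EFinB -QE.
transitivity (\int[P]_w (Q1 w - Q2 w)).
  by apply: eq_Rintegral => w _; exact: QE.
by rewrite RintegralB// /Q1 /Q2 !RintegralD// Epp Epn Enp Enn EX EY; ring.
Qed.

(** Each term is centred and independent of the preceding partial sum, so the cross term in the
    expanded square has mean zero and second moments add up. *)
Lemma sum_independent_second_moment (xi : nat -> T -> R) (v : R) :
  (forall m, measurable_fun setT (xi m)) ->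
  (forall m, intble (fun w => xi m w ^+ 2)) ->
  (forall m, \int[P]_w xi m w = 0) ->
  (forall m, \int[P]_w (xi m w ^+ 2) <= v) ->
  (forall m, independent_rvs P (fun w => \sum_(i < m) xi i w) (xi m)) ->
  forall n, intble (fun w => (\sum_(i < n) xi i w) ^+ 2) /\
    \int[P]_w ((\sum_(i < n) xi i w) ^+ 2) <= n%:R * v.
Proof.
move=> mxi ixi xi0 xiv indep; elim=> [|n [iS ES]].
  split.
    apply: eq_integrable (integrable0 P setT) => // w _ /=.
    by rewrite big_ord0 expr0n.
  rewrite mul0r le_eqVlt; apply/orP; left; apply/eqP.
  under eq_Rintegral do rewrite big_ord0 expr0n/=.
  by rewrite Rintegral_cst//= mul0r.
pose S w := \sum_(i < n) xi i w.
have mS : measurable_fun setT S by apply: measurable_sum.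
have iS1 : intble S by exact: integrable_sqr.
have ixi1 : intble (xi n) by exact: integrable_sqr.
have [iM EM] := independent_integralM mS (mxi n) (indep n) iS1 ixi1.
have i2M : intble (fun w => 2 * (S w * xi n w)).
  by apply: eq_integrable (integrableZl measurableT 2 iM).
have i3 := integrable_EFinD i2M (ixi n).
have i4 := integrable_EFinD iS i3.
have E w : (\sum_(i < n.+1) xi i w) ^+ 2 =
    S w ^+ 2 + (2 * (S w * xi n w) + xi n w ^+ 2).
  by rewrite big_ord_recr/= -/(S w); ring.
split; first by apply: eq_integrable i4 => // w _ /=; rewrite E.
under eq_Rintegral do rewrite E.
rewrite RintegralD// RintegralD// RintegralZl// EM xi0 mulr0 mulr0 add0r.
by rewrite -natr1 mulrDl mul1r lerD.
Qed.

Section normal.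
Variables (X : T -> R) (s : R).
Hypotheses (s0 : 0 < s) (mX : measurable_fun setT X).
Hypothesis lawX : forall B, measurable B -> P (X @^-1` B) = normal_prob 0 s B.

Let normal_ge0_integral (f : R -> R) : measurable_fun setT f -> (forall x, 0 <= f x) ->
  (\int[P]_w (f (X w))%:E = \int[@lebesgue_measure R]_x (f x * normal_pdf 0 s x)%:E)%E.
Proof.
move=> mf f0.
pose X' : {mfun T >-> measurableTypeR R} :=
  HB.pack X (isMeasurableFun.Build _ _ T (measurableTypeR R) X mX).
have -> : (\int[P]_w (f (X w))%:E = \int[distribution P X']_x (f x)%:E)%E.
  by rewrite (@ge0_integral_distribution _ _ _ _ _ P X')//; exact/measurable_EFinP.
transitivity (\int[normal_prob 0 s]_x (f x)%:E)%E.
  by apply: eq_measure_integral => B mB _; exact: lawX.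
by rewrite ge0_integral_normal_prob ?gt_eqF//; exact/measurable_EFinP.
Qed.

Let intble_ge0 (f : R -> R) c : measurable_fun setT f -> (forall x, 0 <= f x) ->
  (\int[P]_w (f (X w))%:E <= c%:E)%E -> intble (f \o X).
Proof.
move=> mf f0 fc; apply/integrableP; split.
  by apply/measurable_EFinP; exact: measurableT_comp.
under eq_integral do rewrite /= ger0_norm//.
by apply: (le_lt_trans fc); rewrite ltry.
Qed.

Lemma normal_sqr : intble (fun w => X w ^+ 2) /\ \int[P]_w (X w ^+ 2) = s ^+ 2.
Proof.
have mf : measurable_fun setT (fun x : R => x ^+ 2) by exact: exprn_measurable.
have E : (\int[P]_w (X w ^+ 2)%:E = (s ^+ 2)%:E)%E.
  by rewrite (normal_ge0_integral mf) ?integral_normal_sqr// => x; exact: sqr_ge0.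
split; last by rewrite /Rintegral E.
by apply: (intble_ge0 (c := s ^+ 2) mf); [move=> x; exact: sqr_ge0|rewrite E].
Qed.

Lemma normal_fourth : intble (fun w => X w ^+ 4) /\ \int[P]_w (X w ^+ 4) <= 3 * s ^+ 4.
Proof.
have mf : measurable_fun setT (fun x : R => x ^+ 4) by exact: exprn_measurable.
have x4 (x : R) : 0 <= x ^+ 4 by rewrite exprn_even_ge0.
have E : (\int[P]_w (X w ^+ 4)%:E <= (3 * s ^+ 4)%:E)%E.
  by rewrite (normal_ge0_integral mf)//; exact: integral_normal_fourth.
have i4 : intble (fun w => X w ^+ 4) by exact: (intble_ge0 mf x4 E).
split=> //; rewrite /Rintegral -lee_fin fineK//.
exact: (integrable_fin_num measurableT i4).
Qed.

Lemma normal_mean : \int[P]_w X w = 0.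
Proof.
have mpos : measurable_fun setT (fun x : R => Num.max x 0).
  by apply: measurable_maxr; [exact: measurable_id|exact: measurable_cst].
have mneg : measurable_fun setT (fun x : R => Num.max (- x) 0).
  by apply: measurable_maxr; [exact: oppr_measurable|exact: measurable_cst].
have pos0 (x : R) : 0 <= Num.max x 0 by rewrite le_max lexx orbT.
have E : (\int[P]_w (Num.max (X w) 0)%:E = \int[P]_w (Num.max (- X w) 0)%:E)%E.
  rewrite (normal_ge0_integral mpos)// (normal_ge0_integral mneg)//.
  exact: integral_normal_pos_neg.
have [iX2 _] := normal_sqr.
have iX := integrable_sqr mX iX2.
have ip : intble (fun w => Num.max (X w) 0).
  apply: (@le_integrable_prob _ (fun w => `|X w|)); [exact: (measurableT_comp mpos mX)| |].
    exact: integrable_norm.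
  by move=> w /=; rewrite ger0_norm// ge_max ler_norm normr_ge0.
have im : intble (fun w => Num.max (- X w) 0).
  apply: (@le_integrable_prob _ (fun w => `|X w|)); [exact: (measurableT_comp mneg mX)| |].
    exact: integrable_norm.
  by move=> w /=; rewrite ger0_norm// -normrN ge_max ler_norm normr_ge0.
transitivity (\int[P]_w (Num.max (X w) 0 - Num.max (- X w) 0)).
  apply: eq_Rintegral => w _; have [x0|x0] := leP (X w) 0.
    by rewrite max_l ?oppr_ge0// sub0r opprK.
  by rewrite max_r ?subr0// oppr_le0 ltW.
by rewrite RintegralB// /Rintegral E subrr.
Qed.

End normal.
End second_moments.

(** * Moments and independence of the Wiener increments on the grid *)

Section wiener_increments.
Context (R : realType) (dO : measure_display) (Omega : measurableType dO).
Variables (P : probability Omega R) (F : R -> set (set Omega)).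
Variables (d r : latent -> nat).
Variable W : forall i, R -> Omega -> 'cV[R]_(r i).
Variable mu : forall i, Omega -> {measure set (R * 'cV[R]_(d i)) -> \bar R}.
Hypothesis filF : filtration F.
Hypothesis wienerW : forall i, wiener_process P F (W i).
Hypothesis indepW : independent_drivers P F W mu.

Let noise := {i : latent & 'I_(r i)}.
Implicit Types a b : noise.
Variable h : R.
Hypothesis h0 : 0 < h.

Definition noise_increment a (m : nat) (w : Omega) : R :=
  (W (tag a) (m.+1%:R * h) w - W (tag a) (m%:R * h) w) (tagged a) ord0.

Local Notation dW := noise_increment.

Let grid_ge0 m : 0 <= m%:R * h.
Proof. by rewrite mulr_ge0// ltW. Qed.

Let grid_lt m : m%:R * h < m.+1%:R * h.
Proof. by rewrite ltr_pM2r// ltr_nat. Qed.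

Let grid_step m : m.+1%:R * h - m%:R * h = h.
Proof. by rewrite -mulrBl -natr1 addrAC subrr add0r mul1r. Qed.

(** [F t] is already a sigma-algebra, hence equal to the one it generates. Seeing it as a measurable
    type makes the closure properties of measurable functions available for [F t]. *)
Lemma filtration_measurable_fun t (f : Omega -> R) : 0 <= t ->
  measurable_fun setT (f : g_sigma_algebraType (F t) -> R) <->
  forall B, measurable B -> F t (f @^-1` B).
Proof.
move=> t0; have [sF _ _] := filF; have FE : <<s F t >> = F t.
  exact: sigma_algebra_id (sF t t0).
split=> [mf B mB|mf _ B mB].
  by have := mf measurableT B mB; rewrite setTI /measurable/= FE.
by rewrite setTI /measurable/= FE; exact: mf.
Qed.

Lemma adapted_noise_increment a m k : (m < k)%N ->
  measurable_fun setT (dW a m : g_sigma_algebraType (F (k%:R * h)) -> R).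
Proof.
move=> mk; have [_ _ ndF] := filF.
have mW l : (l <= k)%N -> measurable_fun setT
    ((fun w => W (tag a) (l%:R * h) w (tagged a) ord0) : g_sigma_algebraType (F (k%:R * h)) -> R).
  move=> lk; apply/filtration_measurable_fun => // B mB.
  apply: (ndF (l%:R * h)) => //; first by rewrite ler_pM2r// ler_nat.
  have -> : (fun w => W (tag a) (l%:R * h) w (tagged a) ord0) @^-1` B =
    W (tag a) (l%:R * h) @^-1` ((fun v : 'cV[R]_(r (tag a)) => v (tagged a) ord0) @^-1` B).
    by [].
  apply: (wiener_adapted (wienerW (tag a))) => //.
  by rewrite -[X in measurable X]setTI; exact: measurable_mx_entry.
rewrite (_ : dW a m = (fun w => W (tag a) (m.+1%:R * h) w (tagged a) ord0) \-
   (fun w => W (tag a) (m%:R * h) w (tagged a) ord0)).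
  by apply: measurable_funB; apply: mW => //; exact: ltnW.
by apply/funext => w; rewrite /noise_increment !mxE.
Qed.

Lemma measurable_filtration t (f : Omega -> R) : 0 <= t ->
  measurable_fun setT (f : g_sigma_algebraType (F t) -> R) -> measurable_fun setT f.
Proof.
move=> t0 /(filtration_measurable_fun _ t0) mf _ B mB.
by have [_ Fm _] := filF; rewrite setTI; apply: Fm (mf _ mB).
Qed.

Lemma measurable_noise_increment a m : measurable_fun setT (dW a m).
Proof. exact: measurable_filtration (grid_ge0 m.+1) (adapted_noise_increment a (ltnSn m)). Qed.

Lemma noise_increment_law a m B : measurable B ->
  P (dW a m @^-1` B) = normal_prob 0 (Num.sqrt h) B.
Proof.
move=> mB; case: a => i j.
have mW := measurable_noise_increment (Tagged (fun i => 'I_(r i)) j) m.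
rewrite -[LHS]fineK; last by apply: fin_num_measure; rewrite -[X in measurable X]setTI; exact: mW.
rewrite -[RHS]fineK ?fin_num_measure//; congr EFin.
have mB' k : measurable (if k == j then B else setT) by case: ifP.
have := wiener_normal (wienerW i) (grid_ge0 m) (grid_lt m) mB'.
rewrite grid_step (bigD1 j)//= eqxx big1 => [|k kj]; last first.
  by rewrite (negPf kj) probability_setT.
rewrite mulr1 => <-; congr (fine (P _)); apply/seteqP; split=> w /=.
  by move=> Bw k; case: eqP => // ->.
by move=> /(_ j); rewrite eqxx.
Qed.

Let prob_fin E : measurable E -> P E \is a fin_num.
Proof. by move=> mE; exact: fin_num_measure. Qed.

Let measurable_noise_event a m A : measurable A -> measurable (dW a m @^-1` A).
Proof.
by move=> mA; rewrite -[X in measurable X]setTI; exact: measurable_noise_increment.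
Qed.

Let coord_event i (j : 'I_(r i)) A : measurable A ->
  measurable [set v : 'cV[R]_(r i) | A (v j ord0)].
Proof. by move=> mA; rewrite -[X in measurable X]setTI; exact: measurable_mx_entry. Qed.

Let noise_event_sigma i (j : 'I_(r i)) m A : measurable A ->
  sigma_gen [set u | m%:R * h <= u] (fun u w => W i u w - W i (m%:R * h) w)
    (dW (Tagged (fun i => 'I_(r i)) j) m @^-1` A).
Proof.
move=> mA; apply: sub_sigma_algebra.
exists (m.+1%:R * h), [set v : 'cV[R]_(r i) | A (v j ord0)]; split=> //.
  exact: ltW.
exact: coord_event.
Qed.

(** For two coordinates of one Wiener process, [wiener_normal] factors the joint law and
    [wiener_independent] splits off the past. For different processes, [independent_drivers] at time
    [m%:R * h] is applied to the past and the two noise sigma-fields. *)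
Lemma noise_increments_indep a b m E A B : a != b -> F (m%:R * h) E ->
  measurable A -> measurable B ->
  P (E `&` (dW a m @^-1` A `&` dW b m @^-1` B)) =
  (P E * (P (dW a m @^-1` A) * P (dW b m @^-1` B)))%E.
Proof.
move=> ab FE mA mB.
have mE : measurable E by have [_ Fm _] := filF; exact: Fm FE.
have mEA := measurable_noise_event a m mA.
have mEB := measurable_noise_event b m mB.
rewrite -[LHS]fineK; last by apply: prob_fin; do 2?apply: measurableI.
rewrite -[RHS]fineK; last by rewrite !fin_numM// prob_fin.
congr EFin; rewrite !fineM ?fin_numM ?prob_fin//.
case: a b ab mEA mEB => [i j] [i' j'] ab mEA mEB.
have [ii'|ii'] := eqVneq i i'.
  subst i'; have jj' : j' != j by apply: contra_neq ab => ->.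
  have mB' k : measurable (if k == j then A else if k == j' then B else setT).
    by case: ifP => // _; case: ifP.
  have := wiener_normal (wienerW i) (grid_ge0 m) (grid_lt m) mB'.
  rewrite grid_step (bigD1 j)//= eqxx (bigD1 j')//= eqxx (negPf jj').
  rewrite big1 => [|k /andP[kj kj']]; last first.
    by rewrite (negPf kj) (negPf kj') probability_setT.
  rewrite mulr1 !noise_increment_law// => <-.
  rewrite (_ : [set w | _] = dW (Tagged (fun i => 'I_(r i)) j) m @^-1` A `&`
    dW (Tagged (fun i => 'I_(r i)) j') m @^-1` B); last first.
    apply/seteqP; split=> w /=.
      by move=> H; have := H j; have := H j'; rewrite !eqxx (negPf jj').
    by move=> [Aw Bw] k; case: eqP => [->//|_]; case: eqP => // ->.
  rewrite -fineM ?prob_fin//; last exact: measurableI.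
  congr fine; exact: (wiener_independent (wienerW i) (grid_ge0 m) (ltW (grid_lt m)) FE
    (measurableI _ _ (coord_event j mA) (coord_event j' mB))).
pose J : {set option (latent + latent)} :=
  (None |: (Some (inl i) |: [set Some (inl i')]))%SET.
pose G (k : option (latent + latent)) := match k with
  | None => E
  | Some (inl k) => if k == i then dW (Tagged (fun i => 'I_(r i)) j) m @^-1` A
                    else dW (Tagged (fun i => 'I_(r i)) j') m @^-1` B
  | Some (inr _) => setT end.
have := @indepW _ (grid_ge0 m) J G.
rewrite /J !big_setU1 ?inE ?eqE//= ?(negPf ii')// big_set1 /G eqxx eq_sym (negPf ii').
move=> <-; last first.
  move=> k; rewrite !inE => /or3P[] /eqP -> //=.
    by rewrite eqxx; exact: noise_event_sigma.
  by rewrite eq_sym (negPf ii'); exact: noise_event_sigma.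
congr (fine (P _)); apply/seteqP; split=> w /=.
  move=> [Ew [Aw Bw]] k /=; rewrite !inE => /or3P[] /eqP -> //=.
    by rewrite eqxx.
  by rewrite eq_sym (negPf ii').
move=> H; split; first by apply: (H None); rewrite /= !inE.
split; first by have := H (Some (inl i)); rewrite /= !inE !eqxx ?orbT; apply.
by have := H (Some (inl i')); rewrite /= !inE !eqxx ?orbT [i' == i]eq_sym (negPf ii'); apply.
Qed.

Lemma independent_noise_increments a b m : a != b ->
  independent_rvs P (dW a m) (dW b m).
Proof.
move=> ab A B mA mB; have := @noise_increments_indep a b m setT A B ab.
rewrite setTI probability_setT mul1e; apply=> //.
have [sF _ _] := filF; have [F0 FC _] := sF _ (grid_ge0 m).
by rewrite -(setD0 setT); exact: FC.
Qed.

(** This includes [a = b], where the two increments coincide but the pair is still independent of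
    the past. *)
Lemma noise_increments_past a b m E A B : F (m%:R * h) E -> measurable A -> measurable B ->
  P (E `&` (dW a m @^-1` A `&` dW b m @^-1` B)) =
  (P E * P (dW a m @^-1` A `&` dW b m @^-1` B))%E.
Proof.
move=> FE mA mB; have [ab|ab] := eqVneq a b; last first.
  by rewrite noise_increments_indep// independent_noise_increments.
rewrite -{b}ab; case: a => i j.
exact: (wiener_independent (wienerW i) (grid_ge0 m) (ltW (grid_lt m)) FE
  (coord_event j (measurableI _ _ mA mB))).
Qed.

Lemma noise_increment_moments a m :
  [/\ P.-integrable setT (EFin \o (fun w => dW a m w ^+ 2)),
      P.-integrable setT (EFin \o (fun w => dW a m w ^+ 4)),
      \int[P]_w dW a m w = 0, \int[P]_w (dW a m w ^+ 2) = h &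
      \int[P]_w (dW a m w ^+ 4) <= 3 * h ^+ 2].
Proof.
have s0 : 0 < Num.sqrt h by rewrite sqrtr_gt0.
have mV := measurable_noise_increment a m.
have law := noise_increment_law a m.
have sh : Num.sqrt h ^+ 2 = h by rewrite sqr_sqrtr// ltW.
have [i2 E2] := normal_sqr s0 mV (@law).
have [i4 E4] := normal_fourth s0 mV (@law).
split=> //; first exact: normal_mean s0 mV (@law).
- by rewrite E2.
- by rewrite (_ : h ^+ 2 = Num.sqrt h ^+ 4)// (exprM _ 2 2) sh.
Qed.

Definition covariation_error a b m w := dW a m w * dW b m w - (a == b)%:R * h.

Local Notation xi := covariation_error.

(** On the diagonal the second moment is the fourth moment minus [h ^+ 2], at most [2 * h ^+ 2]; off
    the diagonal it is [h ^+ 2] by independence. The bound [3 * h ^+ 2] covers both. *)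
Lemma covariation_error_moments a b m :
  [/\ measurable_fun setT (xi a b m),
      P.-integrable setT (EFin \o (fun w => xi a b m w ^+ 2)),
      \int[P]_w xi a b m w = 0 & \int[P]_w (xi a b m w ^+ 2) <= 3 * h ^+ 2].
Proof.
have mW a' := measurable_noise_increment a' m.
have mxi : measurable_fun setT (xi a b m).
  by apply: measurable_funB; [exact: measurable_funM|exact: measurable_cst].
have [i2 i4 E1 E2 E4] := noise_increment_moments a m.
have [i2' i4' E1' E2' E4'] := noise_increment_moments b m.
have [ab|ab] := eqVneq a b.
  subst b.
  have cst_int c : \int[P]_w (cst c) w = c.
    have PT : fine (P setT) = 1 by rewrite probability_setT.
    by rewrite Rintegral_cst// -[RHS]mulr1 -PT.
  have xiE w : xi a a m w = dW a m w ^+ 2 + (- h) by rewrite /xi eqxx mul1r expr2.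
  have icst c : P.-integrable setT (EFin \o cst c) by exact: finite_measure_integrable_cst.
  have xi2E w : xi a a m w ^+ 2 = dW a m w ^+ 4 + (- (2 * h) * dW a m w ^+ 2 + h ^+ 2).
    by rewrite xiE; ring.
  have i2h : P.-integrable setT (EFin \o (fun w => - (2 * h) * dW a m w ^+ 2)).
    by apply: eq_integrable (integrableZl measurableT (- (2 * h)) i2).
  have i3 := integrable_EFinD i2h (icst (h ^+ 2)).
  split.
  - by [].
  - by apply: eq_integrable (integrable_EFinD i4 i3) => // w _ /=; rewrite xi2E.
  - under eq_Rintegral do rewrite xiE.
    by rewrite (RintegralD measurableT i2 (icst (- h))) E2 cst_int subrr.
  - under eq_Rintegral do rewrite xi2E.
    rewrite (RintegralD measurableT i4 i3) (RintegralD measurableT i2h (icst _)).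
    rewrite RintegralZl// cst_int E2.
    by have := sqr_ge0 h; nra.
have iab := independent_noise_increments m ab.
have i1 := integrable_sqr (mW a) i2; have i1' := integrable_sqr (mW b) i2'.
have [_ Eab] := independent_integralM (mW a) (mW b) iab i1 i1'.
have msq : measurable_fun setT (fun x : R => x ^+ 2) by exact: exprn_measurable.
have iab2 := independent_rvs_comp msq msq iab.
have [iab4 Eab2] := independent_integralM (measurableT_comp msq (mW a))
  (measurableT_comp msq (mW b)) iab2 i2 i2'.
have xiE w : xi a b m w = dW a m w * dW b m w by rewrite /xi (negPf ab) mul0r subr0.
split=> //.
- by apply: eq_integrable iab4 => // w _ /=; rewrite xiE exprMn.
- by under eq_Rintegral do rewrite xiE; rewrite Eab E1 mul0r.
- under eq_Rintegral do rewrite xiE exprMn.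
  by rewrite [X in X <= _]Eab2/= E2 E2'; have := sqr_ge0 h; nra.
Qed.

Lemma covariation_error_sum a b n :
  P.-integrable setT (EFin \o (fun w => (\sum_(m < n) xi a b m w) ^+ 2)) /\
  \int[P]_w ((\sum_(m < n) xi a b m w) ^+ 2) <= n%:R * (3 * h ^+ 2).
Proof.
apply: sum_independent_second_moment.
- by move=> m; have [] := covariation_error_moments a b m.
- by move=> m; have [] := covariation_error_moments a b m.
- by move=> m; have [] := covariation_error_moments a b m.
- by move=> m; have [] := covariation_error_moments a b m.
move=> m A B mA mB.
(* The partial sum is measurable for [F] at time [m%:R * h], and the next error is a function of the
   pair of increments over the following cell, so [independent_pair] applies. *)
have sF : measurable_fun setT
    ((fun w => \sum_(i < m) xi a b i w) : g_sigma_algebraType (F (m%:R * h)) -> R).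
  apply: measurable_sum => k; apply: measurable_funB; last exact: measurable_cst.
  by apply: measurable_funM; apply: adapted_noise_increment.
have FE := (filtration_measurable_fun _ (grid_ge0 m)).1 sF _ mA.
set E := _ @^-1` A in FE *.
have mE : measurable E by have [_ Fm _] := filF; exact: Fm FE.
pose f (z : R * R) := z.1 * z.2 - (a == b)%:R * h.
have mf : measurable_fun setT f.
  by apply: measurable_funB; [exact: measurable_funM|exact: measurable_cst].
have mC : measurable (f @^-1` B) by rewrite -[X in measurable X]setTI; exact: mf.
apply: (independent_pair (measurable_noise_increment a m) (measurable_noise_increment b m)
  mE _ mC) => A' B' mA' mB'.
exact: noise_increments_past.
Qed.

End wiener_increments.

(** * Pathwise increments of the latent processes *)

Section cadlag_path.
Context {R : realType} (d : nat).
Variable S : R -> 'cV[R]_d.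
Hypothesis S_right : forall t, 0 <= t -> S u @[u --> t^'+] --> S t.
Hypothesis S_left : forall t, 0 < t -> cvg (S u @[u --> t^'-]).

Let Sl t : 'cV[R]_d := lim (S u @[u --> t^'-]).

(** Near each [t] the path is bounded by its right value on one side and by its left limit on the
    other; compactness of the segment does the rest. *)
Lemma cadlag_bounded (T : R) : exists C, forall t, 0 <= t <= T -> `|S t| <= C.
Proof.
suff : \forall C \near +oo, `[0, T] `<=` [set t | 0 <= t -> `|S t| <= C].
  move=> [C [_ CP]]; exists (C + 1) => t t0T.
  have t_in : `[0, T]%classic t by rewrite /= in_itv.
  apply: CP t_in _; first by rewrite ltrDl.
  by case/andP: t0T.
have /compact_near_coveringP := @segment_compact R 0 T; apply.
move=> t; rewrite /= in_itv/= => /andP[t0 _].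
have right_near : \forall u \near t, t < u -> `|S u| <= `|S t| + 1.
  have : \forall u \near t^'+, `|S u| <= `|S t| + 1.
    by apply: (cvgr_norm_le _ (S_right t0)); rewrite ltrDl.
  by rewrite near_withinE.
(* Nothing is known about [S] at negative times, so at [t = 0] the left side must be made empty by
   the guard [0 <= u]. *)
have [L left_near] : exists L, \forall u \near t, 0 <= u -> u < t -> `|S u| <= L.
  have [t_gt0|t_le0] := ltP 0 t; last first.
    exists 0; near=> u => u0 ut; have := lt_le_trans ut t_le0.
    by rewrite ltNge u0.
  exists (`|Sl t| + 1).
  have : \forall u \near t^'-, `|S u| <= `|Sl t| + 1.
    by apply: (cvgr_norm_le _ (S_left t_gt0)); rewrite ltrDl.
  by rewrite near_withinE; apply: filterS => u + _.
pose C0 := Num.max L (`|S t| + 1).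
near=> u C.
have C0C : C0 <= C by near: C; apply: nbhs_pinfty_ge; exact: num_real.
have u_right : t < u -> `|S u| <= `|S t| + 1 by near: u.
have u_left : 0 <= u -> u < t -> `|S u| <= L by near: u.
move=> u0; apply: le_trans C0C.
rewrite /C0 le_max; have [ut|ut|->] := ltgtP u t.
- by apply/orP; left; exact: u_left.
- by apply/orP; right; exact: u_right.
- by rewrite lerDl ler01 orbT.
Unshelve. all: by end_near. Qed.

Lemma left_limit_bounded (T C : R) : (forall t, 0 <= t <= T -> `|S t| <= C) ->
  forall t, 0 < t <= T -> `|Sl t| <= C.
Proof.
move=> SC t /andP[t0 tT].
have cvgN : `|S u| @[u --> t^'-] --> `|Sl t| by apply: cvg_norm; exact: S_left.
apply: (cvgr_to_le cvgN); near=> u; apply: SC; apply/andP; split.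
  by near: u; exact: nbhs_left_ge.
by rewrite (le_trans _ tT)//; near: u; exact: nbhs_left_le.
Unshelve. all: by end_near. Qed.

Let grid_cell n (x : R) : 0 < x <= n%:R -> exists2 k, (k < n)%N & k%:R < x <= k.+1%:R.
Proof.
elim: n => [|n IHn] /andP[x0 xn]; first by have := lt_le_trans x0 xn; rewrite ltxx.
have [x_le|x_gt] := leP x n%:R; last by exists n => //; rewrite x_gt.
have [|k kn kx] := IHn; first by rewrite x0.
by exists k => //; exact: ltnW.
Qed.

(* The left limit is the pointwise limit of the step functions taking on each
   cell the value of S at its left end. *)
Lemma measurable_left_limit (T : R) (j : 'I_d) : 0 < T ->
  measurable_fun `]0, T] (fun t => Sl t j ord0).
Proof.
move=> T0.
pose cell n k : set R := `]k%:R * (T / n%:R), k.+1%:R * (T / n%:R)]%classic.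
pose Sn n t := \sum_(k < n.+1) \1_(cell n.+1 k) t * S (k%:R * (T / n.+1%:R)) j ord0.
apply: (@measurable_fun_cvg _ _ _ _ Sn) => [n|t].
  apply: measurable_sum => k; apply: measurable_funM; last exact: measurable_cst.
  by apply/measurable_indic; exact: measurable_itv.
rewrite /= in_itv/= => /andP[t0 tT].
have cvgj : S u j ord0 @[u --> t^'-] --> Sl t j ord0.
  exact: (@cvg_comp _ _ _ S (fun M : 'cV[R]_d => M j ord0) _ _ _
    (S_left t0) (@coord_continuous R d 1 j ord0 (Sl t))).
apply/cvgrPdist_lt => e e0.
have /cvgrPdist_lt/(_ e e0) := cvgj; rewrite near_withinE.
move=> [del /= del0 near_t].
have hT : T / n.+1%:R @[n --> \oo] --> (0 : R).
  rewrite -[X in _ --> X](mulr0 T); apply: cvgM; first exact: cvg_cst.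
  exact: cvg_harmonic.
have h_lt := cvgr_lt _ hT _ del0.
near=> n.
have hn : T / n.+1%:R < del by near: n; exact: h_lt.
have h0 : 0 < T / n.+1%:R by rewrite divr_gt0// ltr0n.
have [|k kn /andP[k_lt k_ge]] := @grid_cell n.+1 (t / (T / n.+1%:R)).
  rewrite divr_gt0//= ler_pdivrMr//.
  by rewrite (_ : n.+1%:R * (T / n.+1%:R) = T)// mulrC divfK// pnatr_eq0.
rewrite /Sn (bigD1 (Ordinal kn))//= indicE mem_set; last first.
  by rewrite /cell/= in_itv/= -ltr_pdivlMr// k_lt/= -ler_pdivrMr.
rewrite mul1r big1 ?addr0 => [|l lk]; last first.
  rewrite indicE memNset ?mul0r// /cell/= in_itv/= -ltr_pdivlMr// -ler_pdivrMr//.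
  move=> /andP[l_lt l_ge]; move: lk; rewrite -val_eqE/= => /eqP; apply.
  have : (l%:R < k.+1%:R :> R) by exact: lt_le_trans l_lt k_ge.
  have : (k%:R < l.+1%:R :> R) by exact: lt_le_trans k_lt l_ge.
  by rewrite !ltr_nat !ltnS => kl lk; apply/eqP; rewrite eqn_leq kl lk.
move: k_lt k_ge; rewrite ltr_pdivlMr// ler_pdivrMr// => k_lt k_ge.
apply: near_t => //; rewrite /ball/=.
rewrite ger0_norm ?subr_ge0 ?(ltW k_lt)//.
rewrite ltrBlDl; apply: le_lt_trans k_ge _.
by rewrite -[k.+1%:R]natr1 mulrDl mul1r ltrD2l.
Unshelve. all: by end_near. Qed.

End cadlag_path.

Lemma le_coord_norm (R : realType) m n (A : 'M[R]_(m, n)) i j : `|A i j| <= `|A|.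
Proof.
by rewrite -[leRHS]/(mx_norm A) mx_normrE (le_bigmax _ (fun k => `|A k.1 k.2|) (i, j)).
Qed.

Lemma enorm_le_card (R : realType) n (v : 'cV[R]_n) (C : R) : 0 <= C ->
  (forall i, `|v i ord0| <= C) -> enorm v <= n.+1%:R * C.
Proof.
move=> C0 vC; have nC0 : 0 <= n.+1%:R * C by rewrite mulr_ge0.
rewrite -(@ler_pXn2r _ 2) ?nnegrE ?enorm_ge0// sqr_enorm_cV.
apply: (@le_trans _ _ (\sum_(i < n) C ^+ 2)).
  apply: ler_sum => i _; rewrite -[v i ord0 ^+ 2]real_normK ?num_real//.
  by rewrite lerXn2r ?nnegrE.
rewrite sumr_const card_ord exprMn -[leLHS]mulr_natl; apply: ler_wpM2r; first exact: sqr_ge0.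
rewrite -natrX ler_nat (@leq_trans n.+1)//.
by rewrite -[n.+1 in leqLHS]expn1 leq_pexp2l.
Qed.

Lemma measurable_nonzero (R : realType) d : measurable (@nonzero R d).
Proof.
rewrite (_ : nonzero = \bigcup_(i in [set: 'I_d]) [set z : 'cV[R]_d | z i ord0 != 0]).
  apply: fin_bigcup_measurable => // i _.
  rewrite (_ : [set z | _] = (fun z : 'cV[R]_d => z i ord0) @^-1` [set~ 0]).
    rewrite -[X in measurable X]setTI; apply: measurable_mx_entry => //.
    exact: measurableC.
  by apply/seteqP; split=> z /=; [move/eqP|move=> ?; apply/eqP].
apply/seteqP; split=> z /=; last first.
  by move=> [i _ /=]; apply: contra_neq => ->; rewrite mxE.
rewrite /nonzero/= => z0; apply: contrapT => H; move/eqP: z0; apply.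
apply/matrixP => i j; rewrite ord1 mxE; apply: contrapT => zi; apply: H.
by exists i => //=; apply/eqP.
Qed.

Section path_integrals.
Context {R : realType} (d : nat).
Variables (S : R -> 'cV[R]_d) (T : R).
Hypothesis T0 : 0 < T.
Hypothesis S_right : forall t, 0 <= t -> S u @[u --> t^'+] --> S t.
Hypothesis S_left : forall t, 0 < t -> cvg (S u @[u --> t^'-]).

Let Sl (t : R) : 'cV[R]_d := lim (S u @[u --> t^'-]).
(** Extension by zero, so that the left limits are measurable on the whole line and compose with the
    coefficients. *)
Let g (t : R) : 'cV[R]_d := if t \in `]0, T] then Sl t else 0.

Let measurable_g : measurable_fun setT g.
Proof.
apply/measurable_fun_mxP => i j; rewrite ord1.
rewrite (_ : (fun t => g t i ord0) = (fun t => Sl t i ord0) \_ `]0, T]).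
  apply/(measurable_restrictT _ _).1; first exact: measurable_itv.
  exact: measurable_left_limit.
apply/funext => t; rewrite patchE /g; case: ifPn => tT.
  by rewrite mem_set.
by rewrite memNset ?mxE//; exact/negP.
Qed.

Lemma drift_increment_le (a : 'cV[R]_d -> 'cV[R]_d) (L : R) : 0 <= L ->
  measurable_fun setT a ->
  (forall x y, enorm (a x - a y) <= L * enorm (x - y)) ->
  exists2 C, 0 <= C & forall s t j, 0 <= s -> s <= t -> t <= T ->
    `|(vintegral lebesgue_measure `]0, t] (fun u => a (Sl u))
       - vintegral lebesgue_measure `]0, s] (fun u => a (Sl u))) j ord0| <= C * (t - s).
Proof.
move=> L0 ma aL.
have [C1 SC1] := cadlag_bounded S_right S_left T.
have C1_ge0 : 0 <= C1 by apply: le_trans (normr_ge0 _) (SC1 0 _); rewrite lexx ltW.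
have SlC1 := left_limit_bounded S_left SC1.
(* Lipschitz growth from the origin: [enorm (a x) <= enorm (a 0) + L * enorm x], where
   [d.+1%:R * C1] bounds the Euclidean norm of a left limit through its max norm. *)
pose C := enorm (a 0) + L * (d.+1%:R * C1).
have C0 : 0 <= C by rewrite addr_ge0 ?enorm_ge0// mulr_ge0// mulr_ge0.
pose f j u := a (Sl u) j ord0.
have fC j u : 0 < u <= T -> `|f j u| <= C.
  move=> uT; rewrite /f (_ : a (Sl u) j ord0 = (a (Sl u) - a 0) j ord0 + a 0 j ord0).
    rewrite (le_trans (ler_normD _ _))// addrC lerD ?ler_norm_enorm//.
    apply: (le_trans (ler_norm_enorm _ _ _)); apply: (le_trans (aL _ _)).
    rewrite subr0 ler_wpM2l// enorm_le_card// => i.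
    by apply: le_trans (SlC1 u uT); exact: le_coord_norm.
  by rewrite !mxE subrK.
have mf j : measurable_fun `]0, T] (f j).
  apply: (@eq_measurable_fun _ _ _ _ _ (fun u => a (g u) j ord0)).
    by move=> u; rewrite inE/= => uT; rewrite /g uT.
  apply: measurable_funTS.
  apply: (measurableT_comp (measurable_mx_entry j ord0)).
  exact: (measurableT_comp ma measurable_g).
exists C => // s t j s0 st tT.
have itv_fin u v : (lebesgue_measure (`]u, v]%classic : set R) < +oo)%E.
  by rewrite lebesgue_measure_itv/=; case: ifP => // _; rewrite -EFinB ltry.
have intf : (@lebesgue_measure R).-integrable `]0, t] (EFin \o f j).
  apply: measurable_bounded_integrable.
  - exact: measurable_itv.
  - exact: itv_fin.
  - apply: measurable_funS (mf j); first exact: measurable_itv.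
    by apply: subset_itv; rewrite bnd_simp.
  - exists C; split; first exact: num_real.
    move=> x Cx u /=; rewrite in_itv/= => /andP[u0 ut].
    by apply: ltW; apply: le_lt_trans Cx; apply: fC; rewrite u0 (le_trans ut).
rewrite !mxE.
have -> : \int[lebesgue_measure]_(x in `]0, t]) a (Sl x) j ord0 -
    \int[lebesgue_measure]_(x in `]0, s]) a (Sl x) j ord0 =
    \int[lebesgue_measure]_(x in `]s, t]) f j x.
  by apply: Rintegral_itvB => //; rewrite ?bnd_simp.
have intf' : (@lebesgue_measure R).-integrable `]s, t] (EFin \o f j).
  apply: integrableS intf; [exact: measurable_itv|exact: measurable_itv|].
  by apply: subset_itv; rewrite bnd_simp.
apply: (le_trans (le_normr_Rintegral _ intf')); first exact: measurable_itv.
apply: (@le_trans _ _ (\int[lebesgue_measure]_(x in `]s, t]) C)).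
  apply: le_Rintegral.
  - exact: measurable_itv.
  - exact: integrable_norm.
  - apply: measurable_bounded_integrable.
    + exact: measurable_itv.
    + exact: itv_fin.
    + exact: measurable_cst.
    + exact: bounded_cst.
  - move=> u /=; rewrite in_itv/= => /andP[su ut]; apply: fC.
    by rewrite (le_lt_trans s0 su) (le_trans ut).
rewrite Rintegral_cst; last exact: measurable_itv.
rewrite (_ : fine _ = t - s)//.
rewrite -[LHS]/(fine (lebesgue_measure (`]s, t]%classic : set R))) lebesgue_measure_itv/=.
rewrite lte_fin; move: st; rewrite le_eqVlt => /orP[/eqP->|->//].
by rewrite ltxx subrr.
Qed.

(** The two domains differ by a null set. It is removed from the positive and the negative part
    separately, so the equality holds whether or not the integrals are finite. *)
Lemma jump_increment_eq0 (c : 'cV[R]_d -> 'cV[R]_d -> 'cV[R]_d)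
    (mu : {measure set (R * 'cV[R]_d) -> \bar R}) s t :
  measurable_fun (setT `*` nonzero) (fun y => c y.1 y.2) ->
  0 <= s -> s <= t -> t <= T -> mu (`]s, t] `*` nonzero) = 0%E ->
  vintegral mu (`]0, t] `*` nonzero) (fun q => c (Sl q.1) q.2) =
  vintegral mu (`]0, s] `*` nonzero) (fun q => c (Sl q.1) q.2).
Proof.
move=> mc s0 st tT mu0; apply/matrixP => j k; rewrite !mxE {k}.
pose f (q : R * 'cV[R]_d) := c (Sl q.1) q.2 j ord0.
have mnz : measurable (@nonzero R d) by exact: measurable_nonzero.
have mI u v : measurable ((`]u, v] `*` nonzero) : set (R * 'cV[R]_d)).
  by apply: measurableX => //; exact: measurable_itv.
have mf : measurable_fun (`]0, t] `*` nonzero) f.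
  apply: (@eq_measurable_fun _ _ _ _ _ (fun q => c (g q.1) q.2 j ord0)).
    move=> q; rewrite inE/= in_itv/= => -[/andP[q0 qt] _].
    by rewrite /g /f in_itv/= q0 (le_trans qt).
  apply: (measurableT_comp (measurable_mx_entry j ord0)).
  apply: (measurable_comp (F := setT `*` nonzero) (f := fun y => c y.1 y.2)
    (g := fun q : R * 'cV[R]_d => (g q.1, q.2))) => //.
  - exact: measurableX.
  - by move=> _ [q [_ qnz] <-].
  - apply: measurable_funTS; apply: measurable_fun_pair.
      exact: (measurableT_comp measurable_g measurable_fst).
    exact: measurable_snd.
have setE : (`]0, t] `*` nonzero) `\` (`]s, t] `*` nonzero) =
    (`]0, s] `*` nonzero : set (R * 'cV[R]_d)).
  apply/seteqP; split=> -[u z] /=; rewrite !in_itv/=.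
    move=> [[/andP[u0 ut] zn] H]; split=> //; rewrite u0 leNgt; apply/negP => su.
    by apply: H; rewrite su ut.
  move=> [/andP[u0 us] zn]; rewrite u0 (le_trans us st); split=> // -[/andP[su _] _].
  by have := lt_le_trans su us; rewrite ltxx.
rewrite /Rintegral; congr fine; rewrite [LHS]integralE [RHS]integralE; congr (_ - _)%E.
  rewrite (ge0_negligible_integral (mI s t) (mI 0 t))// ?setE//.
  by apply: measurable_funepos; apply/measurable_EFinP.
rewrite (ge0_negligible_integral (mI s t) (mI 0 t))// ?setE//.
by apply: measurable_funeneg; apply/measurable_EFinP.
Qed.

End path_integrals.

(** * Finite jump activity *)

Lemma esum_poisson_pmf (R : realType) (m : R) : 0 <= m ->
  (\sum_(k <oo) (expR (- m) * m ^+ k / k`!%:R)%:E = 1)%E.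
Proof.
rewrite le_eqVlt => /orP[/eqP<-|m0].
  (* At rate zero only the term [k = 0] survives, because [0 ^+ 0 = 1]. *)
  rewrite (@nneseriesD1 _ _ 0%N xpredT)//.
  rewrite oppr0 expR0 expr0 fact0 invr1 !mulr1 eseries0 ?adde0// => -[|k] _ //= _.
  by rewrite expr0n/= mulr0 mul0r.
have : poisson_prob m 0 setT = 1%E by exact: probability_setT.
rewrite /poisson_prob m0 -nneseries_esumT; last first.
  by move=> *; rewrite lee_fin poisson_pmf_ge0.
move=> <-; apply: eq_eseriesr => k _; congr EFin.
by rewrite /poisson_pmf m0; ring.
Qed.

Section poisson_finite.
Context (R : realType) (dO : measure_display) (Omega : measurableType dO).
Variables (P : probability Omega R) (F : R -> set (set Omega)) (d : nat).
Variable mu : Omega -> {measure set (R * 'cV[R]_d) -> \bar R}.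

(** The Poisson weights sum to 1, so the events that [mu w A] is a given natural number exhaust the
    space up to a null set. *)
Lemma prm_finite (f : 'cV[R]_d -> R) A : poisson_random_measure P F mu f ->
  measurable A -> A `<=` @jump_space R d -> (intensity f A < +oo)%E ->
  (0 <= intensity f A)%E ->
  {ae P, forall w, exists k : nat, mu w A = k%:R%:E}.
Proof.
move=> prm mA AJ If If0.
set m := fine (intensity f A).
have m0 : 0 <= m by exact: fine_ge0.
pose E k := [set w | mu w A = k%:R%:E].
have mE k : measurable (E k).
  have -> : E k = (fun w => mu w A) @^-1` [set k%:R%:E] by [].
  by rewrite -[X in measurable X]setTI; apply: (prm_measurable prm).
have tE : trivIset setT E.
  apply/trivIsetP => i j _ _ ij; apply/seteqP; split=> // w [Ei Ej].
  have [/eqP] : i%:R%:E = j%:R%:E :> \bar R by rewrite -Ei -Ej.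
  by rewrite eqr_nat (negPf ij).
have mU : measurable (\bigcup_k E k) by exact: bigcupT_measurable.
have PE : P (\bigcup_k E k) = 1%E.
  rewrite measure_semi_bigcup// -(esum_poisson_pmf m0).
  by apply: eq_eseriesr => k _; exact: (prm_law prm mA AJ If k).
exists (~` \bigcup_k E k); split; first exact: measurableC.
  by rewrite probability_setC// PE subee.
by move=> w /= H [k _ Ek]; apply: H; exists k.
Qed.

(** By Tonelli the integral factors into [lambda], the length of []0, T]] and the total mass 1 of
    the density. *)
Lemma intensity_finite (dens : 'cV[R]_d -> R) (lambda T : R) :
  0 < lambda -> probability_density dens -> 0 < T ->
  (0 <= intensity (fun z => (lambda * dens z)%R) (`]0%R, T] `*` nonzero) < +oo)%E.
Proof.
move=> l0 [mdens dens0 int1] T0.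
have mnz := @measurable_nonzero R d.
have mI : measurable (`]0%R, T]%classic : set R) by exact: measurable_itv.
apply/andP; split.
  by apply: integral_ge0 => -[t z] [_ /= zn]; rewrite lee_fin; apply: mulr_ge0; [exact: ltW|exact: dens0].
pose g := dens \_ nonzero.
have mg : measurable_fun setT g by exact: (measurable_restrictT dens mnz).1 mdens.
have g0 z : 0 <= g z.
  by rewrite /g patchE; case: ifPn => //; rewrite inE => /dens0.
pose phi (q : R * 'cV[R]_d) := \1_(`]0%R, T]%classic : set R) q.1 * (lambda * g q.2).
have phi0 q : (0 <= (phi q)%:E)%E by rewrite lee_fin !mulr_ge0// ltW.
have mphi : measurable_fun setT (fun q => (phi q)%:E).
  apply/measurable_EFinP; apply: measurable_funM.
    by apply: measurableT_comp => //; exact: measurable_indic.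
  apply: measurable_funM; first exact: measurable_cst.
  exact: (measurableT_comp mg measurable_snd).
have -> : intensity (fun z => (lambda * dens z)%R) (`]0%R, T] `*` nonzero) =
    (\int[(lebesgue_measure \x lebesgue_cV d)%E]_q (phi q)%:E)%E.
  rewrite /intensity integral_mkcond; apply: eq_integral => -[t z] _.
  rewrite patchE /phi /g/= indicE patchE.
  case: ifPn; rewrite ?inE ?notin_setE/=.
    by move=> [tT zn]; rewrite !mem_set// mul1r.
  move=> H; have [tT|tT] := boolP (t \in (`]0%R, T]%classic : set R)); last by rewrite mul0r.
  rewrite memNset ?mulr0// => zn; apply: H; split=> //.
  by move: tT; rewrite inE.
rewrite fubini_tonelli1// /fubini_F.
have intg : (\int[lebesgue_cV d]_z (g z)%:E = 1)%E.
  rewrite -int1 [RHS]integral_mkcond; apply: eq_integral => z _.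
  by rewrite /g !patchE; case: ifP.
rewrite [X in (X < _)%E](_ : _ = lambda%:E *
    \int[@lebesgue_measure R]_x (\1_(`]0%R, T]%classic : set R) x)%:E)%E; last first.
  rewrite -ge0_integralZl//; last 2 first.
  - by apply/measurable_EFinP; exact: measurable_indic.
  - by rewrite lee_fin ltW.
  apply: eq_integral => x _; rewrite /phi/=.
  under eq_integral do rewrite mulrCA mulrA EFinM.
  rewrite ge0_integralZl//.
  - by rewrite intg mule1 EFinM.
  - exact/measurable_EFinP.
  - by move=> z _; rewrite lee_fin.
  - by rewrite lee_fin mulr_ge0// ltW.
rewrite integral_indic// setIT lte_mul_pinfty ?lee_fin ?ltW//.
rewrite -[X in (X < _)%E]/(lebesgue_measure (`]0%R, T]%classic : set R)).
by rewrite lebesgue_measure_itv/= lte_fin T0 -EFinB ltry.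
Qed.

End poisson_finite.

(** * Increments of a latent process over cells without jumps *)

Section latent_increments.
Context (R : realType) (dO : measure_display) (Omega : measurableType dO).
Variables (P : probability Omega R) (F : R -> set (set Omega)) (d r : nat).
Variable mu : Omega -> {measure set (R * 'cV[R]_d) -> \bar R}.
Variable T : R.
Hypothesis T0 : 0 < T.

Let cell n m : set (R * 'cV[R]_d) :=
  `]m%:R * (T / n%:R), m.+1%:R * (T / n%:R)] `*` nonzero.

Let measurable_cell n m : measurable (cell n m).
Proof. by apply: measurableX; [exact: measurable_itv|exact: measurable_nonzero]. Qed.

Let grid_ge0 n m : 0 <= m%:R * (T / n%:R).
Proof. by rewrite !mulr_ge0 ?invr_ge0// ltW. Qed.

Let grid_le n m : (0 < n)%N -> (m <= n)%N -> m%:R * (T / n%:R) <= T.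
Proof.
move=> n0 mn; rewrite mulrA ler_pdivrMr ?ltr0n// mulrC ler_wpM2l ?(ltW T0)//.
by rewrite ler_nat.
Qed.

(** The cells are disjoint parts of a set of mass [K], and a cell charged by an integer-valued
    measure has mass at least 1. The bound is uniform in [n]. *)
Lemma count_jump_cells (f : 'cV[R]_d -> R) w (K n : nat) : poisson_random_measure P F mu f -> (0 < n)%N ->
  mu w (`]0, T] `*` nonzero) = K%:R%:E ->
  (\sum_(m < n) (mu w (cell n m) != 0%E) <= K)%N.
Proof.
move=> prm n0 muK.
have h0 : 0 < T / n%:R by rewrite divr_gt0// ltr0n.
have disj i j : (i < j)%N -> cell n i `&` cell n j = set0.
  move=> ij; apply/seteqP; split=> // -[u z] [[uI _] [uJ _]].
  move: uI uJ; rewrite /= !in_itv/= => /andP[_ u_le] /andP[u_gt _].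
  have := lt_le_trans u_gt u_le; rewrite ltr_pM2r// ltr_nat ltnS.
  by rewrite leqNgt ij.
have tcell : trivIset setT (cell n).
  apply/trivIsetP => i j _ _; rewrite neq_ltn => /orP[ij|ji]; first exact: disj.
  by rewrite setIC disj.
have : (\sum_(m < n) mu w (cell n m) <= K%:R%:E)%E.
  rewrite -muK -measure_bigsetU//.
  rewrite le_measure ?inE//.
  - by apply: bigsetU_measurable => i _.
  - by apply: measurableX; [exact: measurable_itv|exact: measurable_nonzero].
  rewrite -bigcup_mkord => -[u z] [i /= i_n [/= + zn]]; rewrite in_itv/= => /andP[u0 u1].
  by split=> //=; rewrite in_itv/= (le_lt_trans (grid_ge0 _ _) u0) (le_trans u1)// grid_le.
have cell_ge m : ((mu w (cell n m) != 0%E)%:R%:E <= mu w (cell n m))%E.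
  have [|->|[k ->]] := prm_integer prm w (measurable_cell n m).
  - move=> q [qI qnz]; move: qI; rewrite /= in_itv/= => /andP[v0 _]; split=> //=.
    by rewrite in_itv/= andbT (le_trans (grid_ge0 _ _) (ltW v0)).
  - by rewrite leey.
  - by case: k => [|k]; rewrite ?eqxx// lee_fin ler_nat (leq_trans (leq_b1 _)).
move=> le_K; rewrite -(ler_nat R) -lee_fin; apply: le_trans le_K.
by rewrite natr_sum -sumEFin; apply: lee_sum.
Qed.

Variables (x0 : 'cV[R]_d) (a : 'cV[R]_d -> 'cV[R]_d) (M : 'M[R]_(d, r)).
Variables (c : 'cV[R]_d -> 'cV[R]_d -> 'cV[R]_d) (W : R -> Omega -> 'cV[R]_r).
Variables (S : R -> Omega -> 'cV[R]_d) (lambda : R) (dens : 'cV[R]_d -> R).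

(** On a cell without jumps only the drift separates the increment from its Gaussian part. [C] and
    [K] depend on the path but not on [n], and one null set serves all [n]. *)
Lemma latent_increment_approx : poisson_random_measure P F mu (fun z => lambda * dens z) ->
  0 < lambda -> probability_density dens ->
  measurable_fun setT a -> measurable_fun (setT `*` nonzero) (fun y => c y.1 y.2) ->
  lipschitz_coefficients a c -> cadlag S -> sde_solution P x0 a M c W mu S ->
  {ae P, forall w, exists C (K : nat), 0 <= C /\ forall n, (0 < n)%N ->
    (\sum_(m < n) (mu w (cell n m) != 0%E) <= K)%N /\
    forall m j, (m < n)%N -> mu w (cell n m) = 0%E ->
      `|(S (m.+1%:R * (T / n%:R)) w - S (m%:R * (T / n%:R)) w -
         M *m (W (m.+1%:R * (T / n%:R)) w - W (m%:R * (T / n%:R)) w)) j ord0|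
        <= C * (T / n%:R)}.
Proof.
move=> prm l0 pdens ma mc [L [g [L0 _ aL _ _]]] cadS sde.
have [If0 Ify] := andP (intensity_finite l0 pdens T0).
have mA : measurable ((`]0, T] `*` nonzero) : set (R * 'cV[R]_d)).
  by apply: measurableX; [exact: measurable_itv|exact: measurable_nonzero].
have AJ : (`]0, T] `*` nonzero) `<=` @jump_space R d.
  move=> q [qI qnz]; move: qI; rewrite /= in_itv/= => /andP[u0 _]; split=> //=.
  by rewrite in_itv/= andbT ltW.
have := prm_finite prm mA AJ Ify If0.
apply: filterS2 sde => w sdew [K muK].
have [Sr Sl] := cadS w.
have [C C0 driftC] := drift_increment_le T0 Sr Sl (ltW L0) ma aL.
exists C, K; split=> // n n0; split; first exact: (count_jump_cells prm n0 muK).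
move=> m j mn mucell.
have h0 : 0 < T / n%:R by rewrite divr_gt0// ltr0n.
have hT : m.+1%:R * (T / n%:R) <= T by exact: grid_le.
have s0 := grid_ge0 n m.
have st : m%:R * (T / n%:R) <= m.+1%:R * (T / n%:R) by rewrite ler_wpM2r ?(ltW h0)// ler_nat.
have jump := jump_increment_eq0 T0 Sl mc s0 st hT mucell.
have := driftC _ _ j s0 st hT.
have -> : m.+1%:R * (T / n%:R) - m%:R * (T / n%:R) = T / n%:R.
  by rewrite -mulrBl -natr1 addrAC subrr add0r mul1r.
apply: le_trans; rewrite le_eqVlt; apply/orP; left; apply/eqP; congr (`|_|).
rewrite (sdew _ s0) (sdew _ (le_trans s0 st)) /left_limit jump.
set V1 := vintegral _ _ _; set V2 := vintegral _ _ _; set V3 := vintegral _ _ _.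
congr (fun_of_matrix _ j ord0); rewrite mulmxBr.
by rewrite !opprD !opprK; apply/matrixP => k l; rewrite !mxE; ring.
Qed.

End latent_increments.

(** * Measurability of the test statistic *)

(** The sigma-algebra is generated by the entries, and balls for the max norm are finite
    intersections of coordinate conditions; an open set is the union of the countably many balls
    with rational centre and radius [1 / (k + 1)] that it contains. *)
Lemma open_measurable_cV (R : realType) q (U : set 'cV[R]_q) : open U -> measurable U.
Proof.
move=> oU.
pose center (z : 'cV[rat]_q) : 'cV[R]_q := \col_i ratr (z i ord0).
pose B (c : 'cV[rat]_q * nat) : set 'cV[R]_q := ball (center c.1) c.2.+1%:R^-1.
have mB c : measurable (B c).
  rewrite (_ : B c = \bigcap_(i in [set: 'I_q])
    [set v : 'cV[R]_q | ball (center c.1 i ord0) c.2.+1%:R^-1 (v i ord0)]).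
    apply: fin_bigcap_measurable => // i _.
    rewrite -[X in measurable X]setTI.
    by apply: (measurable_mx_entry i ord0) => //; exact: measurable_ball.
  apply/seteqP; split=> v /=.
    by move=> [_ Bv] i _ /=; exact: Bv.
  by move=> Bv; split=> // i j; rewrite ord1; exact: Bv.
pose D := [set c | B c `<=` U].
rewrite (_ : U = \bigcup_(c in D) B c).
  rewrite bigcup_mkcond; apply: countable_bigcupT_measurable => // c.
  by case: ifP.
apply/seteqP; split=> [v Uv|v [c Dc Bv]]; last exact: Dc.
have := open_nbhs_nbhs (conj oU Uv) => /nbhs_ballP[e /= e0 ve].
(* Two radii must fit into [e]: from [v] to the rational centre, and from there to an arbitrary
   point of the ball. *)
have [k ke] : exists k : nat, k.+1%:R^-1 < e / 2.
  exists (Num.truncn (e / 2)^-1).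
  rewrite -[ltRHS]invrK ltf_pV2 ?posrE ?invr_gt0 ?divr_gt0//.
  exact: truncnS_gt.
have k0 : 0 < k.+1%:R^-1 :> R by rewrite invr_gt0.
have zP i : exists z : rat, `|v i ord0 - ratr z| < k.+1%:R^-1.
  have lt_v : v i ord0 - k.+1%:R^-1 < v i ord0 + k.+1%:R^-1.
    by rewrite ltrD2l (lt_trans _ k0)// oppr_lt0.
  have [z] := rat_in_itvoo lt_v; rewrite in_itv/= => /andP[z1 z2]; exists z.
  by rewrite distrC ltr_distl z1 z2.
pose z : 'cV[rat]_q := \col_i sval (cid (zP i)).
have zE i : `|v i ord0 - center z i ord0| < k.+1%:R^-1.
  by rewrite !mxE; exact: svalP (cid (zP i)).
have Bv : B (z, k) v.
  by split=> // i j; rewrite ord1 /ball/= distrC.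
exists (z, k) => // u [_ Bu]; apply: ve; split=> // i j; rewrite ord1 /ball/=.
apply: (le_lt_trans (ler_distD (center z i ord0) (v i ord0) (u i ord0))).
rewrite [ltRHS]splitr; apply: ltrD; first exact: lt_trans (zE i) ke.
exact: lt_trans (Bu i ord0) ke.
Qed.

Lemma measurable_continuous_cV (R : realType) q (U : set 'cV[R]_q) (f : 'cV[R]_q -> R) :
  open U -> (forall x, U x -> {for x, continuous f}) -> measurable_fun U f.
Proof.
move=> oU cf; apply: (measurability _ (RGenOInfty.measurableE R)).
move=> _ [_ [x ->] <-]; apply: open_measurable_cV.
rewrite openE => y [Uy /= fy]; rewrite /interior.
apply: filterI; first exact: open_nbhs_nbhs.
apply: (cf _ Uy); apply: open_nbhs_nbhs; split=> //; exact: interval_open.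
Qed.

(** If the quadratic form of such a Gram matrix vanishes at [x], every weighted term vanishes, hence
    the matrix kills [x]. This replaces [posdef], which quantifies over all vectors, by a condition
    on the determinant that is visibly measurable. *)
Lemma gram_posdef (R : realType) p (c : R) (I : finType) (b : I -> R) (v : I -> 'cV[R]_p) :
  0 < c -> (forall i, 0 <= b i) ->
  posdef (c *: \sum_i b i *: (v i *m (v i)^T)) <->
  \det (c *: \sum_i b i *: (v i *m (v i)^T)) != 0.
Proof.
move=> c0 b0; set A := c *: _; split=> [pA|dA].
  by have [dA _ _] := posdef_stein pA; rewrite gt_eqF.
have uA : A \in unitmx by rewrite unitmxE unitfE.
pose u i (x : 'cV[R]_p) := ((v i)^T *m x) ord0 ord0.
have Ax x : A *m x = c *: \sum_i (b i * u i x) *: v i.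
  rewrite -scalemxAl mulmx_suml; congr (_ *: _); apply: eq_bigr => i _.
  rewrite -scalemxAl -mulmxA [X in v i *m X]mx11_scalar mul_mx_scalar.
  by rewrite scalerA.
have xAx x : (x^T *m A *m x) ord0 ord0 = c * \sum_i b i * u i x ^+ 2.
  rewrite -mulmxA Ax -scalemxAr mxE; congr (_ * _).
  rewrite mulmx_sumr summxE; apply: eq_bigr => i _.
  rewrite -scalemxAr mxE expr2 mulrA; congr (_ * _).
  by rewrite /u -[in RHS](trmxK x) -trmx_mul [in RHS]mxE.
split.
  rewrite linearZ linear_sum/=; congr (_ *: _); apply: eq_bigr => i _.
  by rewrite linearZ/= trmx_mul trmxK.
move=> x x0; rewrite xAx mulr_gt0// lt_neqAle eq_sym.
have sq_ge0 i : 0 <= b i * u i x ^+ 2 by rewrite mulr_ge0// sqr_ge0.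
rewrite sumr_ge0 ?andbT//; apply: contra_neq x0 => /eqP.
rewrite psumr_eq0// => /allP bu0.
rewrite -[x](mulKmx uA) Ax big1 ?scaler0 ?mulmx0// => i _.
have := bu0 i; rewrite mem_index_enum => /(_ isT)/=.
by rewrite mulf_eq0 sqrf_eq0 => /orP[] /eqP ->; rewrite ?mul0r ?mulr0 scale0r.
Qed.

Section measurable_matrices.
Context d (Omega : measurableType d) (R : realType).
Local Notation mfun f := (measurable_fun [set: Omega] f).

Lemma measurable_det n (A : Omega -> 'M[R]_n) :
  (forall i j, mfun (fun w => A w i j)) -> mfun (fun w => \det (A w)).
Proof.
move=> mA; apply: measurable_sum => s; apply: measurable_funM.
  exact: measurable_cst.
by apply: measurable_prod => i _; exact: mA.
Qed.

Lemma measurable_invr_gt0 (f : Omega -> R) : mfun f -> (forall w, 0 < f w) ->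
  mfun (fun w => (f w)^-1).
Proof.
move=> mf f0; rewrite (_ : (fun w => _) = (fun w => expR (- ln (f w)))); last first.
  by apply/funext => w; rewrite expRN lnK// posrE.
apply: (measurableT_comp (@measurable_expR R)).
apply: (measurableT_comp (@oppr_measurable R setT)).
exact: (measurableT_comp (@measurable_ln R) mf).
Qed.

Lemma measurable_invmx n (A : Omega -> 'M[R]_n) i j :
  (forall i j, mfun (fun w => A w i j)) -> (forall w, 0 < \det (A w)) ->
  mfun (fun w => invmx (A w) i j).
Proof.
move=> mA dA; rewrite (_ : (fun w => _) = (fun w => (\det (A w))^-1 * (\adj (A w)) i j)).
  apply: measurable_funM.
    by apply: measurable_invr_gt0 => //; exact: measurable_det.
  rewrite (_ : (fun w => _) = (fun w => (-1) ^+ (j + i) * \det (row' j (col' i (A w))))).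
    apply: measurable_funM; first exact: measurable_cst.
    apply: measurable_det => k l.
    rewrite (_ : (fun w => _) = (fun w => A w (lift j k) (lift i l))) ?mA//.
    by apply/funext => w; rewrite !mxE.
  by apply/funext => w; rewrite mxE.
by apply/funext => w; rewrite /invmx unitmxE unitfE gt_eqF// mxE.
Qed.

Lemma measurable_tr_mulmx n (A B : Omega -> 'M[R]_n) :
  (forall i j, mfun (fun w => A w i j)) -> (forall i j, mfun (fun w => B w i j)) ->
  mfun (fun w => \tr (A w *m B w)).
Proof.
move=> mA mB; rewrite (_ : (fun w => _) = (fun w => \sum_i \sum_j A w i j * B w j i)).
  by apply: measurable_sum => i; apply: measurable_sum => j; exact: measurable_funM.
by apply/funext => w; apply: eq_bigr => i _; rewrite mxE.
Qed.

Lemma measurable_enorm m (v : Omega -> 'cV[R]_m) :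
  (forall i, mfun (fun w => v w i ord0)) -> mfun (fun w => enorm (v w)).
Proof.
move=> mv; apply: (measurableT_comp (continuous_measurable_fun (@sqrt_continuous R))).
apply: measurable_sum => i; rewrite (_ : (fun w => _) = (fun w => v w i ord0 ^+ 2)).
  exact: measurable_funX.
by apply/funext => w; rewrite big_ord1.
Qed.

Section statistic.
Variables (p n : nat) (D rho h : R) (dx : Omega -> nat -> 'cV[R]_p).
Hypotheses (n0 : (0 < n)%N) (h0 : 0 < h).
Hypothesis mdx : forall m i, mfun (fun w => dx w m i ord0).

Let msmall m : mfun (fun w => (small D rho h (dx w) m)%:R : R).
Proof.
pose E := [set w | small D rho h (dx w) m].
rewrite (_ : (fun w => _) = \1_E).
  apply: measurable_indic.
  rewrite (_ : E = (fun w => enorm (dx w m)) @^-1` `]-oo, D * h `^ rho]).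
    by rewrite -[X in measurable X]setTI; apply: measurable_enorm => //.
  by apply/seteqP; split=> w; rewrite /= in_itv.
apply/funext => w; rewrite indicE; congr (_%:R).
by rewrite /E; case: (boolP (small _ _ _ _ _)) => sw; [rewrite mem_set|rewrite memNset//; apply/negP].
Qed.

Lemma measurable_num_small : mfun (fun w => (num_small D rho n h (dx w))%:R : R).
Proof.
under eq_fun do rewrite /num_small natr_sum.
by apply: measurable_sum => m; exact: msmall.
Qed.

Lemma measurable_cov_estimator i j : mfun (fun w => cov_estimator D rho n h (dx w) i j).
Proof.
pose N w : R := (num_small D rho n h (dx w))%:R.
have mN : mfun N by exact: measurable_num_small.
pose E := N @^-1` [set 0].
have mE : measurable E by rewrite -[X in measurable X]setTI; exact: mN.
(* The default value [n] is added exactly on the event [N w = 0], which turns the case distinction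
   into a measurable expression. *)
have NposE w : (num_small_pos D rho n h (dx w))%:R = N w + n%:R * \1_E w :> R.
  rewrite /num_small_pos indicE; case: eqP => [N0|N0].
    by rewrite mem_set ?/E /= /N N0// add0r mulr1.
  rewrite memNset ?mulr0 ?addr0// /E/= => /eqP; rewrite /N pnatr_eq0 => /eqP.
  exact: N0.
have Npos w : 0 < (num_small_pos D rho n h (dx w))%:R :> R.
  by rewrite /num_small_pos ltr0n; case: eqP => // /eqP; rewrite lt0n.
rewrite (_ : (fun w => _) = (fun w => ((num_small_pos D rho n h (dx w))%:R * h)^-1 *
    \sum_(m < n) (small D rho h (dx w) m)%:R * (dx w m i ord0 * dx w m j ord0))).
  apply: measurable_funM.
    apply: measurable_invr_gt0; last by move=> w; rewrite mulr_gt0.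
    apply: measurable_funM; last exact: measurable_cst.
    under eq_fun do rewrite NposE; apply: measurable_funD => //.
    by apply: measurable_funM; [exact: measurable_cst|exact: measurable_indic].
  apply: measurable_sum => m; apply: measurable_funM; first exact: msmall.
  by apply: measurable_funM; exact: mdx.
apply/funext => w; rewrite !mxE summxE; congr (_ * _); apply: eq_bigr => m _.
by rewrite !mxE big_ord1 !mxE.
Qed.

Lemma posdef_cov_estimator w : posdef (cov_estimator D rho n h (dx w)) <->
  \det (cov_estimator D rho n h (dx w)) != 0.
Proof.
apply: gram_posdef => [|m]; last exact: ler0n.
rewrite invr_gt0 mulr_gt0// ltr0n /num_small_pos; case: eqP => // /eqP.
by rewrite lt0n.
Qed.

Lemma cov_estimator_pdE w : cov_estimator_pd D rho n h (dx w) =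
  if \det (cov_estimator D rho n h (dx w)) == 0 then 1%:M
  else cov_estimator D rho n h (dx w).
Proof.
rewrite /cov_estimator_pd; case: asboolP => [/posdef_cov_estimator/negPf->//|npd].
by case: eqP => // /eqP/posdef_cov_estimator/npd.
Qed.

Lemma measurable_cov_estimator_pd i j :
  mfun (fun w => cov_estimator_pd D rho n h (dx w) i j).
Proof.
pose E := (fun w => \det (cov_estimator D rho n h (dx w))) @^-1` [set 0].
have mE : measurable E.
  rewrite -[X in measurable X]setTI; apply: measurable_det => //.
  exact: measurable_cov_estimator.
rewrite (_ : (fun w => _) = (fun w => \1_E w * (1%:M : 'M[R]_p) i j +
    (1 - \1_E w) * cov_estimator D rho n h (dx w) i j)).
  apply: measurable_funD; apply: measurable_funM.
  - exact: measurable_indic.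
  - exact: measurable_cst.
  - by apply: measurable_funB; [exact: measurable_cst|exact: measurable_indic].
  - exact: measurable_cov_estimator.
apply/funext => w; rewrite cov_estimator_pdE indicE; case: eqP => dw.
  by rewrite mem_set// mul1r subrr mul0r addr0.
by rewrite memNset// mul0r add0r subr0 mul1r.
Qed.

Lemma measurable_quasi_lr (S : Omega -> 'M[R]_p) :
  (forall i j, mfun (fun w => S w i j)) -> (forall w, 0 < \det (S w)) ->
  mfun (fun w => quasi_lr D rho n h (dx w) (S w)).
Proof.
move=> mS dS; have mln (A : Omega -> 'M[R]_p) : (forall i j, mfun (fun w => A w i j)) ->
    mfun (fun w => ln (\det (A w))).
  by move=> mA; apply: (measurableT_comp (@measurable_ln R)); exact: measurable_det.
have mN := measurable_num_small; have mC := measurable_cov_estimator_pd.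
apply: measurable_funB; last first.
  by apply: measurable_funM => //; exact: measurable_cst.
apply: measurable_funD; last first.
  apply: measurable_funM => //; apply: measurable_tr_mulmx => // i j.
  exact: measurable_invmx.
by apply: measurable_funB; apply: measurable_funM => //; apply: mln.
Qed.

End statistic.
End measurable_matrices.

(** * Convergence in probability *)

(** The threshold [k] is random. It serves both as a lower bound on [n] and, inverted, as a bound on
    the error, so that raising it only weakens the requirement and one deterministic [k] works with
    probability close to 1. *)
Lemma prob_cvg1_of_eventually d (T : measurableType d) (R : realType)
    (P : probability T R) (G : nat -> set T) (err : nat -> T -> R) :
  (forall n, (0 < n)%N -> measurable (G n)) ->
  (forall n, (0 < n)%N -> measurable_fun setT (err n)) ->
  (forall n w, 0 <= err n w) ->
  (forall n, (0 < n)%N -> P.-integrable setT (EFin \o err n)) ->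
  \int[P]_w err n w @[n --> \oo] --> (0 : R) ->
  {ae P, forall w, exists k : nat, forall n, (k < n)%N ->
    err n w < k.+1%:R^-1 -> G n w} ->
  P (G n) @[n --> \oo] --> 1%E.
Proof.
move=> mG merr err0 ierr Eerr [N [mN N0 NG]].
pose bad n k := [set w | k.+1%:R^-1 <= err n w].
have mbad n k : (0 < n)%N -> measurable (bad n k).
  move=> n0.
  rewrite (_ : bad n k = err n @^-1` `[k.+1%:R^-1, +oo[).
    by rewrite -[X in measurable X]setTI; exact: merr.
  by apply/seteqP; split=> w /=; rewrite in_itv/= andbT.
(* B k increases to a set of probability one, and P (B k) is at most
   P (bad n k) + P (G n), where Markov's inequality controls bad n k. *)
pose B k := \bigcap_(n in [set n | (k < n)%N]) (bad n k `|` G n).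
have mB k : measurable (B k).
  apply: bigcap_measurable; first by exists k.+1 => /=.
  by move=> n /= kn; have n0 := leq_ltn_trans (leq0n k) kn; apply: measurableU; [exact: mbad|exact: mG].
have ndB : nondecreasing_seq B.
  move=> k k' kk'; rewrite subsetEset => w Bw n /= k'n.
  have [|Gw] := Bw n (leq_ltn_trans kk' k'n); last by right.
  rewrite /bad/= => e_le; left; apply: le_trans e_le.
  by rewrite lef_pV2 ?posrE ?ltr0n// ler_nat ltnS.
have mU : measurable (\bigcup_k B k) by exact: bigcupT_measurable.
have PU : P (\bigcup_k B k) = 1%E.
  apply/eqP; rewrite eq_le probability_le1//=.
  have PN : P (~` N) = 1%E by rewrite probability_setC// N0 sube0.
  rewrite -PN le_measure ?inE//; first exact: measurableC.
  move=> w /= Nw; have [k kG] : exists k : nat, forall n, (k < n)%N ->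
      err n w < k.+1%:R^-1 -> G n w.
    by apply: contrapT => /NG.
  exists k => // n /= kn; rewrite /bad/=.
  have [?|e_lt] := leP k.+1%:R^-1 (err n w); first by left.
  by right; exact: kG.
have cvgB : P (B k) @[k --> \oo] --> 1%E.
  by rewrite -PU; exact: nondecreasing_cvg_mu.
have finP A : measurable A -> P A \is a fin_num by move=> ?; exact: fin_num_measure.
have {}cvgB : fine (P (B k)) @[k --> \oo] --> (1 : R).
  exact: fine_cvg cvgB.
suff : fine (P (G n)) @[n --> \oo] --> (1 : R).
  move=> cG; apply/fine_cvgP; split=> //.
  by near=> n; apply: finP; apply: mG; near: n; exists 1%N.
apply/cvgrPdist_le => e e0.
have e20 : 0 < e / 2 by rewrite divr_gt0.
have /cvgrPdist_le/(_ _ e20)[k _ kB] := cvgB.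
have {kB} := kB k (leqnn k); rewrite ler_norml => /andP[_ Bk].
(* Markov's inequality at level [k.+1%:R^-1] costs a factor [k.+1%:R], which is compensated here. *)
have k0 : 0 < e / 2 / k.+1%:R by rewrite divr_gt0// ltr0n.
have Ee := cvgr_le _ Eerr _ k0.
near=> n.
have kn : (k < n)%N by near: n; exists k.+1.
have n0 := leq_ltn_trans (leq0n k) kn.
have mGn : measurable (G n) by exact: mG.
have mbadn := mbad n k n0.
have mErr := merr n n0.
have G1 : fine (P (G n)) <= 1 by rewrite -lee_fin fineK ?finP// probability_le1.
rewrite ger0_norm ?subr_ge0//.
have bad_le : fine (P (bad n k)) <= k.+1%:R * \int[P]_w err n w.
  rewrite mulrC -ler_pdivrMr ?ltr0n// -lee_fin /Rintegral fineK; last first.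
    exact: (integrable_fin_num measurableT (ierr n n0)).
  rewrite EFinM fineK ?finP// muleC -integral_cst//.
  apply: (@le_trans _ _ (\int[P]_(w in bad n k) (err n w)%:E)%E).
    apply: ge0_le_integral => //.
      by move=> w _; rewrite /= lee_fin invr_ge0.
    by apply: measurable_funTS; apply/measurable_EFinP.
  by apply: ge0_subset_integral => //; [exact/measurable_EFinP|move=> w _; rewrite lee_fin].
have : fine (P (B k)) <= fine (P (bad n k)) + fine (P (G n)).
  rewrite -lee_fin EFinD !fineK ?finP//.
  apply: le_trans (measureU2 _ mbadn mGn).
  by rewrite le_measure ?inE//; [exact: measurableU|move=> w; exact].
have Een : \int[P]_w err n w <= e / 2 / k.+1%:R by near: n; exact: Ee.
have : k.+1%:R * \int[P]_w err n w <= e / 2.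
  by rewrite mulrC -ler_pdivlMr// ltr0n.
move: Bk bad_le; lra.
Unshelve. all: by end_near. Qed.

Lemma sqr_sum_le (R : realFieldType) (I : finType) (x : I -> R) :
  (\sum_i x i) ^+ 2 <= #|I|%:R * \sum_i x i ^+ 2.
Proof.
have -> : #|I|%:R * \sum_i x i ^+ 2 = \sum_i \sum_j (x i ^+ 2 + x j ^+ 2) / 2.
  transitivity (\sum_i (#|I|%:R * x i ^+ 2 / 2 + (\sum_j x j ^+ 2) / 2)).
    rewrite big_split/= sumr_const -mulr_suml -mulr_sumr -mulr_natl; lra.
  apply: eq_bigr => i _; rewrite -mulr_suml big_split/= sumr_const.
  by rewrite mulrDl [in LHS]mulr_natl.
rewrite expr2 mulr_suml ler_sum// => i _; rewrite mulr_sumr ler_sum// => j _.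
by have := sqr_ge0 (x i - x j); lra.
Qed.

Lemma Rintegral_sum d (T : measurableType d) (R : realType) (P : {measure set T -> \bar R})
    (I : Type) (s : seq I) (f : I -> T -> R) :
  (forall i, P.-integrable setT (EFin \o f i)) ->
  P.-integrable setT (EFin \o (fun w => \sum_(i <- s) f i w)) /\
  \int[P]_w (\sum_(i <- s) f i w) = \sum_(i <- s) \int[P]_w f i w.
Proof.
move=> fi; elim: s => [|i s [is_ Es]].
  split.
    apply: eq_integrable (integrable0 P setT) => // w _ /=.
    by rewrite big_nil.
  rewrite big_nil; under eq_Rintegral do rewrite big_nil.
  by rewrite Rintegral_cst//= mul0r.
have E w : \sum_(j <- i :: s) f j w = f i w + \sum_(j <- s) f j w by rewrite big_cons.
split; first by apply: eq_integrable (integrableD measurableT (fi i) is_) => // w _ /=; rewrite E.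
by under eq_Rintegral do rewrite E; rewrite RintegralD// Es big_cons.
Qed.

(** * The error functional of the driving noise and its mean *)

Section quadratic_error.
Context (R : realType) (dO : measure_display) (Omega : measurableType dO).
Variables (P : probability Omega R) (F : R -> set (set Omega)).
Variables (d r : latent -> nat).
Variable W : forall i, R -> Omega -> 'cV[R]_(r i).
Variable mu : forall i, Omega -> {measure set (R * 'cV[R]_(d i)) -> \bar R}.
Hypothesis filF : filtration F.
Hypothesis wienerW : forall i, wiener_process P F (W i).
Hypothesis indepW : independent_drivers P F W mu.
Local Notation noise := {i : latent & 'I_(r i)}.

(* The L^1 size of quadratic_error is O(h + h / tau^2), and along any sequence
   where it vanishes the noise has the limiting covariation of Brownian motion. *)
Definition quadratic_error (h tau : R) n w :=
  \sum_(ab : noise * noise) (\sum_(m < n) covariation_error W h ab.1 ab.2 m w) ^+ 2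
  + tau ^- 2 * \sum_(am : noise * 'I_n) noise_increment W h am.1 am.2 w ^+ 4.

Lemma quadratic_error_ge0 h tau n w : 0 <= quadratic_error h tau n w.
Proof.
rewrite addr_ge0 ?sumr_ge0// => [ab _|]; first exact: sqr_ge0.
by rewrite mulr_ge0 ?invr_ge0 ?sqr_ge0// sumr_ge0// => am _; rewrite exprn_even_ge0.
Qed.

Lemma quadratic_error_moment h tau n : 0 < h -> 0 < tau ->
  [/\ measurable_fun setT (quadratic_error h tau n),
      P.-integrable setT (EFin \o quadratic_error h tau n) &
      \int[P]_w quadratic_error h tau n w <=
        #|{: noise * noise}|%:R * (n%:R * (3 * h ^+ 2)) +
        tau ^- 2 * (#|{: noise * 'I_n}|%:R * (3 * h ^+ 2))].
Proof.
move=> h0 tau0.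
have [i1 E1] := @Rintegral_sum _ _ _ P _ (index_enum (noise * noise)%type)
  (fun ab w => (\sum_(m < n) covariation_error W h ab.1 ab.2 m w) ^+ 2)
  (fun ab => (covariation_error_sum filF wienerW indepW h0 ab.1 ab.2 n).1).
have i4 (am : noise * 'I_n) : P.-integrable setT
    (EFin \o (fun w => noise_increment W h am.1 am.2 w ^+ 4)).
  by have [] := noise_increment_moments filF wienerW h0 am.1 am.2.
have [i2 E2] := Rintegral_sum (index_enum (noise * 'I_n)%type) i4.
have i3 : P.-integrable setT (EFin \o (fun w => tau ^- 2 *
    \sum_(am : noise * 'I_n) noise_increment W h am.1 am.2 w ^+ 4)).
  by apply: eq_integrable (integrableZl measurableT (tau ^- 2) i2).
have iE : P.-integrable setT (EFin \o quadratic_error h tau n).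
  by apply: eq_integrable (integrableD measurableT i1 i3).
split=> //.
  by apply/measurable_EFinP; exact: (measurable_int P).
rewrite RintegralD// RintegralZl// E1 E2 lerD//.
  rewrite [leRHS]mulr_natl -sumr_const ler_sum// => ab _.
  exact: (covariation_error_sum filF wienerW indepW h0 ab.1 ab.2 n).2.
rewrite ler_wpM2l ?invr_ge0 ?sqr_ge0// [leRHS]mulr_natl -sumr_const ler_sum// => am _.
by have [] := noise_increment_moments filF wienerW h0 am.1 am.2.
Qed.

Lemma quadratic_error_cvg0 (T D rho : R) : 0 < T -> 0 < D -> 0 < rho -> rho < 2^-1 ->
  \int[P]_w quadratic_error (T / n%:R) (D * (T / n%:R) `^ rho) n w @[n --> \oo] --> (0 : R).
Proof.
move=> T0 D0 rho0 rho_lt.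
pose N : R := #|{: noise}|%:R.
pose u n := 3 * N ^+ 2 * T * (T / n%:R) + 3 * N * T * ((T / n%:R) `^ (1 - 2 * rho) / D ^+ 2).
have h0 : T / n%:R @[n --> \oo] --> (0 : R).
  rewrite -[X in _ --> X](mulr0 T); apply: cvgM; first exact: cvg_cst.
  by apply/gtr0_cvgV0; [near=> n; rewrite ltr0n; near: n; exists 1%N|exact: cvgr_idn].
have u0 : u n @[n --> \oo] --> (0 : R).
  rewrite [X in _ --> X](_ : _ = 3 * N ^+ 2 * T * 0 + 3 * N * T * (0 / D ^+ 2)); last by ring.
  apply: cvgD; (apply: cvgM; first exact: cvg_cst) => //.
  apply: cvgM; last exact: cvg_cst.
  apply: cvg_powR0 => //; first by move: rho_lt; lra.
  by near=> n; rewrite divr_ge0// ltW.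
apply: (squeeze_cvgr _ (cvg_cst (0 : R)) u0); near=> n.
have n0 : (0 < n)%N by near: n; exists 1%N.
have nR : 0 < n%:R :> R by rewrite ltr0n.
have hn : 0 < T / n%:R by rewrite divr_gt0.
have tau0 : 0 < D * (T / n%:R) `^ rho by rewrite mulr_gt0// powR_gt0.
have [_ _ le_E] := quadratic_error_moment n hn tau0.
apply/andP; split.
  by apply: Rintegral_ge0 => w _; exact: quadratic_error_ge0.
apply: (le_trans le_E); rewrite le_eqVlt; apply/orP; left; apply/eqP.
rewrite !card_prod card_ord !natrM /u powRB ?(gt_eqF hn) ?implybT// powRr1 ?(ltW hn)//.
rewrite [2 * rho]mulrC powRrM powR_mulrn ?powR_ge0// -/N.
have : (T / n%:R) `^ rho != 0 by rewrite gt_eqF// powR_gt0.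
move: (_ `^ rho) => z z0; field.
by rewrite (gt_eqF nR) z0 (gt_eqF D0).
Unshelve. all: by end_near. Qed.

End quadratic_error.

(** * Linear images of the driving noise *)

Section linear_noise.
Context {R : realType} (p : nat) (I : finType) (F : set_system nat) {FF : Filter F}.
Variables (T : R) (tau : nat -> R) (x : nat -> I -> nat -> R) (cf : I -> 'cV[R]_p).
Hypothesis Foo : F `=>` \oo.
Let y n m : 'cV[R]_p := \sum_a x n a m *: cf a.

Hypothesis covar0 : forall a b,
  \sum_(m < n) (x n a m * x n b m - (a == b)%:R * (T / n%:R)) @[n --> F] --> 0.
Hypothesis fourth0 :
  tau n ^- 2 * \sum_(am : I * 'I_n) x n am.1 am.2 ^+ 4 @[n --> F] --> 0.

Let yE n m j : y n m j ord0 = \sum_a x n a m * cf a j ord0.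
Proof. by rewrite summxE; apply: eq_bigr => a _; rewrite mxE. Qed.

Lemma linear_noise_covariation j k :
  \sum_(m < n) y n m j ord0 * y n m k ord0 @[n --> F] -->
  T * (\sum_a cf a *m (cf a)^T) j k.
Proof.
(* The realized covariation expanded by bilinearity; the compensators [(a == b)%:R * (T / n%:R)] sum
   to [(a == b)%:R * T], which is added back. *)
pose Q n := \sum_a \sum_b cf a j ord0 * cf b k ord0 *
  (\sum_(m < n) (x n a m * x n b m - (a == b)%:R * (T / n%:R)) + (a == b)%:R * T).
have : Q n @[n --> F] --> \sum_a \sum_b cf a j ord0 * cf b k ord0 * (0 + (a == b)%:R * T).
  apply: cvg_sumr => a _; apply: cvg_sumr => b _.
  apply: cvgM; first exact: cvg_cst.
  by apply: cvgD => //; exact: cvg_cst.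
rewrite [X in _ --> X -> _](_ : _ = T * (\sum_a cf a *m (cf a)^T) j k); last first.
  rewrite summxE mulr_sumr; apply: eq_bigr => a _.
  rewrite (bigD1 a)//= eqxx big1 => [|b /negPf ba]; last by rewrite eq_sym ba mul0r addr0 mulr0.
  by rewrite add0r mul1r mxE big_ord1 mxE; ring.
apply: cvg_trans; apply: near_eq_cvg; near=> n.
have n0 : (0 < n)%N by near: n; apply: Foo; exists 1%N.
rewrite /Q; transitivity (\sum_a \sum_b \sum_(m < n)
    (x n a m * cf a j ord0) * (x n b m * cf b k ord0)).
  apply: eq_bigr => a _; apply: eq_bigr => b _.
  rewrite sumrB sumr_const card_ord -[X in _ - X]mulr_natr.
  rewrite (_ : _ * (T / n%:R) * n%:R = (a == b)%:R * T); last first.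
    by field; rewrite pnatr_eq0 -lt0n.
  by rewrite subrK mulr_sumr; apply: eq_bigr => m _; ring.
under eq_bigr do rewrite exchange_big/=.
rewrite exchange_big/=; apply: eq_bigr => m _; rewrite !yE mulr_suml.
by apply: eq_bigr => a _; rewrite mulr_sumr.
Unshelve. all: by end_near. Qed.

(** Cauchy-Schwarz twice: [enorm (y n m) ^+ 2] is bounded by the squared coordinates of the noise,
    with factor [p * N * B]; squaring costs a further factor [N]. Hence the constant [C]. *)
Lemma linear_noise_fourth :
  (\sum_(m < n) enorm (y n m) ^+ 4) / tau n ^+ 2 @[n --> F] --> 0.
Proof.
pose N : R := #|I|%:R; pose B := \sum_a enorm (cf a) ^+ 2.
have B0 : 0 <= B by apply: sumr_ge0 => a _; exact: sqr_ge0.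
pose C := (p%:R * N * B) ^+ 2 * N.
have y2 n m : enorm (y n m) ^+ 2 <= p%:R * N * B * \sum_a x n a m ^+ 2.
  rewrite sqr_enorm_cV.
  have -> : p%:R * N * B * (\sum_a x n a m ^+ 2) =
      \sum_(j < p) N * B * \sum_a x n a m ^+ 2.
    by rewrite sumr_const card_ord -mulr_natl; ring.
  apply: ler_sum => j _; rewrite yE (le_trans (sqr_sum_le _))// -mulrA ler_wpM2l//.
  rewrite mulr_sumr ler_sum// => a _; rewrite exprMn mulrC ler_wpM2r ?sqr_ge0//.
  rewrite (@le_trans _ _ (enorm (cf a) ^+ 2))//.
    rewrite -[leLHS]real_normK ?num_real// lerXn2r ?nnegrE ?enorm_ge0//.
    exact: ler_norm_enorm.
  by rewrite /B (bigD1 a)//= lerDl sumr_ge0// => b _; exact: sqr_ge0.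
have y4 n m : enorm (y n m) ^+ 4 <= C * \sum_a x n a m ^+ 4.
  rewrite (exprM _ 2 2) (le_trans (_ : _ <= (p%:R * N * B * \sum_a x n a m ^+ 2) ^+ 2))//.
    rewrite lerXn2r ?nnegrE ?sqr_ge0// mulr_ge0 ?sumr_ge0// => [|a _]; last exact: sqr_ge0.
    by rewrite !mulr_ge0.
  rewrite exprMn /C -[leRHS]mulrA ler_wpM2l ?sqr_ge0// (le_trans (sqr_sum_le _))//.
  by rewrite ler_wpM2l// ler_sum// => a _; rewrite -exprM.
have C0 : C * (tau n ^- 2 * \sum_(am : I * 'I_n) x n am.1 am.2 ^+ 4) @[n --> F] --> 0.
  by rewrite -[X in _ --> X](mulr0 C); apply: cvgM => //; exact: cvg_cst.
apply: (squeeze_cvgr _ (cvg_cst (0 : R)) C0); near=> n; apply/andP; split.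
  by rewrite divr_ge0 ?sqr_ge0// sumr_ge0// => m _; rewrite exprn_even_ge0.
rewrite mulrCA [leRHS]mulrC ler_wpM2r ?invr_ge0 ?sqr_ge0//.
rewrite (_ : \sum_(am : I * 'I_n) _ = \sum_(m < n) \sum_a x n a m ^+ 4).
  by rewrite mulr_sumr ler_sum.
by rewrite exchange_big pair_bigA.
Unshelve. all: by end_near. Qed.

End linear_noise.

(** * Reduced form of the structural model *)

Lemma big_latent (V : zmodType) (f : latent -> V) :
  \sum_i f i = f Xi + f Delta + f Epsilon + f Zeta.
Proof.
have ne (i j : latent) : i <> j -> i != j by move=> ij; apply/eqP.
rewrite (bigD1 Xi)// (bigD1 Delta) ?ne// (bigD1 Epsilon) ?ne// (bigD1 Zeta) ?ne//=.
rewrite big_pred0 ?addr0; first by rewrite !addrA.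
by case; rewrite ?eqxx ?andbF.
Qed.

Section loading.
Context {R : realType} (p1 p2 k1 k2 : nat).
Variables (L1 : 'M[R]_(p1, k1)) (L2 : 'M[R]_(p2, k2)) (Gam : 'M[R]_(k2, k1)).
Variable Psi : 'M[R]_k2.

(** Coefficient of each latent process in [X] once [eta] is eliminated through
    [eta = invmx Psi *m (Gam *m xi + zeta)]. *)
Definition loading (i : latent) : 'M[R]_(p1 + p2, latent_dim p1 p2 k1 k2 i) :=
  match i with
  | Xi => col_mx L1 (L2 *m invmx Psi *m Gam)
  | Delta => col_mx 1%:M 0
  | Epsilon => col_mx 0 1%:M
  | Zeta => col_mx 0 (L2 *m invmx Psi)
  end.

Lemma loading_cov (r : latent -> nat) (M : forall i, 'M[R]_(latent_dim p1 p2 k1 k2 i, r i)) :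
  \sum_i (loading i *m M i) *m (loading i *m M i)^T =
  model_cov L1 L2 Gam Psi (M Xi *m (M Xi)^T) (M Delta *m (M Delta)^T)
    (M Epsilon *m (M Epsilon)^T) (M Zeta *m (M Zeta)^T).
Proof.
rewrite big_latent /= /model_cov.
have outer k l (U : 'M[R]_(p1, k)) (V : 'M[R]_(p2, k)) (N : 'M[R]_(k, l)) :
    (col_mx U V *m N) *m (col_mx U V *m N)^T =
    block_mx (U *m (N *m N^T) *m U^T) (U *m (N *m N^T) *m V^T)
             (V *m (N *m N^T) *m U^T) (V *m (N *m N^T) *m V^T).
  by rewrite trmx_mul tr_col_mx -mulmxA (mulmxA N) mul_mx_row mul_col_row !mulmxA.
rewrite !outer !mul1mx !mul0mx !trmx1 !trmx0 !mulmx1 !mulmx0 !add_block_mx !addr0 ?add0r.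
rewrite !trmx_mul !trmxK !mulmxDr !mulmxDl !mulmxA.
by congr block_mx; rewrite addrAC.
Qed.

Lemma loading_state (x : forall i, 'cV[R]_(latent_dim p1 p2 k1 k2 i)) (eta : 'cV[R]_k2)
    (B0 : 'M[R]_k2) : Psi = 1%:M - B0 -> Psi \in unitmx ->
  eta = B0 *m eta + Gam *m x Xi + x Zeta ->
  col_mx (L1 *m x Xi + x Delta) (L2 *m eta + x Epsilon) = \sum_i loading i *m x i.
Proof.
move=> PsiE uPsi etaE.
have {etaE} -> : eta = invmx Psi *m (Gam *m x Xi + x Zeta).
  have : Psi *m eta = Gam *m x Xi + x Zeta.
    apply/eqP; rewrite PsiE mulmxBl mul1mx subr_eq addrC addrA.
    by apply/eqP.
  by move=> <-; rewrite mulKmx.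
rewrite big_latent /= !mul_col_mx !mul1mx !mul0mx !add_col_mx ?addr0 ?add0r.
by rewrite !mulmxDr !mulmxA; congr col_mx; rewrite addrAC.
Qed.

End loading.

(** Flattens the vector noises into scalar coordinates, each weighted by a column; the next lemma
    does the same for the covariance. *)
Lemma sum_col_mul (R : realType) (I : finType) (r : I -> nat) p
    (B : forall i, 'M[R]_(p, r i)) (v : forall i, 'cV[R]_(r i)) :
  \sum_(a : {i : I & 'I_(r i)}) v (tag a) (tagged a) ord0 *: col (tagged a) (B (tag a)) =
  \sum_i B i *m v i.
Proof.
transitivity (\sum_i \sum_(j < r i) v i j ord0 *: col j (B i)).
  exact/esym/(sig_big_dep xpredT (fun _ => xpredT)
    (fun i (j : 'I_(r i)) => v i j ord0 *: col j (B i))).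
apply: eq_bigr => i _; apply/matrixP => k l; rewrite summxE !mxE.
by apply: eq_bigr => j _; rewrite !mxE (ord1 l) mulrC.
Qed.

Lemma sum_col_outer (R : realType) (I : finType) (r : I -> nat) p
    (B : forall i, 'M[R]_(p, r i)) :
  \sum_(a : {i : I & 'I_(r i)}) col (tagged a) (B (tag a)) *m (col (tagged a) (B (tag a)))^T =
  \sum_i B i *m (B i)^T.
Proof.
transitivity (\sum_i \sum_(j < r i) col j (B i) *m (col j (B i))^T).
  exact/esym/(sig_big_dep xpredT (fun _ => xpredT)
    (fun i (j : 'I_(r i)) => col j (B i) *m (col j (B i))^T)).
apply: eq_bigr => i _; apply/matrixP => k l; rewrite summxE !mxE.
by apply: eq_bigr => j _; rewrite !mxE big_ord1 !mxE.
Qed.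

Theorem theorem4
  (R : realType) (dO : measure_display) (Omega : measurableType dO)
  (P : probability Omega R) (F : R -> set (set Omega))
  (p1 p2 k1 k2 q : nat) (r : latent -> nat)
  (* latent processes *)
  (x0 : forall i, 'cV[R]_(latent_dim p1 p2 k1 k2 i))
  (a : forall i, 'cV[R]_(latent_dim p1 p2 k1 k2 i) ->
    'cV[R]_(latent_dim p1 p2 k1 k2 i))
  (c : forall i, 'cV[R]_(latent_dim p1 p2 k1 k2 i) ->
    'cV[R]_(latent_dim p1 p2 k1 k2 i) -> 'cV[R]_(latent_dim p1 p2 k1 k2 i))
  (M : forall i, 'M[R]_(latent_dim p1 p2 k1 k2 i, r i))
  (lambda0 : latent -> R)
  (dens : forall i, 'cV[R]_(latent_dim p1 p2 k1 k2 i) -> R)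
  (W : forall i, R -> Omega -> 'cV[R]_(r i))
  (mu : forall i, Omega ->
    {measure set (R * 'cV[R]_(latent_dim p1 p2 k1 k2 i)) -> \bar R})
  (S : forall i, R -> Omega -> 'cV[R]_(latent_dim p1 p2 k1 k2 i))
  (* structural model and observed process *)
  (L1 : 'M[R]_(p1, k1)) (L2 : 'M[R]_(p2, k2)) (Gam : 'M[R]_(k2, k1))
  (B0 : 'M[R]_k2)
  (eta : R -> Omega -> 'cV[R]_k2) (X : R -> Omega -> 'cV[R]_(p1 + p2))
  (* parametric model *)
  (Theta : set 'cV[R]_q)
  (L1th : 'cV[R]_q -> 'M[R]_(p1, k1)) (L2th : 'cV[R]_q -> 'M[R]_(p2, k2))
  (Gamth : 'cV[R]_q -> 'M[R]_(k2, k1)) (Psith : 'cV[R]_q -> 'M[R]_k2)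
  (Sxxth : 'cV[R]_q -> 'M[R]_k1) (Sddth : 'cV[R]_q -> 'M[R]_p1)
  (Seeth : 'cV[R]_q -> 'M[R]_p2) (Szzth : 'cV[R]_q -> 'M[R]_k2)
  (thetastar : 'cV[R]_q)
  (* sampling scheme and estimator *)
  (T D rho alpha : R) (thetahat : nat -> Omega -> 'cV[R]_q) :
  let f := fun i z => lambda0 i * dens i z in
  let Psi := 1%:M - B0 in
  let Sigmastar := model_cov L1 L2 Gam Psi (M Xi *m (M Xi)^T)
    (M Delta *m (M Delta)^T) (M Epsilon *m (M Epsilon)^T)
    (M Zeta *m (M Zeta)^T) in
  let Sigma := fun th => model_cov (L1th th) (L2th th) (Gamth th) (Psith th)
    (Sxxth th) (Sddth th) (Seeth th) (Szzth th) in
  let U := fun th => contrast (Sigma th) Sigmastar in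
  let p := (p1 + p2)%N in
  let pbar := ((p * p.+1) %/ 2)%N in
  let h := fun n : nat => T / n%:R in
  let dX := fun n w => increment X (h n) w in
  let H := fun n w th => quasi_loglik D rho n (h n) (dX n w) (Sigma th) in
  let Tn := fun n w =>
    quasi_lr D rho n (h n) (dX n w) (Sigma (thetahat n w)) in
  (0 < k1 <= p1)%N -> (0 < k2 <= p2)%N ->
  (* stochastic basis, driving noises and latent processes *)
  filtration F ->
  (forall i, wiener_process P F (W i)) ->
  (forall i, 0 < lambda0 i /\ probability_density (dens i)) ->
  (forall i, poisson_random_measure P F (mu i) (f i)) ->
  independent_drivers P F W mu ->
  (forall i, measurable_fun setT (a i)) ->
  (forall i, measurable_fun (setT `*` nonzero) (fun y => c i y.1 y.2)) ->
  (forall i, cadlag (S i) /\ adapted F (S i)) ->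
  (forall i, sde_solution P (x0 i) (a i) (M i) (c i) (W i) (mu i) (S i)) ->
  (* structural equations *)
  \rank L1 = k1 -> \rank L2 = k2 ->
  (forall j, B0 j j = 0) -> Psi \in unitmx ->
  (forall t w, 0 <= t ->
    eta t w = B0 *m eta t w + Gam *m S Xi t w + S Zeta t w) ->
  (forall t w, 0 <= t ->
    X t w = col_mx (L1 *m S Xi t w + S Delta t w)
                   (L2 *m eta t w + S Epsilon t w)) ->
  posdef Sigmastar ->
  (* parametrization *)
  compact Theta -> convex_set Theta ->
  (forall j, is_entry Theta j L1th \/ is_entry Theta j L2th \/
    is_entry Theta j Gamth \/ is_entry Theta j Psith \/
    is_entry Theta j Sxxth \/ is_entry Theta j Sddth \/
    is_entry Theta j Seeth \/ is_entry Theta j Szzth) ->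
  (forall th, Theta th -> Psith th \in unitmx) ->
  (forall th, Theta th -> posdef (Sigma th)) ->
  Ck_near 2 Theta Sigma ->
  (q < pbar)%N ->
  (* the alternative hypothesis H_1 *)
  (forall th, Theta th -> Sigmastar <> Sigma th) ->
  Theta thetastar -> U thetastar = inf [set U th | th in Theta] ->
  (* sampling scheme and estimator *)
  0 < T -> 0 < D -> 3^-1 <= rho < 2^-1 ->
  (forall n, measurable_fun setT (thetahat n)) ->
  (forall n w, (0 < n)%N -> Theta (thetahat n w) /\
    H n w (thetahat n w) = sup [set H n w th | th in Theta]) ->
  (* assumptions of the theorem *)
  (forall i, lipschitz_coefficients (a i) (c i)) ->
  (forall i, smooth_drift (a i)) ->
  (forall i, jump_density_condition (f i)) ->
  (forall i, jump_size_condition (c i)) ->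
  (forall th, Theta th -> U th = U thetastar -> th = thetastar) ->
  0 < alpha < 1 ->
  P [set w | chi2_upper (pbar - q) alpha < Tn n w] @[n --> \oo] --> 1%E.
Proof.
move=> f Psi Sstar Sigma U p pbar h dX H Tn _ _ filF wien dens0 prm indep ma mc cadS sde.
move=> _ _ _ uPsi etaE XE pSstar cTheta _ _ _ pSigma CkSigma _ notin Tts Uts T0 D0.
move=> /andP[rho_ge rho_lt] mth thopt lip _ _ _ _ _.
set chi := chi2_upper _ _.
have rho0 : 0 < rho by apply: lt_le_trans rho_ge; rewrite invr_gt0.
pose A := loading L1 L2 Gam Psi.
pose B i := A i *m M i.
pose cf (a : {i : latent & 'I_(r i)}) := col (tagged a) (B (tag a)).
have covE : \sum_a cf a *m (cf a)^T = Sstar.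
  by rewrite /cf sum_col_outer /B loading_cov.
pose err n w := quadratic_error W (h n) (D * h n `^ rho) n w.
(* The Gaussian part of the observed increment: the Wiener increments sent through [M i] and the
   loadings, written over scalar coordinates. *)
pose y n m w := \sum_a noise_increment W (h n) a m w *: cf a.
have h0 n : (0 < n)%N -> 0 < h n by move=> n0; rewrite divr_gt0// ltr0n.
have tau0 n : (0 < n)%N -> 0 < D * h n `^ rho.
  by move=> n0; rewrite mulr_gt0// powR_gt0// h0.
have Xsum t w : 0 <= t -> X t w = \sum_i A i *m S i t w.
  move=> t0; rewrite XE//.
  apply: (@loading_state R p1 p2 k1 k2 L1 L2 Gam Psi (fun i => S i t w) (eta t w) B0) => //.
  exact: etaE.
have grid_ge0 n m : 0 <= m%:R * h n by rewrite !mulr_ge0 ?invr_ge0// ltW.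
have mX t : 0 <= t -> forall i, measurable_fun setT (fun w => X t w i ord0).
  move=> t0 k; rewrite (_ : (fun w => _) =
      (fun w => \sum_i \sum_j A i k j * S i t w j ord0)); last first.
    apply/funext => w; rewrite Xsum// summxE; apply: eq_bigr => i _.
    by rewrite mxE.
  apply: measurable_sum => i; apply: measurable_sum => j.
  apply: measurable_funM => //.
  have mS : measurable_fun setT (S i t).
    move=> _ E mE; rewrite setTI; have [_ Fm _] := filF.
    exact: Fm t0 _ ((cadS i).2 t t0 E mE).
  exact: (measurableT_comp (measurable_mx_entry j ord0) mS).
have mdX n m i : measurable_fun setT (fun w => dX n w m i ord0).
  rewrite (_ : (fun w => _) = (fun w => X (m.+1%:R * h n) w i ord0) \-
    (fun w => X (m%:R * h n) w i ord0)).
    by apply: measurable_funB; exact: mX.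
  by apply/funext => w; rewrite /dX /increment !mxE.
have [kap kap0 contrast_ge] := contrast_lower_bound cTheta CkSigma pSigma pSstar Tts
  (notin _ Tts) Uts.
apply: (@prob_cvg1_of_eventually _ _ _ P _ err).
- move=> n n0.
  have mS i j : measurable_fun setT (fun w => Sigma (thetahat n w) i j).
    (* Regularity of [Sigma] is known through its extension [g], continuous on the open set [V]; it
       coincides with [Sigma] at [thetahat n], which takes its values in [Theta]. *)
    have [V [g [oV TV gS Cg]]] := CkSigma.
    rewrite (_ : (fun w => _) = (fun th => g th i j) \o thetahat n); last first.
      by apply/funext => w /=; rewrite gS//; have [] := thopt n w n0.
    apply: (measurable_comp (open_measurable_cV oV)) (mth n).
      by move=> _ [w _ <-]; apply: TV; have [] := thopt n w n0.
    apply: measurable_continuous_cV => // th Vth.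
    have [/(_ th Vth) cg _] := Cg [::] isT.
    exact: (continuous_comp cg (@coord_continuous _ _ _ i j _)).
  have dS w : 0 < \det (Sigma (thetahat n w)).
    by have [Th _] := thopt n w n0; have [] := posdef_stein (pSigma _ Th).
  have mTn : measurable_fun setT (Tn n).
    exact: (measurable_quasi_lr D rho n0 (h0 n n0) (mdX n) mS dS).
  rewrite (_ : [set w | _] = setT `&` Tn n @^-1` `]chi, +oo[); last first.
    by rewrite setTI; apply/seteqP; split=> w /=; rewrite in_itv/= andbT.
  exact: mTn.
- by move=> n n0; have [] := quadratic_error_moment filF wien indep n (h0 n n0) (tau0 n n0).
- by move=> n w; exact: quadratic_error_ge0.
- by move=> n n0; have [] := quadratic_error_moment filF wien indep n (h0 n n0) (tau0 n n0).
- exact: (quadratic_error_cvg0 filF wien indep T0 D0 rho0 rho_lt).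
pose cell i n m : set (R * 'cV[R]_(latent_dim p1 p2 k1 k2 i)) :=
  `]m%:R * h n, m.+1%:R * h n] `*` nonzero.
have aeL : {ae P, forall w, forall i, exists C (K : nat), 0 <= C /\ forall n, (0 < n)%N ->
    (\sum_(m < n) (mu i w (cell i n m) != 0%E) <= K)%N /\
    forall m j, (m < n)%N -> mu i w (cell i n m) = 0%E ->
      `|(S i (m.+1%:R * h n) w - S i (m%:R * h n) w -
         M i *m (W i (m.+1%:R * h n) w - W i (m%:R * h n) w)) j ord0| <= C * h n}.
  apply: filter_forall => i; have [l0 pd] := dens0 i; have [cad _] := cadS i.
  exact: (latent_increment_approx T0 (prm i) l0 pd (ma i) (mc i) (lip i) cad (sde i)).
apply: filterS aeL => w /choice[C /choice[K CK]].
(* A cell is marked as soon as one latent process may jump in it, so the four counts add up. *)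
pose J n m := [exists i, mu i w (cell i n m) != 0%E].
have JK n : (\sum_(m < n) J n m <= \sum_i K i)%N.
  case: n => [|n]; first by rewrite big_ord0.
  apply: (@leq_trans (\sum_(m < n.+1) \sum_i
      (mu i w (cell i n.+1 m) != 0%E))%N).
    apply: leq_sum => m _; rewrite /J; case: existsP => //= -[i mui].
    by rewrite (bigD1 i)//= mui.
  rewrite exchange_big; apply: leq_sum => i _.
  by have [_ /(_ n.+1 isT)[]] := CK i.
(* The sum over the row [k] is a crude maximum, giving one constant for all coordinates of the
   observed increment. *)
pose C1 := \sum_k \sum_i \sum_j `|A i k j| * C i.
have C1_ge0 : 0 <= C1.
  apply: sumr_ge0 => k _; apply: sumr_ge0 => i _; apply: sumr_ge0 => j _.
  by rewrite mulr_ge0//; have [] := CK i.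
pose C2 := (p1 + p2).+1%:R * C1.
have C2_ge0 : 0 <= C2 by rewrite mulr_ge0.
have dxy n m : (m < n)%N -> ~~ J n m -> enorm (dX n w m - y n m w) <= C2 * h n.
  move=> mn nJ; have n0 : (0 < n)%N by apply: leq_ltn_trans mn.
  have {}nJ i : mu i w (cell i n m) = 0%E.
    by apply/eqP; apply: contraNT nJ => mui; apply/existsP; exists i.
  rewrite /C2 -mulrA; apply: enorm_le_card.
    by rewrite mulr_ge0// ltW// h0.
  move=> k.
  have -> : dX n w m - y n m w = \sum_i A i *m
      (S i (m.+1%:R * h n) w - S i (m%:R * h n) w -
       M i *m (W i (m.+1%:R * h n) w - W i (m%:R * h n) w)).
    rewrite /dX /increment !Xsum// /y.
    rewrite (sum_col_mul B (fun i => W i (m.+1%:R * h n) w - W i (m%:R * h n) w)).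
    rewrite -!sumrB; apply: eq_bigr => i _.
    by rewrite /B -mulmxA !mulmxBr.
  apply: (@le_trans _ _ ((\sum_i \sum_j `|A i k j| * C i) * h n)); last first.
    rewrite ler_wpM2r ?(ltW (h0 _ n0))// /C1 (bigD1 k)//= lerDl.
    apply: sumr_ge0 => l _; apply: sumr_ge0 => i _; apply: sumr_ge0 => j _.
    by rewrite mulr_ge0//; have [] := CK i.
  rewrite summxE mulr_suml; apply: le_trans (ler_norm_sum _ _ _) _.
  apply: ler_sum => i _; rewrite mxE mulr_suml.
  apply: le_trans (ler_norm_sum _ _ _) _; apply: ler_sum => j _.
  rewrite normrM -mulrA ler_wpM2l//.
  by have [_ /(_ n n0)[_]] := CK i; apply.
(* The exceptional null set does not depend on n; the rest of the argument is
   pathwise, along the filter Fl on which err n w tends to 0. *)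
pose Fl : set_system nat := fun Q => exists k : nat, forall n, (k < n)%N ->
  err n w < k.+1%:R^-1 -> Q n.
change (Fl (fun n => chi < Tn n w)).
(* On a path along which [err] stays away from 0, [Fl] contains the empty set, so it is a filter but
   possibly not a proper one. *)
have FF : Filter Fl.
  split=> [|Q Q' [ka Q1] [kb Q2]|Q Q' QQ' [k kQ]].
  - by exists 0%N.
  - exists (maxn ka kb) => n kn en.
    have le k : (k <= maxn ka kb)%N -> (k < n)%N /\ err n w < k.+1%:R^-1.
      move=> kk; split; first exact: leq_ltn_trans kn.
      by apply: lt_le_trans en _; rewrite lef_pV2 ?posrE// ler_nat ltnS.
    have [? ?] := le _ (leq_maxl _ _); have [? ?] := le _ (leq_maxr ka kb).
    by split; [exact: Q1|exact: Q2].
  - by exists k => n kn en; exact/QQ'/kQ.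
have Foo : Fl `=>` \oo.
  by move=> Q [N _ NQ]; exists N => n Nn _; apply: NQ; exact: ltnW.
have err_ge0 n : 0 <= err n w by exact: quadratic_error_ge0.
have err_cvg : err n w @[n --> Fl] --> (0 : R).
  apply/cvgrPdist_lt => e e0; have [N _ /(_ N (leqnn N)) /= Ne] := near_infty_natSinv_lt (PosNum e0).
  by exists N => n _ en; rewrite sub0r normrN ger0_norm//; exact: lt_trans en Ne.
pose x n b m := noise_increment W (h n) b m w.
have covar0 b b' :
    \sum_(m < n) (x n b m * x n b' m - (b == b')%:R * (T / n%:R)) @[n --> Fl] --> (0 : R).
  (* The square of this sum is one of the nonnegative summands of [err n w], so [err n w < e ^+ 2]
     is enough. *)
  apply/cvgrPdist_lt => e e0; have e20 : 0 < e ^+ 2 by rewrite exprn_gt0.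
  apply: filterS (cvgr_lt _ err_cvg _ e20) => n en.
  rewrite sub0r normrN -(@ltr_pXn2r _ 2)// ?nnegrE ?(ltW e0)// real_normK ?num_real//.
  apply: le_lt_trans en; rewrite /err /quadratic_error (bigD1 (b, b'))//= -addrA lerDl.
  rewrite addr_ge0//; first by apply: sumr_ge0 => bb _; exact: sqr_ge0.
  by rewrite mulr_ge0// ?invr_ge0 ?sqr_ge0// sumr_ge0// => am _; rewrite exprn_even_ge0.
have fourth0 : (D * h n `^ rho) ^- 2 * \sum_(am : {i : latent & 'I_(r i)} * 'I_n)
    x n am.1 am.2 ^+ 4 @[n --> Fl] --> (0 : R).
  apply: (@squeeze_cvgr _ _ _ _ (fun=> 0) (fun n => err n w)) => //; last exact: cvg_cst.
  apply: nearW => n.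
  apply/andP; split.
    by rewrite mulr_ge0// ?invr_ge0 ?sqr_ge0// sumr_ge0// => am _; rewrite exprn_even_ge0.
  by rewrite /err /quadratic_error lerDr; apply: sumr_ge0 => bb _; exact: sqr_ge0.
have yS j k := @linear_noise_covariation R _ _ Fl FF T x cf Foo covar0 j k.
have V0 := @linear_noise_fourth R _ _ Fl FF _ x cf fourth0.
rewrite covE in yS.
pose y' n m := y n m w.
have Ncvg := @num_small_near_pos R _ Fl FF T D rho (dX^~ w) y' J (\sum_i K i) C2
  T0 D0 rho0 rho_lt Foo dxy JK V0.
have Ccvg := @cov_estimator_cvg R _ Fl FF T D rho (dX^~ w) y' J (\sum_i K i) C2 Sstar
  T0 D0 rho0 rho_lt Foo C2_ge0 dxy JK V0 yS.
have [dS _ _] := posdef_stein pSstar.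
have detP := cvgr_gt _ (cvg_det Ccvg) _ dS.
have kapP := contrast_ge _ Fl _ FF Ccvg.
(* At least [n / 2] increments are kept and the contrast is at least [kap], so the statistic is at
   least [n / 2 * kap]; this is the size of [n] beyond which that exceeds [|chi|]. *)
have large : \forall n \near Fl, 2 * `|chi| / kap < n%:R by apply: Foo; exact: nbhs_infty_gtr.
have pos : \forall n \near Fl, (0 < n)%N by apply: Foo; exists 1%N.
near=> n.
have n0 : (0 < n)%N by near: n.
have Chat : cov_estimator_pd D rho n (h n) (dX n w) = cov_estimator D rho n (h n) (dX n w).
  rewrite (cov_estimator_pdE D rho (dX n) n0 (h0 n n0) w) gt_eqF//.
  by near: n; exact: detP.
have -> : Tn n w = (num_small D rho n (h n) (dX n w))%:R *
    contrast (Sigma (thetahat n w)) (cov_estimator D rho n (h n) (dX n w)).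
  by rewrite /Tn /quasi_lr /contrast Chat; ring.
have [Th _] := thopt n w n0.
have contr : kap <= contrast (Sigma (thetahat n w)) (cov_estimator D rho n (h n) (dX n w)).
  by move: (thetahat n w) Th; near: n; exact: kapP.
have Nlarge : n%:R / 2 <= (num_small D rho n (h n) (dX n w))%:R :> R by near: n; exact: Ncvg.
have nlarge : 2 * `|chi| / kap < n%:R by near: n; exact: large.
apply: le_lt_trans (ler_norm chi) _.
apply: (@lt_le_trans _ _ (n%:R / 2 * kap)).
  by move: nlarge; rewrite ltr_pdivrMr//; lra.
by apply: ler_pM => //; rewrite ?ltW// divr_ge0.
Unshelve. all: by end_near.
Qed.
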